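(* Consider the system of distributional equations, with unknown laws of real random variables $X$ and $Y$, $$ (\ast)\qquad\left\{ \begin{array}{l} \displaystyle X\overset{\mathcal L}{=}\sum_{k=1}^{a+1}V_k^{\sigma}X^{(k)}+\sum_{k=a+2}^{S+1}V_k^{\sigma}Y^{(k)}\\[2ex] \displaystyle Y\overset{\mathcal L}{=}\sum_{k=1}^{c}V_k^{\sigma}X^{(k)}+\sum_{k=c+1}^{S+1}V_k^{\sigma}Y^{(k)} \end{array} \right. $$ where $V=(V_1,\dots,V_{S+1})$ is Dirichlet distributed with parameters $\left(\frac1S,\dots,\frac1S\right)$, and the $X^{(k)}$ and $Y^{(k)}$ are respective copies of $X$ and $Y$, all being independent of each other and of $V$. (i) When $B$ and $C$ are real numbers that satisfy $cB+bC=0$, the system $(\ast)$ has a unique solution in $\mathcal M_2(B)\times\mathcal M_2(C)$. (ii) The pair $\left(X^{DT},Y^{DT}\right)=\left(W^{DT}_{(1,0)},W^{DT}_{(0,1)}\right)$ is the unique (in law) solution of the system $(\ast)$ having $$\left(\frac{\Gamma\left(\frac1S\right)}{\Gamma\left(\frac{m+1}S\right)}\frac bS,\ -\frac{\Gamma\left(\frac1S\right)}{\Gamma\left(\frac{m+1}S\right)}\frac cS\right)$$ as expectation and a finite second moment.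
   Context: Standing assumptions on the urn: $a,b,c,d$ are nonnegative integers with $a+b=c+d=:S$ (balanced), $bc\neq0$ (non triangular), $m:=a-c=d-b$, $\sigma:=m/S$, and the urn is large, i.e. $\sigma>\frac12$. For $A\in\mathbb R$, $\mathcal M_2(A)$ is the space of probability distributions on $\mathbb R$ having expectation $A$ and a finite second moment. A solution of the system in $\mathcal M_2(B)\times\mathcal M_2(C)$ is a pair of laws $(\mu,\nu)$, $\mu\in\mathcal M_2(B)$, $\nu\in\mathcal M_2(C)$, such that the system holds for $X\sim\mu$, $Y\sim\nu$. Discrete time urn: start with $\alpha$ red and $\beta$ black balls, $(\alpha,\beta)\in\mathbb N^2\setminus\{(0,0)\}$. At each time step a ball is drawn uniformly at random among the balls of the urn and put back; if it is red, $a$ red and $b$ black balls are added; if it is black, $c$ red and $d$ black balls are added. $U^{DT}_{(\alpha,\beta)}(n)\in\mathbb N^2$ is the composition vector (number of red balls, number of black balls) after $n$ draws. Let $u_2(x,y)=\frac1S(bx-cy)$. It is known that the limit $$W^{DT}_{(\alpha,\beta)}:=\lim_{n\to+\infty}\frac1{n^{\sigma}}u_2\left(U^{DT}_{(\alpha,\beta)}(n)\right)$$ exists almost surely and in $L^p$ for every $p\ge1$. $\overset{\mathcal L}{=}$ denotes equality in distribution; $\Gamma$ is Euler's Gamma function. The Dirichlet distribution with positive parameters $(\nu_1,\dots,\nu_d)$ is the probability law on the simplex $\{x\in[0,1]^d:\sum_k x_k=1\}$ with density proportional to $\prod_{k=1}^d x_k^{\nu_k-1}$. *)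

(* Defs.v *)
From mathcomp Require Import all_boot all_order all_algebra.
From mathcomp Require Import all_classical all_reals all_analysis.

Set Implicit Arguments.
Unset Strict Implicit.
Unset Printing Implicit Defensive.

Import Order.TTheory GRing.Theory Num.Theory.
Import numFieldNormedType.Exports.

Local Open Scope classical_set_scope.
Local Open Scope ring_scope.

Definition Gamma (R : realType) (x : R) : R :=
  \int[lebesgue_measure]_(t in `]0, +oo[) (t `^ (x - 1) * expR (- t)).

(* Measures are functions on all of [set T], and only their values on
   measurable sets are meaningful: equality of laws is equality there. *)
Definition same_law (R : realType) (d : measure_display)
    (T : measurableType d) (mu nu : probability T R) : Prop :=
  forall A : set T, measurable A -> mu A = nu A.

Definition has_law (R : realType) (d d' : measure_display)
    (T : measurableType d) (T' : measurableType d')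
    (P : probability T R) (f : T -> T') (mu : probability T' R) : Prop :=
  forall A : set T', measurable A -> P (f @^-1` A) = mu A.

Definition in_M2 (R : realType) (A : R) (mu : probability R R) : Prop :=
  ('E_mu[id] = A%:E)%E /\ ('E_mu[fun x : R => (x ^+ 2)%R] < +oo)%E.

(* Iterated Lebesgue integral over R^n. For nonnegative measurable
   integrands, the only ones it is applied to, this is the integral with
   respect to n-dimensional Lebesgue measure (Tonelli). *)
Fixpoint integral_tuple (R : realType) (n : nat) :
    (n.-tuple R -> \bar R) -> \bar R :=
  match n with
  | 0%N => fun f => f [tuple]
  | n'.+1 => fun f =>
      (\int[lebesgue_measure]_(x in [set: R])
         integral_tuple (fun t : n'.-tuple R => f [tuple of x :: t]))%E
  end.

Definition in_simplex (R : realType) (n : nat) (x : n.-tuple R) : bool :=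
  [forall k : 'I_n, 0 <= tnth x k <= 1] && (\sum_(k < n) tnth x k == 1).

Definition dirichlet_weight (R : realType) (n : nat) (p : 'I_n -> R)
    (x : n.-tuple R) : R :=
  if in_simplex x then \prod_(k < n) tnth x k `^ (p k - 1) else 0.

Definition simplex_point (R : realType) (n : nat) (t : n.-tuple R) :
    n.+1.-tuple R :=
  [tuple of rcons t (1 - \sum_(i < n) tnth t i)].

(* The simplex of R^(n+1) is parametrised by its first n coordinates, the
   last one being 1 minus their sum; "density" refers to the image of the
   n-dimensional Lebesgue measure. The constant Z, the inverse of the total
   mass of the weight, is forced by D being a probability. *)
Definition is_dirichlet (R : realType) (n : nat) (p : 'I_n.+1 -> R)
    (D : probability (n.+1.-tuple R) R) : Prop :=
  exists2 Z : R, 0 < Z &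
    forall A : set (n.+1.-tuple R), measurable A ->
      D A = (Z%:E * integral_tuple (fun t : n.-tuple R =>
               (\1_A (simplex_point t)
                  * dirichlet_weight p (simplex_point t))%:E))%E.

(* Mutual independence of V and of all the X k and Y k; taking full sets for
   some of the A, B k, C k gives the product rule for the subfamilies. *)
Definition all_independent (R : realType) (d : measure_display)
    (T : measurableType d) (P : probability T R) (n : nat)
    (V : {RV P >-> n.-tuple R}) (X Y : 'I_n -> {RV P >-> R}) : Prop :=
  forall (A : set (n.-tuple R)) (B C : 'I_n -> set R),
    measurable A -> (forall k, measurable (B k)) ->
    (forall k, measurable (C k)) ->
    P [set w | [/\ A (V w), forall k, B k (X k w) & forall k, C k (Y k w)]]
    = (P [set w | A (V w)] * (\prod_(k < n) P [set w | B k (X k w)])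
         * (\prod_(k < n) P [set w | C k (Y k w)]))%E.

(* Indices are shifted by one: k = 1, ..., S + 1 becomes k : 'I_S.+1. *)
Definition solves_system (R : realType) (a c S : nat) (sigma : R)
    (mu nu : probability R R) : Prop :=
  exists (d : measure_display) (T : measurableType d) (P : probability T R)
         (D : probability (S.+1.-tuple R) R)
         (V : {RV P >-> S.+1.-tuple R}) (X Y : 'I_S.+1 -> {RV P >-> R}),
    [/\ is_dirichlet (fun=> S%:R^-1) D /\ has_law P V D,
        forall k, has_law P (X k) mu /\ has_law P (Y k) nu,
        all_independent V X Y,
        has_law P (fun w =>
          \sum_(k < S.+1 | (k < a.+1)%N) tnth (V w) k `^ sigma * X k w
          + \sum_(k < S.+1 | (a.+1 <= k)%N) tnth (V w) k `^ sigma * Y k w) mu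
      & has_law P (fun w =>
          \sum_(k < S.+1 | (k < c)%N) tnth (V w) k `^ sigma * X k w
          + \sum_(k < S.+1 | (c <= k)%N) tnth (V w) k `^ sigma * Y k w) nu].

Definition is_unique_solution (R : realType) (a c S : nat) (sigma B C : R)
    (mu nu : probability R R) : Prop :=
  [/\ in_M2 B mu, in_M2 C nu, solves_system a c S sigma mu nu &
      forall mu' nu' : probability R R,
        in_M2 B mu' -> in_M2 C nu' -> solves_system a c S sigma mu' nu' ->
        same_law mu' mu /\ same_law nu' nu].

(* Urn contents are pairs (red, black); a draw is [true] for red. *)
Definition urn_step (a b c d : nat) (u : nat * nat) (red : bool) : nat * nat :=
  if red then (u.1 + a, u.2 + b)%N else (u.1 + c, u.2 + d)%N.

Definition urn_after (a b c d : nat) (u0 : nat * nat) (h : seq bool) :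
    nat * nat :=
  foldl (urn_step a b c d) u0 h.

(* Each ball is drawn uniformly at random given the past: after the draws h,
   the next one is red with conditional probability red / (red + black). *)
Definition urn_draws (R : realType) (a b c d : nat) (u0 : nat * nat)
    (disp : measure_display) (T : measurableType disp) (P : probability T R)
    (draw : nat -> {RV P >-> bool}) : Prop :=
  forall h : seq bool,
    let u := urn_after a b c d u0 h in
    P [set w | mkseq (fun i => draw i w) (size h) = h /\ draw (size h) w = true]
    = (P [set w | mkseq (fun i => draw i w) (size h) = h]
         * (u.1%:R / (u.1 + u.2)%:R)%:E)%E.

Definition urn_composition (R : realType) (a b c d : nat) (u0 : nat * nat)
    (disp : measure_display) (T : measurableType disp) (P : probability T R)
    (draw : nat -> {RV P >-> bool}) (n : nat) (w : T) : nat * nat :=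
  urn_after a b c d u0 (mkseq (fun i => draw i w) n).

Definition u2 (R : realType) (b c S : nat) (u : nat * nat) : R :=
  (b%:R * u.1%:R - c%:R * u.2%:R) / S%:R.

Definition is_WDT (R : realType) (a b c d S : nat) (sigma : R)
    (u0 : nat * nat) (disp : measure_display) (T : measurableType disp)
    (P : probability T R) (draw : nat -> {RV P >-> bool})
    (W : {RV P >-> R}) : Prop :=
  urn_draws a b c d u0 draw /\
  {ae P, forall w, u2 R b c S (urn_composition a b c d u0 draw n w)
                     / n%:R `^ sigma @[n --> \oo] --> W w}.

(* Main.v *)
Require Import Defs.
From HB Require Import structures.
From mathcomp Require Import all_boot all_order all_algebra.
From mathcomp Require Import all_classical all_reals all_analysis.
From mathcomp Require Import ring lra zify.
From mathcomp Require Import measurable_realfun.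
Set Implicit Arguments.
Unset Strict Implicit.
Unset Printing Implicit Defensive.
Import Order.TTheory GRing.Theory Num.Theory.
Import numFieldNormedType.Exports.
Local Open Scope classical_set_scope.
Local Open Scope ring_scope.

(** Write u2(n) for the value of u2 on the composition after n draws, and sigma = m / S.

    Uniqueness.  The right-hand sides of the system map a pair of laws to a pair of laws.
    Measure the distance of two laws of equal mean by their integrals against bounded
    functions f with |f(x+h) - f(x) - g(x) h| <= L h^2.  Such a test, read through an affine
    map of slope s, has constant L s^2, so replacing the laws of the X^(k) and Y^(k) one by
    one costs at most the distance times the expectation of sum_k V_k^(2 sigma)
    ([smear_zolotarev]).  For the Dirichlet law of parameter 1/S this expectation is
    (1 + 1/S) / (2 sigma + 1/S), less than 1 because the urn is large
    ([expect_power_sum]).  Two solutions with equal means are at finite distance and hence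
    equal ([system_unique]).

    The limit laws solve the system.  After a first draw from the urn (1,0), it contains
    a + 1 red and b black balls.  These S + 1 balls are the roots of S + 1 independent
    urns started from one ball: histories of the whole urn are shuffles of histories of the
    parts, a Leibniz rule for sums over histories ([history_sum_total]).  The numbers of
    draws made in the parts are Dirichlet-multinomial, that is a multinomial law whose
    weights are drawn from the Dirichlet law of parameter 1/S
    ([expect_multinomial_mixture]).  By the law of large numbers the proportions of draws
    tend to these weights V_k, the k-th part contributes (n V_k)^sigma times its own limit,
    and dividing by n^sigma gives the system ([urn_smoothing]).  The argument only uses
    that u2(n) is close to n^sigma times a variable of the limit law, in the quantitative
    sense [urn_approx].

    The limit of the urn.  The expectation of u2 is multiplied at each draw by 1 + m / s,
    s being the number of balls; the product of these factors is a quotient of Gamma values,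
    equivalent to kappa n^sigma with kappa = Gamma(1/S) / Gamma((m+1)/S)
    ([urn_growth_cvg]).  Divided by it, u2(n) is a martingale bounded in L^2 when
    2 m > S ([urn_variance]).  By Fatou's lemma any almost sure limit of a subsequence is
    also a limit in L^2, with the same rate ([limit_square_dist]).  This gives its mean,
    its second moment and [urn_approx], hence part (ii).

    Existence for all means.  An urn process is built on [0,1] by cutting intervals
    proportionally to the composition of the urn ([urn_draws_cell]); a fast subsequence of
    its normalised u2 converges almost surely ([normalised_urn_ae_cvg]), and the limits
    for the two initial colours solve the system with means proportional to (b, -c).
    The system is homogeneous and the solutions of c B + b C = 0 form a line, so scaling
    this pair reaches every admissible (B, C). *)

(** * Lebesgue integrals on the line *)

Definition mfun_of d d' (T : measurableType d) (T' : measurableType d')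
  (f : T -> T') (mf : measurable_fun [set: T] f) : {mfun T >-> T'} :=
  HB.pack f (isMeasurableFun.Build d d' T T' f mf).

Section image_measure.
Context d1 d2 (T1 : measurableType d1) (T2 : measurableType d2) (R : realType).
Variables (mu : {measure set T1 -> \bar R}) (f : T1 -> T2).
Hypothesis mf : measurable_fun [set: T1] f.

Definition image_measure : {measure set T2 -> \bar R} :=
  measure_function_pushforward__canonical__measure_function_Measure mu mf.

Lemma image_measureE A : image_measure A = mu (f @^-1` A).
Proof. by []. Qed.

Lemma integral_image_measure (g : T2 -> \bar R) :
  measurable_fun [set: T2] g -> (forall x, 0 <= g x)%E ->
  (\int[image_measure]_x g x = \int[mu]_x g (f x))%E.
Proof.
move=> mg g0.
have := ge0_integral_pushforward mf mu measurableT mg (fun y _ => g0 y).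
by rewrite preimage_setT.
Qed.

End image_measure.

Section affine_change_of_variable.
Context {R : realType}.
Local Notation leb := (@lebesgue_measure R).
Local Open Scope ereal_scope.

(** Lebesgue measure is determined by its values on half-open intervals, so its invariance
    under x -> s - x only has to be checked there; the same argument gives the effect of a
    dilation. *)
Lemma integral_lebesgue_reflect (s : R) (f : R -> \bar R) :
  measurable_fun [set: R] f -> (forall x, 0 <= f x) ->
  \int[leb]_x f (s - x)%R = \int[leb]_x f x.
Proof.
move=> mf f0.
have mphi : @measurable_fun _ _ (measurableTypeR R) (measurableTypeR R) setT (fun x => s - x)%R.
  exact: measurable_funB.
pose mu' := image_measure leb mphi.
have E : forall A, measurable A -> leb A = mu' A.
  apply: lebesgue_measure_unique => _ [[a b]] _ <-.
  change (leb `]a, b] = leb ((fun x => s - x)%R @^-1` `]a, b])).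
  rewrite (_ : _ @^-1` _ = `[(s - b)%R, (s - a)%R[%classic); last first.
    apply/seteqP; split=> x /=; rewrite !in_itv/= => /andP[? ?]; apply/andP; split; lra.
  rewrite !lebesgue_measure_itv/= !lte_fin.
  by rewrite ltrD2l ltrN2 -!EFinD; case: ifPn => // _; congr (_%:E); ring.
transitivity (\int[mu']_x f x); first by rewrite integral_image_measure.
by apply: eq_measure_integral => A mA _; apply/esym/E.
Qed.

Lemma integral_lebesgue_scale (c : R) (f : R -> \bar R) : (0 < c)%R ->
  measurable_fun [set: R] f -> (forall x, 0 <= f x) ->
  \int[leb]_x f x = c%:E * \int[leb]_x f (c * x)%R.
Proof.
move=> c0 mf f0.
have mphi : @measurable_fun _ _ (measurableTypeR R) (measurableTypeR R) setT (fun x => c * x)%R.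
  exact: measurable_funM.
pose cc := NngNum (ltW c0); pose mu' := image_measure leb mphi.
have E : forall A, measurable A -> leb A = mscale cc mu' A.
  apply: lebesgue_measure_unique => _ [[a b]] _ <-.
  change (leb `]a, b] = c%:E * leb ((fun x => c * x)%R @^-1` `]a, b])).
  rewrite (_ : _ @^-1` _ = `](a / c)%R, (b / c)%R]%classic); last first.
    apply/seteqP; split=> x /=; rewrite !in_itv/= ltr_pdivrMr// ler_pdivlMr// ![(c * x)%R]mulrC//.
  rewrite !lebesgue_measure_itv/= !lte_fin ltr_pM2r ?invr_gt0//.
  by case: ifPn => // _; rewrite ?mule0// -!EFinD -EFinM; congr (_%:E); field; rewrite gt_eqF.
transitivity (\int[mscale cc mu']_x f x).
  by apply: eq_measure_integral => A mA _; apply/E.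
by rewrite ge0_integral_mscale// integral_image_measure.
Qed.

End affine_change_of_variable.

Section lebesgue_linear.
Context {R : realType}.
Local Notation leb := (@lebesgue_measure R).
Local Open Scope ereal_scope.

Lemma ge0_lebesgueZl (c : R) (f : R -> R) : (0 <= c)%R ->
  measurable_fun [set: R] f -> (forall x, 0 <= f x)%R ->
  \int[leb]_x (c * f x)%:E = c%:E * \int[leb]_x (f x)%:E.
Proof.
move=> c0 mf f0.
have mF : @measurable_fun _ _ (measurableTypeR R) _ setT (EFin \o f).
  by apply/measurable_EFinP.
exact: (@ge0_integralZl_EFin _ _ _ leb setT measurableT (EFin \o f) (fun x _ => f0 x) mF c c0).
Qed.

Lemma lebesgue_tonelli (k : R * R -> R) :
  measurable_fun [set: R * R] k -> (forall z, 0 <= k z)%R ->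
  \int[leb]_x \int[leb]_y (k (x, y))%:E = \int[leb]_y \int[leb]_x (k (x, y))%:E.
Proof.
move=> mk k0.
have mK : @measurable_fun _ _ (measurableTypeR R * measurableTypeR R)%type _ setT (EFin \o k).
  by apply/measurable_EFinP.
exact: (@fubini_tonelli _ _ _ _ _ leb leb (EFin \o k) mK (fun z => k0 z)).
Qed.

Lemma measurable_lebesgue_tonelli (k : R * R -> R) :
  measurable_fun [set: R * R] k -> (forall z, 0 <= k z)%R ->
  measurable_fun [set: R] (fun y => \int[leb]_x (k (x, y))%:E).
Proof.
move=> mk k0.
have mK : @measurable_fun _ _ (measurableTypeR R * measurableTypeR R)%type _ setT (EFin \o k).
  by apply/measurable_EFinP.
exact: (@measurable_fun_fubini_tonelli_G _ _ _ _ _ leb (EFin \o k) mK (fun z => k0 z)).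
Qed.

Lemma ge0_lebesgueZr (c : \bar R) (f : R -> R) : 0 <= c ->
  measurable_fun [set: R] f -> (forall x, 0 <= f x)%R ->
  \int[leb]_x ((f x)%:E * c) = \int[leb]_x (f x)%:E * c.
Proof.
move=> c0 mf f0.
have mF : @measurable_fun _ _ (measurableTypeR R) _ setT (EFin \o f).
  by apply/measurable_EFinP.
exact: (@ge0_integralZr _ _ _ leb setT measurableT (EFin \o f) mF c (fun x _ => f0 x) c0).
Qed.

Lemma ge0_le_lebesgue (f g : R -> R) :
  measurable_fun [set: R] f -> measurable_fun [set: R] g ->
  (forall x, 0 <= f x)%R -> (forall x, f x <= g x)%R ->
  \int[leb]_x (f x)%:E <= \int[leb]_x (g x)%:E.
Proof.
move=> mf mg f0 fg; apply: ge0_le_integral => //.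
- by move=> x _; rewrite lee_fin.
- by apply/measurable_EFinP.
- by apply/measurable_EFinP.
- by move=> x _; rewrite lee_fin.
Qed.

Lemma ge0_lebesgueD (f g : R -> R) :
  measurable_fun [set: R] f -> measurable_fun [set: R] g ->
  (forall x, 0 <= f x)%R -> (forall x, 0 <= g x)%R ->
  \int[leb]_x (f x + g x)%:E = \int[leb]_x (f x)%:E + \int[leb]_x (g x)%:E.
Proof.
move=> mf mg f0 g0.
have mF (h : R -> R) : measurable_fun [set: R] h ->
    @measurable_fun _ _ (measurableTypeR R) _ setT (EFin \o h).
  by move=> mh; apply/measurable_EFinP.
exact: (@ge0_integralD _ _ _ leb setT measurableT (EFin \o f) (EFin \o g)
  (fun x _ => f0 x) (mF _ mf) (fun x _ => g0 x) (mF _ mg)).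
Qed.

End lebesgue_linear.

(** * The Gamma function and the beta integral *)

Section power.
Context {R : realType}.
Local Notation leb := (@lebesgue_measure R).

(** The function x^(p-1) on the positive half-line, extended by 0, so that the beta
    integrals over bounded intervals become convolutions over the whole line. *)
Definition mono (p x : R) : R := if 0 < x then x `^ (p - 1) else 0.

Lemma mono_ge0 p x : 0 <= mono p x.
Proof. by rewrite /mono; case: ifP => // _; exact: powR_ge0. Qed.

Lemma mono_le0 p x : x <= 0 -> mono p x = 0.
Proof. by rewrite /mono ltNge => ->. Qed.

Lemma measurable_mono p : measurable_fun [set: R] (mono p : R -> R).
Proof.
apply: measurable_fun_ifT => //.
  exact: measurable_fun_ltr.
Qed.

Lemma mono_gt0 p x : 0 < x -> mono p x = x `^ (p - 1).
Proof. by rewrite /mono => ->. Qed.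

Lemma monoM p q x : mono (p + q) x = x `^ p * mono q x.
Proof.
rewrite /mono; case: ifPn => x0; last by rewrite mulr0.
by rewrite -powRD ?(gt_eqF x0) ?implybT// addrA.
Qed.

Lemma mono_scale p c x : 0 < c -> mono p (c * x) = c `^ (p - 1) * mono p x.
Proof.
move=> c0; rewrite /mono pmulr_rgt0//; case: ifPn => x0; last by rewrite mulr0.
by rewrite powRM// ltW.
Qed.

(** For p < 1 the integrand is unbounded at 0: the fundamental theorem of calculus is
    applied on [y/(n+2), y], and these intervals exhaust ]0, y]. *)
Lemma integral_power p (y : R) : 0 < p -> 0 <= y ->
  (\int[leb]_(x in `]0%R, y]) (mono p x)%:E = (y `^ p / p)%:E)%E.
Proof.
move=> p0; rewrite le_eqVlt => /predU1P[<-|y0].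
  rewrite (_ : `]0%R, 0%R]%classic = set0); last by apply/seteqP; split=> x //=; rewrite in_itv/= => /andP[? ?]; lra.
  by rewrite integral_set0 powR0 ?gt_eqF// mul0r.
pose F n : set R := `[(y / n.+2%:R)%R, y]%classic.
have lty n : y / n.+2%:R < y.
  by rewrite ltr_pdivrMr// ltr_pMr// ltr1n.
have gt0 n : 0 < y / n.+2%:R by rewrite divr_gt0.
have FE : \bigcup_n F n = `]0, y]%classic.
  apply/seteqP; split=> [x [n _]|x].
    rewrite /F /= !in_itv/= => /andP[h1 h2]; apply/andP; split => //.
    exact: lt_le_trans h1.
  rewrite /= in_itv/= => /andP[h1 h2].
  exists (Num.truncn (y / x)) => //=; rewrite /F /= in_itv/= h2 andbT.
  rewrite ler_pdivrMr// mulrC -ler_pdivrMr//.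
  by rewrite (le_trans (ltW (truncnS_gt _)))// ler_nat.
have mF n : measurable (F n) by exact: measurable_itv.
have mm : measurable_fun (`]0, y]%classic : set R) (fun x => (mono p x)%:E).
  by apply: measurable_funTS; apply/measurable_EFinP; exact: measurable_mono.
have ndF : nondecreasing_seq F.
  move=> n m nm; apply/subsetPset => x; rewrite /F /= !in_itv/= => /andP[h1 ->]; rewrite andbT.
  by apply: le_trans h1; rewrite ler_pM2l// lef_pV2 ?posrE// ler_nat.
have mm' n : measurable_fun (F n) (fun x => (mono p x)%:E).
  by apply: measurable_funTS; apply/measurable_EFinP; exact: measurable_mono.
have Hge0 n (x : measurableTypeR R) : F n x -> (0 <= (mono p x)%:E)%E by rewrite lee_fin mono_ge0.
have cv := @ge0_nondecreasing_set_cvg_integral _ (measurableTypeR R) R F (fun x => (mono p x)%:E) leb ndF mF.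
rewrite FE in cv.
have {}cv := cv mm' Hge0.
apply/esym; apply: (cvg_unique _ _ cv) => //.
rewrite (_ : (fun _ => _) = (fun n => ((y `^ p / p) - ((y / n.+2%:R) `^ p / p))%:E)); last first.
  apply/funext => n.
  transitivity (\int[leb]_(x in F n) (x `^ (p - 1))%:E)%E.
    apply: eq_integral => x; rewrite inE /F /= in_itv/= => /andP[h _].
    by rewrite mono_gt0//; exact: lt_le_trans h.
  have pos x : x \in `]0%R, +oo[ -> 0 < x by rewrite in_itv/= andbT.
  have cpow q x : 0 < x -> {for x, continuous (fun x : R => x `^ q)}.
    move=> x0; apply: differentiable_continuous; apply/derivable1_diffP.
    by apply: derivable_powR; rewrite in_itv/= andbT.
  rewrite (@continuous_FTC2 _ _ (fun x => x `^ p / p))//.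
  - apply: continuous_in_subspaceT => x; rewrite inE/= in_itv/= => /andP[h _].
    by apply: cpow; exact: lt_le_trans h.
  - split.
    + move=> x; rewrite in_itv/= => /andP[h _].
      apply: derivableM => //; apply: derivable_powR; rewrite in_itv/= andbT.
      exact: lt_trans h.
    + apply: cvg_at_right_filter; apply: cvgM; last exact: cvg_cst.
      exact: cpow.
    + apply: cvg_at_left_filter; apply: cvgM; last exact: cvg_cst.
      exact: cpow.
  - move=> x; rewrite in_itv/= => /andP[h _].
    have x0 : 0 < x by exact: lt_trans h.
    rewrite derive1Mr; last by apply: derivable_powR; rewrite in_itv/= andbT.
    rewrite powR_derive1 ?in_itv/= ?andbT//.
    by rewrite mulrAC mulfV ?mul1r// gt_eqF.
apply: cvg_EFin; first by near=> n.
rewrite -[X in _ --> X]subr0; apply: cvgB; first exact: cvg_cst.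
rewrite -[X in _ --> X](mul0r p^-1); apply: cvgM; last exact: cvg_cst.
have h := @powR_cvg0 R p p0.
apply: (@cvg_comp _ _ _ (fun n => y / n.+2%:R) (fun x => x `^ p) _ (0^'+)) => //.
move=> /= A [/= e e0 eA].
exists (Num.truncn (y / e)) => // n /= hn; apply: eA => //=.
rewrite sub0r normrN gtr0_norm// ltr_pdivrMr// mulrC -ltr_pdivrMr//.
by rewrite (lt_le_trans (truncnS_gt _))// ler_nat ltnS (leq_trans hn).
Unshelve. all: by end_near. Qed.
End power.

Section gamma_function.
Context {R : realType}.
Local Notation leb := (@lebesgue_measure R).
Implicit Types p r s x : R.
Local Open Scope ereal_scope.

(** Extended-real version of Gamma: Tonelli exchanges then need no integrability, and
    finiteness is proved afterwards. *)
Definition egamma p : \bar R := \int[leb]_x (mono p x * expR (- x))%:E.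

Lemma GammaE p : Gamma p = fine (egamma p).
Proof.
rewrite /Gamma /Rintegral integral_mkcond; congr fine; apply: eq_integral => x _.
rewrite patchE /mono mem_setE in_itv/= andbT.
by case: ifP => // _; rewrite mul0r.
Qed.

Local Opaque Gamma.

Lemma measurable_gamma_integrand p :
  measurable_fun [set: R] (fun x => (mono p x * expR (- x))%R).
Proof.
apply: measurable_funM; first exact: measurable_mono.
by apply: measurableT_comp => //; exact: measurable_funN.
Qed.

Lemma gamma_integrand_ge0 p x : (0 <= mono p x * expR (- x))%R.
Proof. by rewrite mulr_ge0 ?mono_ge0 ?expR_ge0. Qed.

Lemma egamma_ge0 p : 0 <= egamma p.
Proof. by apply: integral_ge0 => x _; rewrite lee_fin gamma_integrand_ge0. Qed.

Lemma integral_exp_tail x :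
  \int[leb]_y (if (x < y)%R then expR (- y) else 0)%:E = (expR (- x))%:E.
Proof.
transitivity (\int[leb]_(y in `]x, +oo[) (expR (- y))%:E).
  rewrite [RHS]integral_mkcond; apply: eq_integral => y _.
  by rewrite patchE mem_setE in_itv/= andbT; case: ifP.
rewrite integral_itv_obnd_cbnd; last first.
  apply: measurable_funTS; apply/measurable_EFinP.
  by apply: measurableT_comp => //; exact: measurable_funN.
have dF (y : R) : is_derive y 1%R (fun y => - expR (- y))%R (expR (- y)).
  apply: is_derive_eq; ring.
rewrite (@ge0_continuous_FTC2y _ (fun y => expR (- y)) (fun y => - expR (- y))%R x 0%R).
- by rewrite sub0e -EFinN opprK.
- by move=> y _; exact: expR_ge0.
- apply: continuous_subspaceT => y; apply: continuous_comp.
    exact: opp_continuous.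
  exact: continuous_expR.
- rewrite -oppr0; apply: cvgN; exact: cvgr_expR.
- by move=> y _; exact: ex_derive.
- have cF : {for x, continuous (fun y => - expR (- y))%R}.
    by apply: differentiable_continuous; apply/derivable1_diffP; exact: ex_derive.
  exact: (cvg_at_right_filter cF).
- by move=> y _; rewrite derive1E derive_val.
Qed.

(** Integration by parts in the form of Tonelli: e^(-x) is the integral of e^(-y) over y >
    x, and the integral of x^(p-1) over 0 < x < y is y^p / p. *)
Lemma egammaS p : (0 < p)%R -> egamma (p + 1) = p%:E * egamma p.
Proof.
move=> p0.
pose tail (x y : R) := if (x < y)%R then expR (- y) else 0%R.
have tail0 x y : (0 <= tail x y)%R by rewrite /tail; case: ifP => // _; exact: expR_ge0.
pose k (z : R * R) : R := (mono p z.1 * tail z.1 z.2)%R.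
have mk : measurable_fun [set: R * R] k.
  apply: measurable_funM.
    exact: (measurableT_comp (measurable_mono p) measurable_fst).
  apply: measurable_fun_ifT => //.
    exact: (measurable_fun_ltr measurable_fst measurable_snd).
  by apply: measurableT_comp => //; apply: measurable_funN; exact: measurable_snd.
have k0 z : (0 <= k z)%R by rewrite mulr_ge0 ?mono_ge0.
have mtail x : measurable_fun [set: R] (tail x).
  apply: measurable_fun_ifT => //; first exact: measurable_fun_ltr.
  by apply: measurableT_comp => //; exact: measurable_funN.
transitivity (p%:E * \int[leb]_x \int[leb]_y (k (x, y))%:E); last first.
  congr (_ * _); apply: eq_integral => x _.
  rewrite /k/= ge0_lebesgueZl ?mono_ge0//.
  by rewrite EFinM; congr (_ * _); exact: integral_exp_tail.
rewrite (lebesgue_tonelli mk k0) -ge0_integralZl_EFin//; first last.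
- exact: ltW.
- exact: measurable_lebesgue_tonelli.
- by move=> y _; apply: integral_ge0 => x _; rewrite lee_fin.
apply: eq_integral => y _.
have [y0|y0] := leP y 0%R.
  rewrite mono_le0// mul0r integral0_eq ?mule0// => x _.
  rewrite /k /mono/=; case: ifPn => x0; last by rewrite mul0r.
  by rewrite /tail ltNge (le_trans y0 (ltW x0)) mulr0.
have -> : \int[leb]_x (k (x, y))%:E = (expR (- y) * (y `^ p / p))%:E.
  rewrite EFinM -integral_power ?(ltW y0)//.
  have mrp : measurable_fun `]0%R, y[ (fun x : R => (mono p x)%:E).
    by apply: measurable_funTS; apply/measurable_EFinP; exact: measurable_mono.
  rewrite -integral_itv_bndo_bndc//.
  rewrite [X in _ * X]integral_mkcond.
  transitivity (\int[leb]_x (expR (- y) * (if (0 < x < y)%R then mono p x else 0))%:E).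
    apply: eq_integral => x _; rewrite /k /tail /=; case: (ltP x y) => xy; rewrite ?andbF ?andbT ?mulr0//.
    by rewrite mulrC; case: ifPn => // /negbTE x0; rewrite /mono x0.
  rewrite ge0_lebesgueZl ?expR_ge0//.
  - congr (_ * _); apply: eq_integral => x _; rewrite patchE mem_setE in_itv/=.
    by case: ifP.
  - apply: measurable_fun_ifT => //; last exact: measurable_mono.
    by apply: measurable_and; apply: measurable_fun_ltr.
  - by move=> x; case: ifP => // _; exact: mono_ge0.
by rewrite -EFinM mono_gt0// addrK; congr (_%:E); field; rewrite gt_eqF.
Qed.
(** For p <= 1 the integrand is at most x^(p-1) on ]0,1] and e^(-x) beyond 1; the functional
    equation then raises p by unit steps. *)
Lemma egamma_fin p : (0 < p)%R -> egamma p < +oo.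
Proof.
have base q : (0 < q <= 1)%R -> egamma q < +oo.
  move=> /andP[q0 q1].
  pose u (x : R) := if (x <= 1)%R then mono q x else 0%R.
  pose v (x : R) := if (1 < x)%R then expR (- x) else 0%R.
  have mu : measurable_fun [set: R] u.
    by apply: measurable_fun_ifT; [exact: measurable_fun_ler|exact: measurable_mono|].
  have mv : measurable_fun [set: R] v.
    apply: measurable_fun_ifT => //; first exact: measurable_fun_ltr.
    by apply: measurableT_comp => //; exact: measurable_funN.
  have u0 x : (0 <= u x)%R by rewrite /u; case: ifP => // _; exact: mono_ge0.
  have v0 x : (0 <= v x)%R by rewrite /v; case: ifP => // _; exact: expR_ge0.
  apply: (@le_lt_trans _ _ (\int[leb]_x (u x + v x)%:E)).
    apply: ge0_le_lebesgue.
    - exact: measurable_gamma_integrand.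
    - exact: measurable_funD.
    - by move=> x; exact: gamma_integrand_ge0.
    - move=> x; rewrite /u /v; case: (leP x 1%R) => x1; rewrite ?addr0 ?add0r.
        have [x0|x0] := leP x 0%R; first by rewrite mono_le0// mul0r.
        by rewrite ler_piMr ?mono_ge0// expR_le1 oppr_le0 ltW.
      rewrite ler_piMl ?expR_ge0// mono_gt0 ?(lt_trans _ x1)//.
      by rewrite -[leRHS](powRr0 x) ler_powR ?(ltW x1)// subr_le0.
  rewrite ge0_lebesgueD//.
  have -> : \int[leb]_x (v x)%:E = (expR (- 1))%:E by exact: integral_exp_tail.
  have -> : \int[leb]_x (u x)%:E = (1 `^ q / q)%:E.
    rewrite -integral_power// [RHS]integral_mkcond; apply: eq_integral => x _.
    rewrite patchE mem_setE in_itv/= /u /mono; case: (leP x 1%R); rewrite ?andbF ?andbT//.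
    by move=> _; case: ifP.
  by rewrite -EFinD ltry.
have step n : forall q, (0 < q <= n.+1%:R)%R -> egamma q < +oo.
  elim: n => [|n IH] q; first exact: base.
  move=> /andP[q0 qn]; have [q1|q1] := leP q 1%R; first by apply: base; rewrite q0.
  rewrite -(subrK 1%R q) egammaS ?subr_gt0//.
  rewrite lte_mul_pinfty ?lee_fin ?subr_ge0 ?(ltW q1)//.
  by apply: IH; rewrite subr_gt0 q1/= lerBlDr natr1.
move=> p0; apply: (step (Num.truncn p)); rewrite p0/=; exact/ltW/truncnS_gt.
Qed.

Lemma egammaE p : (0 < p)%R -> egamma p = (Gamma p)%:E.
Proof. by move=> p0; rewrite GammaE fineK// ge0_fin_numE ?egamma_ge0// egamma_fin. Qed.

Lemma GammaS p : (0 < p)%R -> Gamma (p + 1)%R = (p * Gamma p)%R.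
Proof.
move=> p0; have := egammaS p0.
by rewrite !egammaE ?addr_gt0// -EFinM => -[].
Qed.

(** On [1,2] the integrand of Gamma (p + 1) is at least e^(-2). *)
Lemma Gamma_gt0 p : (0 < p)%R -> (0 < Gamma p)%R.
Proof.
move=> p0; rewrite -(pmulr_rgt0 _ p0) -GammaS// -lte_fin -egammaE ?addr_gt0//.
pose u (x : R) : R := (expR (- 2) * \1_(`[1%R, 2%R]%classic : set R) x)%R.
have mi : measurable_fun [set: R] (\1_(`[1%R, 2%R]%classic : set R) : R -> R).
  by apply: measurable_indic; exact: measurable_itv.
apply: (@lt_le_trans _ _ (\int[leb]_x (u x)%:E)).
  rewrite ge0_lebesgueZl ?expR_ge0//.
  have -> : \int[leb]_x (\1_(`[1%R, 2%R]%classic : set R) x)%:E = 1.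
    transitivity (leb (`[1%R, 2%R]%classic `&` setT)).
      apply: integral_indic => //; exact: measurable_itv.
    rewrite setIT lebesgue_measure_itv/= lte_fin ltr1n -EFinD; congr EFin; ring.
  by rewrite mule1 lte_fin expR_gt0.
apply: ge0_le_lebesgue.
- exact: measurable_funM.
- exact: measurable_gamma_integrand.
- by move=> x; rewrite mulr_ge0 ?expR_ge0// indicE.
- move=> x; rewrite /u indicE mem_setE in_itv/=.
  case: (boolP (1 <= x <= 2)%R) => [/andP[x1 x2]|_]; last by rewrite mulr0 gamma_integrand_ge0.
  rewrite mulr1 mono_gt0 ?(lt_le_trans _ x1)// addrK.
  rewrite -[leLHS]mul1r ler_pM ?expR_ge0 ?ler_expR ?lerN2//.
  by rewrite -[leLHS](powRr0 x) ler_powR// ltW.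
Qed.

Lemma integral_lebesgue_shift (x : R) (f : R -> \bar R) :
  measurable_fun [set: R] f -> (forall x, 0 <= f x) ->
  \int[leb]_s f (s - x)%R = \int[leb]_x f x.
Proof.
move=> mf f0; pose g t := f (- t)%R.
have mg : measurable_fun [set: R] g by apply: measurableT_comp => //; exact: measurable_funN.
rewrite -(@integral_lebesgue_reflect _ 0%R f)//.
transitivity (\int[leb]_s g s); last by apply: eq_integral => t _; rewrite /g sub0r.
rewrite -(@integral_lebesgue_reflect _ x g)//; last by move=> t; exact: f0.
by apply: eq_integral => t _; rewrite /g opprB.
Qed.

Definition ebeta p r : \bar R := \int[leb]_x (mono p x * mono r (1 - x))%:E.

Lemma measurable_mono_conv p r s :
  measurable_fun [set: R] (fun x => (mono p x * mono r (s - x))%R).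
Proof.
apply: measurable_funM; first exact: measurable_mono.
by apply: (measurableT_comp (measurable_mono r)); exact: measurable_funB.
Qed.

Lemma mono_conv_ge0 p r s x : (0 <= mono p x * mono r (s - x))%R.
Proof. by rewrite mulr_ge0 ?mono_ge0. Qed.

Lemma ebeta_ge0 p r : 0 <= ebeta p r.
Proof. by apply: integral_ge0 => x _; rewrite lee_fin mono_conv_ge0. Qed.

(** The substitution x = s y extracts from the convolution its homogeneity factor s^(p+r-1). *)
Lemma integral_mono_conv_ebeta p r s :
  \int[leb]_x (mono p x * mono r (s - x))%:E = (mono (p + r) s)%:E * ebeta p r.
Proof.
have [s0|s0] := leP s 0%R.
  rewrite [mono _ s]mono_le0// mul0e integral0_eq// => x _.
  have [x0|x0] := leP x 0%R; first by rewrite mono_le0// mul0r.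
  by rewrite (@mono_le0 _ r) ?mulr0//; lra.
transitivity (s%:E * \int[leb]_x (mono p (s * x) * mono r (s - s * x))%:E).
  apply: (@integral_lebesgue_scale _ s (fun x => (mono p x * mono r (s - x))%:E)) => //.
    by apply/measurable_EFinP; exact: measurable_mono_conv.
  by move=> x; rewrite lee_fin mono_conv_ge0.
transitivity (s%:E * \int[leb]_x (s `^ (p - 1) * s `^ (r - 1) * (mono p x * mono r (1 - x)))%:E).
  congr (_ * _); apply: eq_integral => x _; congr (_%:E).
  rewrite (_ : s - s * x = s * (1 - x))%R; last by ring.
  by rewrite !mono_scale//; ring.
rewrite ge0_lebesgueZl ?mulr_ge0 ?powR_ge0//; first last.
- by move=> x; exact: mono_conv_ge0.
- exact: measurable_mono_conv.
rewrite muleA -EFinM; congr (_%:E * _).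
rewrite mono_gt0// -powRD ?(gt_eqF s0) ?implybT//.
rewrite -{1}(@powRr1 _ s) ?ltW// -powRD ?(gt_eqF s0) ?implybT//; congr (powR _ _); ring.
Qed.

(** Tonelli for x^(p-1) (y-x)^(r-1) e^(-y): integrating first in x gives Gamma (p+r) times
    the beta integral, integrating first in y gives Gamma p Gamma r. *)
Lemma ebetaE p r : (0 < p)%R -> (0 < r)%R ->
  ebeta p r = (Gamma p * Gamma r / Gamma (p + r))%:E.
Proof.
move=> p0 r0.
have pr0 : (0 < p + r)%R by exact: addr_gt0.
suff E : (Gamma (p + r))%:E * ebeta p r = (Gamma p)%:E * (Gamma r)%:E.
  have : (Gamma (p + r))^-1%:E * ((Gamma (p + r))%:E * ebeta p r) =
         (Gamma (p + r))^-1%:E * ((Gamma p)%:E * (Gamma r)%:E) by rewrite E.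
  rewrite muleA -EFinM mulVf ?gt_eqF ?Gamma_gt0// mul1e => ->.
  by rewrite -!EFinM mulrC.
rewrite -(egammaE p0) -(egammaE r0) -(egammaE pr0).
pose k (z : R * R) := ((mono p z.1 * mono r (z.2 - z.1)) * expR (- z.2))%R.
have mk : measurable_fun [set: R * R] k.
  apply: measurable_funM; last first.
    by apply: measurableT_comp => //; apply: measurable_funN; exact: measurable_snd.
  apply: measurable_funM.
    exact: (measurableT_comp (measurable_mono p) measurable_fst).
  apply: (measurableT_comp (measurable_mono r)).
  by apply: measurable_funB; [exact: measurable_snd|exact: measurable_fst].
have k0 z : (0 <= k z)%R by rewrite mulr_ge0 ?expR_ge0// mono_conv_ge0.
transitivity (\int[leb]_y \int[leb]_x (k (x, y))%:E).
  rewrite /egamma -ge0_lebesgueZr ?ebeta_ge0//; first last.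
  - by move=> y; exact: gamma_integrand_ge0.
  - exact: measurable_gamma_integrand.
  apply: eq_integral => y _; rewrite /k/=.
  transitivity (\int[leb]_x (expR (- y) * (mono p x * mono r (y - x)))%:E); last first.
    by apply: eq_integral => x _; rewrite mulrC.
  transitivity ((expR (- y))%:E * \int[leb]_x (mono p x * mono r (y - x))%:E); last first.
    symmetry; apply: (@ge0_lebesgueZl _ (expR (- y)) (fun x => mono p x * mono r (y - x))%R).
    - exact: expR_ge0.
    - exact: measurable_mono_conv.
    - by move=> x; exact: mono_conv_ge0.
  by rewrite integral_mono_conv_ebeta muleA -EFinM mulrC.
rewrite -lebesgue_tonelli// /egamma -ge0_lebesgueZr ?egamma_ge0//; first last.
- by move=> y; exact: gamma_integrand_ge0.
- exact: measurable_gamma_integrand.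
apply: eq_integral => x _; rewrite /k/=.
transitivity (\int[leb]_y (mono p x * expR (- x) * (mono r (y - x) * expR (- (y - x))))%:E).
  apply: eq_integral => y _; congr (_%:E).
  have -> : expR (- y) = (expR (- x) * expR (- (y - x)))%R by rewrite -expRD; congr expR; ring.
  ring.
transitivity ((mono p x * expR (- x))%:E * \int[leb]_y (mono r (y - x) * expR (- (y - x)))%:E).
  apply: (@ge0_lebesgueZl _ (mono p x * expR (- x)) (fun y => mono r (y - x) * expR (- (y - x)))%R).
  - exact: gamma_integrand_ge0.
  - apply: (measurableT_comp (measurable_gamma_integrand r)); exact: measurable_funB.
  - by move=> y; exact: gamma_integrand_ge0.
congr (_ * _).
apply: (@integral_lebesgue_shift x (fun y => (mono r y * expR (- y))%:E)).
  by apply/measurable_EFinP; exact: measurable_gamma_integrand.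
by move=> y; rewrite lee_fin gamma_integrand_ge0.
Qed.

Lemma integral_mono_conv p r s : (0 < p)%R -> (0 < r)%R ->
  \int[leb]_x (mono p x * mono r (s - x))%:E =
  (Gamma p * Gamma r / Gamma (p + r) * mono (p + r) s)%:E.
Proof.
by move=> p0 r0; rewrite integral_mono_conv_ebeta ebetaE// muleC.
Qed.

(** The concave function t^s lies below its tangent at l. *)
Lemma powR_Young (s t l : R) : (0 < s < 1)%R -> (0 <= t)%R -> (0 < l)%R ->
  (t `^ s <= l `^ (s - 1) * (s * t + (1 - s) * l))%R.
Proof.
move=> /andP[s0 s1] t0 l0.
have s1' : (0 < 1 - s)%R by lra.
have := @conjugate_powR R (powR t s) (powR l (1 - s)) (s^-1)%R ((1 - s)^-1)%R (powR_ge0 _ _) (powR_ge0 _ _).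
rewrite !invr_gt0 !invrK => /(_ s0 s1').
rewrite subrKC => /(_ erefl).
rewrite -!powRrM !mulfV ?(gt_eqF s0) ?(gt_eqF s1')// (powRr1 t0) (powRr1 (ltW l0)) => h.
rewrite -(@ler_pM2r _ (powR l (1 - s))) ?powR_gt0//.
apply: (le_trans h).
rewrite mulrAC -powRD ?(gt_eqF l0) ?implybT//.
rewrite (_ : s - 1 + (1 - s) = 0)%R; last by ring.
by rewrite powRr0 mul1r; lra.
Qed.

(** The tangent bound for t^s at t = p, integrated against t^(p-1) e^(-t); equality of Gamma
    (p+1) with p Gamma p makes the two terms collapse. *)
Lemma Gamma_addr_le p s : (0 < p)%R -> (0 < s < 1)%R ->
  (Gamma (p + s) <= p `^ s * Gamma p)%R.
Proof.
move=> p0 s01; have /andP[s0 s1] := s01.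
have ps : (0 < p + s)%R by exact: addr_gt0.
rewrite -lee_fin -egammaE//.
pose A := (p `^ (s - 1) * s)%R; pose B := (p `^ (s - 1) * ((1 - s) * p))%R.
have A0 : (0 <= A)%R by rewrite mulr_ge0 ?powR_ge0 ?ltW.
have B0 : (0 <= B)%R by rewrite !mulr_ge0 ?powR_ge0 ?subr_ge0 ?ltW.
pose G q (t : R) := (mono q t * expR (- t))%R.
have mG q : measurable_fun [set: R] (G q) by exact: measurable_gamma_integrand.
have G0 q t : (0 <= G q t)%R by exact: gamma_integrand_ge0.
apply: (@le_trans _ _ (\int[leb]_t (A * G (p + 1) t + B * G p t)%:E)).
  apply: ge0_le_lebesgue => //.
  - exact: (mG (p + s)%R).
  - by apply: measurable_funD; apply: measurable_funM => //.
  - by move=> t; exact: (G0 (p + s)%R).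
  - move=> t; rewrite -/(G (p + s) t)%R /G.
    have [t0|t0] := leP t 0%R; first by rewrite !mono_le0// !mul0r !mulr0 addr0.
    rewrite ![(p + _)%R]addrC !monoM (powRr1 (ltW t0)).
    have H := @powR_Young s t p s01 (ltW t0) p0.
    rewrite (_ : (A * _ + _ = p `^ (s - 1) * (s * t + (1 - s) * p) * mono p t * expR (- t))%R); last by rewrite /A /B; ring.
    by rewrite ler_wpM2r ?expR_ge0// ler_wpM2r ?mono_ge0.
rewrite ge0_lebesgueD//; first last.
- by move=> t; rewrite mulr_ge0.
- by move=> t; rewrite mulr_ge0.
- exact: measurable_funM.
- exact: measurable_funM.
rewrite !ge0_lebesgueZl// -/(egamma (p + 1)) -/(egamma p) egammaS// egammaE//.
rewrite -!EFinM -EFinD lee_fin /A /B.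
rewrite -(mulr_powRB1 (ltW p0) s0).
by rewrite le_eqVlt; apply/orP; left; apply/eqP; ring.
Qed.

End gamma_function.

Section gamma_asymptotics.
Context {R : realType}.
Implicit Types x s : R.

Lemma Gamma_prod x n : 0 < x ->
  Gamma (x + n%:R) = Gamma x * \prod_(i < n) (x + i%:R).
Proof.
move=> x0; elim: n => [|n IH]; first by rewrite addr0 big_ord0 mulr1.
rewrite big_ord_recr/= mulrA -IH -natr1 addrA GammaS; first by rewrite mulrC.
by rewrite ltr_wpDr.
Qed.

(** The lower bound is the upper bound at x + s with exponent 1 - s, combined with the
    functional equation. *)
Lemma Gamma_ratio_bounds x s : 0 < x -> 0 < s < 1 ->
  x / (x + s) * (x + s) `^ s <= Gamma (x + s) / Gamma x <= x `^ s.
Proof.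
move=> x0 s01; have /andP[s0 s1] := s01.
have xs : 0 < x + s by exact: addr_gt0.
rewrite ler_pdivrMr ?Gamma_gt0// Gamma_addr_le// andbT.
have := @Gamma_addr_le R (x + s) (1 - s) xs.
rewrite addrA addrAC addrK GammaS// => H.
have {}H : x * Gamma x <= (x + s) `^ (1 - s) * Gamma (x + s) by apply: H; lra.
rewrite ler_pdivlMr ?Gamma_gt0//.
rewrite (_ : _ * _ * Gamma x = (x * Gamma x) * ((x + s) `^ s / (x + s))); last by field; rewrite gt_eqF.
apply: (@le_trans _ _ ((x + s) `^ (1 - s) * Gamma (x + s) * ((x + s) `^ s / (x + s)))).
  by rewrite ler_wpM2r// divr_ge0 ?powR_ge0 ?ltW.
rewrite (_ : _ * _ = Gamma (x + s) * ((x + s) `^ (1 - s) * (x + s) `^ s) / (x + s)); last by field; rewrite gt_eqF.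
rewrite -powRD ?(gt_eqF xs) ?implybT// subrK powRr1 ?(ltW xs)//.
by rewrite mulfK ?gt_eqF.
Qed.

(** The product is Gamma x / Gamma (x+s) times Gamma (x+n+s) / Gamma (x+n), and the last
    quotient is squeezed between multiples of n^s tending to n^s. This limit is the constant
    in the mean of the urn limits. *)
Lemma prod_ratio_cvg x s : 0 < x -> 0 < s < 1 ->
  (\prod_(i < n) ((x + i%:R + s) / (x + i%:R))) / n%:R `^ s @[n --> \oo]
    --> Gamma x / Gamma (x + s).
Proof.
move=> x0 s01; have /andP[s0 s1] := s01.
have xs : 0 < x + s by exact: addr_gt0.
have pos n : 0 < x + n%:R by rewrite ltr_wpDr.
have poss n : 0 < x + n%:R + s by rewrite addr_gt0.
pose q n := Gamma (x + n%:R + s) / Gamma (x + n%:R) / n%:R `^ s.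
have -> : (fun n => (\prod_(i < n) ((x + i%:R + s) / (x + i%:R))) / n%:R `^ s) =
          (fun n => Gamma x / Gamma (x + s) * q n).
  apply/funext => n; rewrite /q.
  rewrite [in X in X / _ / _](_ : x + n%:R + s = (x + s) + n%:R); last by ring.
  rewrite !Gamma_prod// big_split/= prodfV.
  rewrite [in X in _ = _ * (X / _ / _)](eq_bigr (fun i : 'I_n => x + i%:R + s)); last by move=> i _; ring.
  rewrite [in RHS]mulrA; congr (_ / _); field.
  rewrite !gt_eqF ?Gamma_gt0//=; last by apply: prodr_gt0 => i _; exact: pos.
rewrite -[X in _ --> X]mulr1; apply: cvgM; first exact: cvg_cst.
apply: (@squeeze_cvgr _ _ _ _ (fun n => 1 - s / (x + n%:R + s)) (fun n => 1 + x / n%:R)).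
- near=> n.
  have n0 : (0 : R) < n%:R by rewrite ltr0n; near: n; exists 1%N.
  have /andP[h1 h2] := @Gamma_ratio_bounds (x + n%:R) s (pos n) s01.
  rewrite /q; apply/andP; split.
    rewrite ler_pdivlMr ?powR_gt0//; apply: le_trans h1.
    rewrite (_ : 1 - _ = (x + n%:R) / (x + n%:R + s)); last by field; rewrite gt_eqF.
    rewrite ler_wpM2l ?divr_ge0 ?(ltW (pos n)) ?(ltW (poss n))//.
    apply: ge0_ler_powR; rewrite ?nnegrE ?(ltW s0) ?(ltW n0) ?(ltW (poss n))//.
    by lra.
  apply: (@le_trans _ _ ((x + n%:R) `^ s / n%:R `^ s)).
    by rewrite ler_wpM2r// invr_ge0 powR_ge0.
  rewrite (_ : 1 + _ = (x + n%:R) / n%:R); last by field; rewrite gt_eqF.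
  have E : (x + n%:R) `^ s = ((x + n%:R) / n%:R) `^ s * n%:R `^ s.
    by rewrite -powRM ?divfK ?gt_eqF ?divr_ge0 ?(ltW (pos n)) ?(ltW n0).
  rewrite E mulfK ?gt_eqF ?powR_gt0//.
  by apply: ler1_powR; [rewrite ler_pdivlMr// mul1r; lra|exact: ltW].
- rewrite -[X in _ --> X]subr0; apply: cvgB; first exact: cvg_cst.
  rewrite -(mulr0 s); apply: cvgM; first exact: cvg_cst.
  apply/gtr0_cvgV0; first by near=> n; exact: poss.
  apply: (@ger_cvgy _ _ _ _ (fun n => n%:R)); last exact: cvgr_idn.
  near=> n; lra.
- rewrite -[X in _ --> X]addr0; apply: cvgD; first exact: cvg_cst.
  rewrite -(mulr0 x); apply: cvgM; first exact: cvg_cst.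
  apply/gtr0_cvgV0; last exact: cvgr_idn.
  by near=> n; rewrite ltr0n; near: n; exists 1%N.
Unshelve. all: by end_near. Qed.

End gamma_asymptotics.

(** * The symmetric Dirichlet law and its moments *)

Section weighted_law.
Context d (T : measurableType d) (R : realType) (m : probability T R) (g : T -> R).
Hypothesis mg : measurable_fun [set: T] g.
Hypothesis g0 : forall t, 0 <= g t.
Hypothesis g1 : (\int[m]_t (g t)%:E = 1)%E.
Local Open Scope ereal_scope.

Definition weighted_law of phant T := fun A : set T => \int[m]_(t in A) (g t)%:E.

Local Notation wl := (weighted_law (Phant T)).

Let wl0 : wl set0 = 0. Proof. exact: integral_set0. Qed.

Let wl_ge0 A : 0 <= wl A.
Proof. by apply: integral_ge0 => t _; rewrite lee_fin. Qed.

Let wl_sigma_additive : semi_sigma_additive wl.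
Proof.
move=> /= F mF tF mUF; rewrite /weighted_law; apply: cvg_toP.
  apply: ereal_nondecreasing_is_cvgn => k n kn.
  apply: lee_sum_nneg_natr => // i _ _.
  by apply: integral_ge0 => /= x Fkx; rewrite lee_fin.
rewrite ge0_integral_bigcup//=.
- by apply: measurable_funTS; exact: measurableT_comp.
- by move=> x _; rewrite lee_fin.
Qed.

HB.instance Definition _ := isMeasure.Build _ _ _ wl wl0 wl_ge0 wl_sigma_additive.

Let wlT : wl setT = 1. Proof. exact: g1. Qed.

HB.instance Definition _ := Measure_isProbability.Build _ _ R wl wlT.

Definition weighted_prob : probability T R := wl.

Import HBNNSimple.

Let int_indic (A : set T) : measurable A ->
  \int[wl]_t (\1_A t)%:E = \int[m]_t (\1_A t * g t)%:E.
Proof.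
move=> mA; rewrite integral_indic// setIT.
change (\int[m]_(t in A) (g t)%:E = \int[m]_t (\1_A t * g t)%:E).
rewrite [LHS]integral_mkcond.
apply: eq_integral => t _; rewrite patchE indicE.
by case: ifP => _; rewrite ?mul1r ?mul0r.
Qed.

Let int_nnsfun (f : {nnsfun T >-> R}) :
  \int[wl]_t (f t)%:E = \int[m]_t (f t * g t)%:E.
Proof.
under [LHS]eq_integral do rewrite fimfunE -fsumEFin//.
have step r : measurable_fun [set: T] (fun t => (r * \1_(f @^-1` [set r]) t)%:E).
  by apply/measurable_EFinP; apply: measurable_funM.
rewrite [LHS]ge0_integral_fsum//; last by move=> n x _; rewrite EFinM nnfun_muleindic_ge0.
transitivity (\int[m]_t (\sum_(r \in range f) (r * \1_(f @^-1` [set r]) t * g t)%:E)); last first.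
  apply: eq_integral => t _; rewrite [in RHS]fimfunE fsumEFin//; congr (_%:E).
  by rewrite mulr_fsuml.
rewrite ge0_integral_fsum//.
- apply: eq_fsbigr => r _.
  rewrite (integralZl_indic_nnsfun _ measurableT)//= int_indic//.
  under [RHS]eq_integral do rewrite -mulrA EFinM.
  have [r0|r0] := leP 0%R r.
    rewrite ge0_integralZl ?lee_fin//.
    - by apply/measurable_EFinP; apply: measurable_funM.
    - by move=> t _; rewrite lee_fin mulr_ge0// indicE.
  have Z t : (\1_(f @^-1` [set r]) t * g t = 0)%R.
    by rewrite preimage_nnfun0// indicE in_set0 mul0r.
  rewrite [X in _ * X]integral0_eq; last by move=> t _; rewrite Z.
  by rewrite mule0 integral0_eq// => t _; rewrite Z mule0.
- by move=> r; apply/measurable_EFinP; do 2 apply: measurable_funM => //.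
- move=> r t _; rewrite lee_fin mulr_ge0//.
  by have := nnfun_muleindic_ge0 f r t; rewrite -EFinM lee_fin.
Qed.

(** True for indicators by definition, then for simple functions, then by monotone limits. *)
Lemma integral_weighted_prob (h : T -> \bar R) :
  measurable_fun [set: T] h -> (forall t, 0 <= h t) ->
  \int[weighted_prob]_t h t = \int[m]_t (h t * (g t)%:E).
Proof.
move=> mh h0; pose f_ := nnsfun_approx measurableT mh.
transitivity (lim (\int[wl]_x (f_ n x)%:E @[n --> \oo])).
  rewrite -monotone_convergence//=.
  - apply: eq_integral => ? /[!inE] xD; apply/esym/cvg_lim => //=.
    exact: cvg_nnsfun_approx.
  - by move=> n; exact/measurable_EFinP/measurable_funTS.
  - by move=> n ? _; rewrite lee_fin.
  - by move=> ? _ ? ? mn; rewrite lee_fin; exact/lefP/nd_nnsfun_approx.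
transitivity (lim (\int[m]_x (f_ n x * g x)%:E @[n --> \oo])).
  by apply: congr_lim; apply/funext => n; exact: int_nnsfun.
rewrite -monotone_convergence//=.
- apply: eq_integral => x _; apply/cvg_lim => //.
  under eq_cvg do rewrite EFinM.
  apply: cvgeZr => //; exact: cvg_nnsfun_approx.
- by move=> n; apply/measurable_EFinP; exact: measurable_funM.
- by move=> n ? _; rewrite lee_fin mulr_ge0.
- by move=> t _ k n kn; rewrite lee_fin ler_wpM2r//; exact/lefP/nd_nnsfun_approx.
Qed.

End weighted_law.

Section iterated_integral.
Context {R : realType}.
Local Open Scope ereal_scope.

Lemma eq_integral_tuple n (f g : n.-tuple R -> \bar R) :
  f =1 g -> integral_tuple f = integral_tuple g.
Proof. by move=> fg; congr integral_tuple; exact/funext. Qed.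

Lemma integral_tuple0 n : integral_tuple (fun _ : n.-tuple R => 0) = 0.
Proof. by elim: n => //= n ->; rewrite integral0. Qed.

(** Integrating out the first coordinate is one beta convolution with the exponents of the
    others merged. The constant c absorbs the factor of that coordinate, which stays outside
    the inner integral. *)
Lemma integral_tuple_mono n (p : nat -> R) (q s c : R) :
  (forall i, 0 < p i)%R -> (0 < q)%R -> (0 <= c)%R ->
  integral_tuple (fun t : n.-tuple R =>
    (c * (\prod_(i < n) mono (p i) (tnth t i) * mono q (s - \sum_(i < n) tnth t i)))%:E) =
  (c * ((\prod_(i < n) Gamma (p i) * Gamma q) / Gamma (\sum_(i < n) p i + q)
        * mono (\sum_(i < n) p i + q) s))%:E.
Proof.
move=> + q0; elim: n p s c => [|n IH] p s c p0 c0 /=.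
  rewrite !big_ord0 add0r !mul1r subr0 mulfV ?mul1r// gt_eqF//; exact: Gamma_gt0.
pose P := (\sum_(i < n) p i.+1 + q)%R.
have P0 : (0 < P)%R by rewrite ltr_wpDl// sumr_ge0// => i _; exact: ltW.
pose K := ((\prod_(i < n) Gamma (p i.+1) * Gamma q) / Gamma P)%R.
have K0 : (0 <= K)%R.
  rewrite divr_ge0 ?(ltW (Gamma_gt0 P0))// mulr_ge0 ?(ltW (Gamma_gt0 q0))//.
  by apply: prodr_ge0 => i _; exact/ltW/Gamma_gt0.
transitivity (\int[lebesgue_measure]_x ((c * K) * (mono (p 0%N) x * mono P (s - x)))%:E).
  apply: eq_integral => x _.
  transitivity (integral_tuple (fun t : n.-tuple R =>
     ((c * mono (p 0%N) x) * (\prod_(i < n) mono (p i.+1) (tnth t i) *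
        mono q ((s - x) - \sum_(i < n) tnth t i)))%:E)).
    apply: eq_integral_tuple => t; congr (_%:E).
    rewrite !big_ord_recl !tnth0 opprD addrA.
    rewrite (eq_bigr (fun i : 'I_n => mono (p i.+1) (tnth t i))); last by move=> i _; rewrite tnthS.
    rewrite [in X in mono q X](eq_bigr (fun i : 'I_n => tnth t i)); last by move=> i _; rewrite tnthS.
    by rewrite /=; ring.
  rewrite (IH (fun i => p i.+1) (s - x)%R (c * mono (p 0%N) x)%R) ?mulr_ge0 ?mono_ge0//.
  by congr (_%:E); rewrite -/P -/K; ring.
rewrite ge0_lebesgueZl ?(mulr_ge0 c0 K0)//; first last.
- by move=> x; exact: mono_conv_ge0.
- exact: measurable_mono_conv.
rewrite integral_mono_conv// -EFinM; congr (_%:E).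
rewrite !big_ord_recl/= /bump/=.
rewrite -[in RHS]addrA -/P /K.
have gP : (Gamma P != 0)%R by rewrite gt_eqF// Gamma_gt0.
have gQ : (Gamma (p 0%N + P) != 0)%R by rewrite gt_eqF// Gamma_gt0// addr_gt0.
move: gP gQ.
move: (Gamma (p 0%N)) (Gamma (_ + P)) (Gamma P) (Gamma q) (mono _ _) (\prod_(i < n) _)%R => x1 x2 x3 x4 x5 x6 h3 h2.
by field; apply/andP; split.
Qed.

Definition in_cube n (t : n.-tuple R) := [forall i : 'I_n, (0 <= tnth t i <= 1)%R].

(** Iterated integrals are not integrals for a measure on tuples by definition; on functions
    carried by the unit cube they coincide with those for a product of uniform laws, which
    makes convergence theorems and image measures available. *)
Lemma cube_law n : exists m : probability (n.-tuple R) R,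
  forall f : n.-tuple R -> \bar R, measurable_fun [set: n.-tuple R] f ->
    (forall t, 0 <= f t) -> (forall t, ~~ in_cube t -> f t = 0) ->
    \int[m]_t f t = integral_tuple f.
Proof.
elim: n => [|n [m IH]].
  exists (\d_([tuple] : 0.-tuple R)) => f mf f0 _ /=.
  by rewrite integral_dirac// diracT mul1e.
pose U := uniform_prob (@ltr01 R).
have mc : measurable_fun [set: measurableTypeR R * n.-tuple R] (fun z : R * n.-tuple R => [tuple of z.1 :: z.2] : n.+1.-tuple R).
  apply: measurable_cons; [exact: measurable_fst|exact: measurable_snd].
pose Q : probability (measurableTypeR R * n.-tuple R)%type R := (U \x m).
exists (distribution Q (mfun_of mc)) => f mf f0 fc.
rewrite ge0_integral_distribution//.
have mfc : measurable_fun [set: measurableTypeR R * n.-tuple R] (f \o mfun_of mc).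
  exact: measurableT_comp.
rewrite /Q/= fubini_tonelli1//.
rewrite integral_uniform; first last.
- by move=> x; apply: integral_ge0.
- exact: measurable_fun_fubini_tonelli_F.
rewrite subr0 invr1 mul1e integral_mkcond /=; apply: eq_integral => x _.
rewrite patchE mem_setE /=; case: ifPn => x01.
  rewrite /fubini_F /=; apply: IH => [|//|t tc].
    apply: (measurableT_comp mf).
    by apply: measurable_cons.
  apply: fc; apply: contra tc => /forallP h; apply/forallP => i.
  by have := h (lift ord0 i); rewrite tnthS.
symmetry; rewrite -[RHS](integral_tuple0 n); apply: eq_integral_tuple => t; apply: fc.
apply: contra x01 => /forallP /(_ ord0); rewrite tnth0 in_itv/=.
by [].
Qed.

End iterated_integral.

Section dirichlet.
Context {R : realType}.
Implicit Types p : R.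

Lemma tnth_simplex_point n (t : n.-tuple R) (i : 'I_n) :
  tnth (simplex_point t) (widen_ord (leqnSn n) i) = tnth t i.
Proof.
rewrite (tnth_nth 0) [in RHS](tnth_nth 0) /= nth_rcons size_tuple.
by rewrite ltn_ord.
Qed.

Lemma tnth_simplex_point_max n (t : n.-tuple R) :
  tnth (simplex_point t) ord_max = 1 - \sum_(i < n) tnth t i.
Proof. by rewrite (tnth_nth 0) /= nth_rcons size_tuple ltnn eqxx. Qed.

Lemma measurable_simplex_point n :
  measurable_fun [set: n.-tuple R] (@simplex_point R n).
Proof.
apply/measurable_fun_tnthP => i.
case: (unliftP ord_max i) => [j ->|->].
  rewrite (_ : _ \o _ = fun t => tnth t j); first exact: measurable_tnth.
  apply/funext => t /=; rewrite -[in RHS]tnth_simplex_point.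
  rewrite (_ : lift _ _ = widen_ord (leqnSn n) j)//.
  by apply/val_inj => /=; rewrite /bump leqNgt ltn_ord.
rewrite (_ : _ \o _ = fun t => 1 - \sum_(i < n) tnth t i); last first.
  by apply/funext => t /=; rewrite tnth_simplex_point_max.
apply: measurable_funB => //; apply: measurable_sum => j.
exact: measurable_tnth.
Qed.

(** The hypothesis p != 1 handles the boundary: there the weight contains the factor
    0^(p-1), which is 0 except for p = 1, where 0^0 = 1. *)
Lemma dirichlet_weightE n p (t : n.-tuple R) : p != 1 ->
  dirichlet_weight (fun=> p) (simplex_point t) =
  \prod_(i < n) mono p (tnth t i) * mono p (1 - \sum_(i < n) tnth t i).
Proof.
move=> p1; set s := 1 - _.
have sE : \sum_(k < n.+1) tnth (simplex_point t) k = 1.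
  rewrite big_ord_recr/= tnth_simplex_point_max.
  under eq_bigr do rewrite tnth_simplex_point.
  by rewrite subrKC.
have prodE (F : R -> R) : \prod_(k < n.+1) F (tnth (simplex_point t) k) =
    \prod_(i < n) F (tnth t i) * F s.
  rewrite big_ord_recr/= tnth_simplex_point_max.
  by under eq_bigr do rewrite tnth_simplex_point.
rewrite /dirichlet_weight -(prodE (mono p)) /in_simplex sE eqxx andbT.
have [/forallP pos|] := boolP [forall k, 0 < tnth (simplex_point t) k].
  have -> : [forall k, 0 <= tnth (simplex_point t) k <= 1].
    apply/forallP => k; rewrite (ltW (pos k)) -sE (bigD1 k)//= lerDl.
    by apply: sumr_ge0 => i _; exact: ltW.
  by apply: eq_bigr => k _; rewrite mono_gt0.
rewrite negb_forall => /existsP[k]; rewrite -leNgt => k0.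
rewrite [RHS](bigD1 k)//= [mono p _]mono_le0// mul0r.
case: ifPn => // /forallP /(_ k) /andP[k0' _].
rewrite (bigD1 k)//= (_ : tnth _ k = 0) ?powR0 ?mul0r ?subr_eq0//.
by apply/eqP; rewrite eq_le k0.
Qed.

(** A point outside the cube has a coordinate at most 0, or only positive coordinates one of
    which exceeds 1, and then the last barycentric coordinate is negative. *)
Lemma mono_prod_cube n (p q : nat -> R) (r : R) (t : n.-tuple R) : ~~ in_cube t ->
  \prod_(i < n) mono (p i) (tnth t i) * mono r (1 - \sum_(i < n) tnth t i) = 0.
Proof.
rewrite negb_forall => /existsP[k kN].
have [k0|k0] := leP (tnth t k) 0.
  by rewrite (bigD1 k)//= [mono _ (tnth t k)]mono_le0// !mul0r.
have [/forallP pos|] := boolP [forall i, 0 < tnth t i].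
  rewrite [mono r _]mono_le0 ?mulr0// subr_le0.
  apply: (@le_trans _ _ (tnth t k)).
    by move: kN; rewrite (ltW k0)/= -ltNge => /ltW.
  by rewrite (bigD1 k)//= lerDl; apply: sumr_ge0 => i _; exact: ltW.
rewrite negb_forall => /existsP[i]; rewrite -leNgt => i0.
by rewrite (bigD1 i)//= [mono _ (tnth t i)]mono_le0// !mul0r.
Qed.

Lemma measurable_mono_prod n (p : nat -> R) (r : R) :
  measurable_fun [set: n.-tuple R] (fun t : n.-tuple R =>
    \prod_(i < n) mono (p i) (tnth t i) * mono r (1 - \sum_(i < n) tnth t i)).
Proof.
apply: measurable_funM.
  apply: measurable_prod => i _.
  by apply: (measurableT_comp (measurable_mono _)); exact: measurable_tnth.
apply: (measurableT_comp (measurable_mono _)); apply: measurable_funB => //.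
by apply: measurable_sum => j; exact: measurable_tnth.
Qed.

Lemma mono_prod_ge0 n (p : nat -> R) (r : R) (t : n.-tuple R) :
  0 <= \prod_(i < n) mono (p i) (tnth t i) * mono r (1 - \sum_(i < n) tnth t i).
Proof. by rewrite mulr_ge0 ?mono_ge0//; apply: prodr_ge0 => i _; exact: mono_ge0. Qed.

Local Open Scope ereal_scope.

(** Multiplying the Dirichlet weight by powers of the coordinates only shifts the exponents,
    so the total mass and the moments are values of the same integral [integral_tuple_mono]. *)
Lemma dirichlet_exists n p : (0 < p)%R -> p != 1%R ->
  exists D : probability (n.+1.-tuple R) R,
    is_dirichlet (fun=> p) D /\
    forall e : nat -> R, (forall i, 0 <= e i)%R ->
      \int[D]_v (\prod_(k < n.+1) tnth v k `^ e k)%:E =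
      ((\prod_(k < n.+1) (Gamma (p + e k) / Gamma p)) *
        (Gamma (p *+ n.+1) / Gamma (p *+ n.+1 + \sum_(k < n.+1) e k)))%:E.
Proof.
move=> p0 p1; have [m mP] := @cube_law R n.
pose w (q : nat -> R) (t : n.-tuple R) : R := (\prod_(i < n) mono (q i) (tnth t i) *
  mono (q n) (1 - \sum_(i < n) tnth t i))%R.
have mw q : measurable_fun [set: n.-tuple R] (w q) by exact: measurable_mono_prod.
have w0 q t : (0 <= w q t)%R by exact: mono_prod_ge0.
have wE q : (forall i, 0 < q i)%R -> \int[m]_t (w q t)%:E =
    (\prod_(k < n.+1) Gamma (q k) / Gamma (\sum_(k < n.+1) q k))%:E.
  move=> q0; rewrite mP.
  - rewrite (@eq_integral_tuple _ _ _ (fun t => (1 * w q t)%:E)); last by move=> t; rewrite mul1r.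
    rewrite integral_tuple_mono// mul1r !big_ord_recr/= mono_gt0// powR1 mulr1.
    by [].
  - exact/measurable_EFinP.
  - by move=> t; rewrite lee_fin.
  - by move=> t tc; rewrite /w mono_prod_cube.
(* the total mass of the Dirichlet weight *)
pose I := (\prod_(k < n.+1) Gamma p / Gamma (\sum_(k < n.+1) p))%R.
have I0 : (0 < I)%R.
  rewrite divr_gt0 ?Gamma_gt0//; first by apply: prodr_gt0 => i _; exact: Gamma_gt0.
  by rewrite sumr_const card_ord mulrn_wgt0.
pose g t := (I^-1 * w (fun=> p) t)%R.
have mg : measurable_fun [set: n.-tuple R] g by exact: measurable_funM.
have g0 t : (0 <= g t)%R by rewrite mulr_ge0// invr_ge0 ltW.
have ZE (h : n.-tuple R -> R) (c : R) : measurable_fun [set: n.-tuple R] h -> (forall t, 0 <= h t)%R ->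
    (0 <= c)%R -> \int[m]_t (c * h t)%:E = c%:E * \int[m]_t (h t)%:E.
  move=> mh h0 c0; under eq_integral do rewrite EFinM.
  apply: ge0_integralZl_EFin => //; last exact/measurable_EFinP.
  by move=> t _; rewrite lee_fin.
have g1 : \int[m]_t (g t)%:E = 1.
  rewrite ZE ?invr_ge0 ?(ltW I0)// wE//.
  by rewrite -EFinM mulVf// gt_eqF.
pose D := distribution (weighted_prob mg g0 g1) (mfun_of (@measurable_simplex_point n)).
exists D; split.
  exists I^-1%R; first by rewrite invr_gt0.
  move=> A mA.
  have mA' : measurable (@simplex_point R n @^-1` A : set (n.-tuple R)).
    by rewrite -[X in measurable X]setTI; exact: measurable_simplex_point.
  change (\int[m]_(t in @simplex_point R n @^-1` A) (g t)%:E = I^-1%:E * integral_tuple (fun t : n.-tuple R => (\1_A (simplex_point t) * dirichlet_weight (fun=> p) (simplex_point t))%:E)).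
  rewrite integral_mkcond.
  pose h (t : n.-tuple R) : R := (\1_(@simplex_point R n @^-1` A) t * w (fun=> p) t)%R.
  have mh : measurable_fun [set: n.-tuple R] h by apply: measurable_funM.
  have h0 t : (0 <= h t)%R by rewrite mulr_ge0// indicE.
  transitivity (\int[m]_t (I^-1 * h t)%:E).
    apply: eq_integral => t _; rewrite patchE /h indicE.
    by case: ifP => _; rewrite ?mul1r ?mul0r ?mulr0.
  rewrite ZE ?invr_ge0 ?(ltW I0)//; congr (_ * _).
  rewrite mP.
  - apply: eq_integral_tuple => t; rewrite /h dirichlet_weightE//.
  - exact/measurable_EFinP.
  - by move=> t; rewrite lee_fin.
  - by move=> t tc; rewrite /h /w mono_prod_cube// mulr0.
move=> e e0.
have mpow : measurable_fun [set: n.+1.-tuple R] (fun v => (\prod_(k < n.+1) tnth v k `^ e k)%:E).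
  apply/measurable_EFinP; apply: measurable_prod => i _.
  by apply: (measurableT_comp (measurable_powR _)); exact: measurable_tnth.
rewrite ge0_integral_distribution//; last first.
  by move=> v; rewrite lee_fin; apply: prodr_ge0 => i _; exact: powR_ge0.
rewrite integral_weighted_prob; first last.
- by move=> t; rewrite lee_fin; apply: prodr_ge0 => i _; exact: powR_ge0.
- by apply: (measurableT_comp mpow); exact: measurable_simplex_point.
transitivity (\int[m]_t (I^-1 * w (fun i => (e i + p)%R) t)%:E).
  apply: eq_integral => t _; rewrite -EFinM; congr (_%:E).
  rewrite /= big_ord_recr/= tnth_simplex_point_max.
  under eq_bigr do rewrite tnth_simplex_point.
  rewrite /g /w monoM.
  rewrite [in RHS](eq_bigr (fun i : 'I_n => tnth t i `^ e i * mono p (tnth t i)))%R; last by move=> i _; rewrite monoM.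
  by rewrite big_split/=; ring.
rewrite ZE ?invr_ge0 ?(ltW I0)// wE; last by move=> i; rewrite ltr_wpDl.
rewrite -EFinM; congr (_%:E).
have -> : (\sum_(k < n.+1) (e k + p) = p *+ n.+1 + \sum_(k < n.+1) e k)%R.
  by rewrite big_split/= sumr_const card_ord addrC.
rewrite [in RHS]big_split/= prodfV /I sumr_const card_ord.
rewrite (eq_bigr (fun k : 'I_n.+1 => Gamma (p + e k))); last by move=> i _; rewrite addrC.
rewrite invf_div.
move: (Gamma _) (Gamma _)^-1%R (\prod_(i < n.+1) _)%R ((\prod_(i < n.+1) _)^-1)%R => x1 x2 x3 x4.
ring.
Qed.

Lemma dirichlet_unique n (p : 'I_n.+1 -> R) (D D' : probability (n.+1.-tuple R) R) :
  is_dirichlet p D -> is_dirichlet p D' -> forall A, measurable A -> D A = D' A.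
Proof.
move=> [Z Z0 ZE] [Z' Z0' ZE'] A mA; rewrite ZE// ZE'//; congr (_%:E * _).
have := ZE setT measurableT; have := ZE' setT measurableT.
rewrite !probability_setT; set I := integral_tuple _.
case: I => [i||]; last 2 first.
- by rewrite gt0_muley ?lte_fin.
- by rewrite gt0_muleNy ?lte_fin.
rewrite -!EFinM => -[h'] -[h].
have i0 : i != 0%R by apply/eqP => i0; move: h; rewrite i0 mulr0 => /eqP; rewrite oner_eq0.
by apply: (mulIf i0); rewrite -h -h'.
Qed.

Lemma measurable_in_simplex n : measurable [set v : n.+1.-tuple R | in_simplex v].
Proof.
have -> : [set v : n.+1.-tuple R | in_simplex v] =
  (\bigcap_(k in [set: 'I_n.+1]) [set v | (0 <= tnth v k <= 1)%R]) `&`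
  [set v | (\sum_(k < n.+1) tnth v k == 1)%R].
  apply/seteqP; split=> v /=; rewrite /in_simplex.
    by move=> /andP[/forallP h ->]; split=> // k _; exact: h.
  by move=> [h ->]; rewrite andbT; apply/forallP => k; exact: h.
apply: measurableI.
  apply: fin_bigcap_measurable => // k _.
  rewrite -[X in measurable X]setTI.
  have mt : measurable_fun [set: n.+1.-tuple R] (fun v => tnth v k) by exact: measurable_tnth.
  rewrite (_ : [set v : n.+1.-tuple R | (0 <= tnth v k <= 1)%R] = (fun v => tnth v k) @^-1` `[0%R, 1%R]%classic).
    by apply: mt => //; exact: measurable_itv.
  by apply/seteqP; split=> v /=; rewrite in_itv.
have ms : measurable_fun [set: n.+1.-tuple R] (fun v => \sum_(k < n.+1) tnth v k)%R.
  by apply: measurable_sum => j; exact: measurable_tnth.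
rewrite (_ : [set v | _] = setT `&` (fun v : n.+1.-tuple R => \sum_(k < n.+1) tnth v k)%R @^-1` [set 1%R]).
  exact: ms.
by rewrite setTI; apply/seteqP; split=> v /= /eqP.
Qed.

Lemma dirichlet_in_simplex n (p : 'I_n.+1 -> R) (D : probability (n.+1.-tuple R) R) :
  is_dirichlet p D -> D [set v | in_simplex v] = 1.
Proof.
move=> [Z Z0 ZE].
have mS := @measurable_in_simplex n.
rewrite -(@probability_setT _ _ _ D) !ZE//; congr (_ * _).
apply: eq_integral_tuple => t; rewrite !indicE in_setT mul1r; congr (_%:E).
rewrite /dirichlet_weight; case: ifPn => [h|]; last by rewrite mulr0.
by rewrite mem_set// mul1r.
Qed.

End dirichlet.

(** * Expectations of bounded functions and independent sums *)

Section bounded_expectation.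
Context d (T : measurableType d) (R : realType).
Implicit Types (P : probability T R) (f g : T -> R).

Definition bounded_measurable f :=
  measurable_fun [set: T] f /\ exists M, forall x, `|f x| <= M.

Lemma bounded_measurable_integrable P f :
  bounded_measurable f -> P.-integrable setT (EFin \o f).
Proof.
move=> [mf [M fM]]; apply: measurable_bounded_integrable => //.
  by rewrite -ge0_fin_numE// fin_num_measure.
exists M; split; first exact: num_real.
by move=> x Mx y _ /=; apply: le_trans (fM y) (ltW Mx).
Qed.

Lemma bounded_measurable_cst c : bounded_measurable (fun=> c).
Proof. by split => //; exists `|c|. Qed.

Lemma bounded_measurableD f g : bounded_measurable f -> bounded_measurable g ->
  bounded_measurable (fun x => f x + g x).
Proof.
move=> [mf [M fM]] [mg [N gN]]; split; first exact: measurable_funD.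
by exists (M + N) => x; rewrite (le_trans (ler_normD _ _))// lerD.
Qed.

Lemma bounded_measurableB f g : bounded_measurable f -> bounded_measurable g ->
  bounded_measurable (fun x => f x - g x).
Proof.
move=> [mf [M fM]] [mg [N gN]]; split; first exact: measurable_funB.
by exists (M + N) => x; rewrite (le_trans (ler_normB _ _))// lerD.
Qed.

Lemma bounded_measurableM f g : bounded_measurable f -> bounded_measurable g ->
  bounded_measurable (fun x => f x * g x).
Proof.
move=> [mf [M fM]] [mg [N gN]]; split; first exact: measurable_funM.
by exists (M * N) => x; rewrite normrM ler_pM.
Qed.

Lemma bounded_measurable_norm f : bounded_measurable f ->
  bounded_measurable (fun x => `|f x|).
Proof.
move=> [mf [M fM]]; split; last by exists M => x; rewrite normr_id.
exact: measurableT_comp.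
Qed.

Lemma bounded_measurable_comp d' (T' : measurableType d') (h : T' -> T) f :
  measurable_fun [set: T'] h -> bounded_measurable f ->
  measurable_fun [set: T'] (f \o h) /\ exists M, forall x, `|f (h x)| <= M.
Proof.
by move=> mh [mf [M fM]]; split; [exact: measurableT_comp|exists M => x].
Qed.

Lemma integrable_realD P f g : P.-integrable setT (EFin \o f) ->
  P.-integrable setT (EFin \o g) -> P.-integrable setT (EFin \o (fun x => f x + g x)).
Proof. exact: integrableD. Qed.

Lemma integrable_realB P f g : P.-integrable setT (EFin \o f) ->
  P.-integrable setT (EFin \o g) -> P.-integrable setT (EFin \o (fun x => f x - g x)).
Proof. exact: integrableB. Qed.

Lemma integrable_realZ P k f : P.-integrable setT (EFin \o f) ->
  P.-integrable setT (EFin \o (fun x => k * f x)).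
Proof. exact: integrableZl. Qed.

Lemma integrable_real_cst P (k : R) : P.-integrable setT (EFin \o (fun _ : T => k)).
Proof. exact/bounded_measurable_integrable/bounded_measurable_cst. Qed.

Lemma expect_cst P c : \int[P]_x c = c.
Proof.
rewrite Rintegral_cst// [X in fine X](_ : _ = 1%E) ?mulr1//.
exact: probability_setT.
Qed.

Lemma expectD P f g : P.-integrable setT (EFin \o f) -> P.-integrable setT (EFin \o g) ->
  \int[P]_x (f x + g x) = \int[P]_x f x + \int[P]_x g x.
Proof. exact: RintegralD. Qed.

Lemma expectB P f g : P.-integrable setT (EFin \o f) -> P.-integrable setT (EFin \o g) ->
  \int[P]_x (f x - g x) = \int[P]_x f x - \int[P]_x g x.
Proof. exact: RintegralB. Qed.

Lemma le_expect P f g : P.-integrable setT (EFin \o f) -> P.-integrable setT (EFin \o g) ->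
  (forall x, f x <= g x) -> \int[P]_x f x <= \int[P]_x g x.
Proof. by move=> ? ? fg; apply: le_Rintegral. Qed.

Lemma le_expect_norm P f g : P.-integrable setT (EFin \o f) ->
  P.-integrable setT (EFin \o g) ->
  (forall x, `|f x| <= g x) -> `|\int[P]_x f x| <= \int[P]_x g x.
Proof.
move=> intf intg fg; apply: (le_trans (le_normr_Rintegral measurableT intf)).
by apply: le_expect => //; exact: integrable_norm.
Qed.

Lemma le_expect_bound P f M : measurable_fun [set: T] f -> (forall x, `|f x| <= M) ->
  `|\int[P]_x f x| <= M.
Proof.
move=> mf fM; rewrite -(expect_cst P M).
apply: le_expect_norm => //; apply: bounded_measurable_integrable.
  by split => //; exists M.
exact: bounded_measurable_cst.
Qed.

Lemma expect_sum P (I : Type) (r : seq I) (F : I -> T -> R) :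
  (forall i, P.-integrable setT (EFin \o F i)) ->
  \int[P]_x (\sum_(i <- r) F i x) = \sum_(i <- r) \int[P]_x F i x.
Proof.
move=> iF; elim: r => [|i r IH].
  by rewrite big_nil; under eq_Rintegral do rewrite big_nil; exact: expect_cst.
rewrite big_cons -IH -expectD//; first by apply: eq_Rintegral => x _; rewrite big_cons.
rewrite (_ : _ \o _ = fun x => (\sum_(j <- r) (EFin (F j x)))%E).
  by apply: (@integrable_sum _ _ _ P setT measurableT I r predT (fun j x => EFin (F j x))) => j _; exact: iF.
by apply/funext => x /=; rewrite sumEFin.
Qed.

Lemma eq_expect P f g : f =1 g -> \int[P]_x f x = \int[P]_x g x.
Proof. by move=> fg; apply: eq_Rintegral => x _; exact: fg. Qed.

Lemma EFin_expect P f : P.-integrable setT (EFin \o f) ->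
  ((\int[P]_x f x)%:E = \int[P]_x (f x)%:E)%E.
Proof. by move=> intf; rewrite /Rintegral fineK//; exact: integrable_fin_num. Qed.

Lemma bounded_measurable_indic (A : set T) : measurable A -> bounded_measurable (\1_A : T -> R).
Proof.
move=> mA; split; first exact: measurable_indic.
by exists 1 => w; rewrite indicE; case: (w \in A); rewrite ?normr1 ?normr0.
Qed.

Lemma expect_indic P (A : set T) : measurable A -> \int[P]_w (\1_A w) = fine (P A).
Proof. by move=> mA; rewrite /Rintegral integral_indic// setIT. Qed.

Lemma bounded_measurable_sum (I : Type) (r : seq I) (F : I -> T -> R) :
  (forall i, bounded_measurable (F i)) -> bounded_measurable (fun w => \sum_(i <- r) F i w).
Proof.
move=> bF; elim: r => [|i r IH].
  by under eq_fun do rewrite big_nil; exact: bounded_measurable_cst.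
by under eq_fun do rewrite big_cons; exact: bounded_measurableD.
Qed.

(** The inequality |y| <= (r + y^2 / r) / 2, integrated and taken at r = sqrt q, replaces
    the Cauchy-Schwarz inequality; for q = 0 one lets r tend to 0. *)
Lemma square_integrable P (Y : T -> R) q : measurable_fun [set: T] Y ->
  (\int[P]_w (Y w ^+ 2)%:E <= q%:E)%E ->
  [/\ P.-integrable setT (EFin \o (fun w => Y w ^+ 2)), P.-integrable setT (EFin \o Y) &
    \int[P]_w `|Y w| <= Num.sqrt q].
Proof.
move=> mY Yq.
have mY2 : measurable_fun [set: T] (fun w => Y w ^+ 2) by exact: measurable_funX.
have i2 : P.-integrable setT (EFin \o (fun w => Y w ^+ 2)).
  apply/integrableP; split; first exact/measurable_EFinP.
  apply: (@le_lt_trans _ _ q%:E); last exact: ltry.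
  apply: le_trans Yq; apply: ge0_le_integral => //=.
  - by apply/measurable_EFinP; apply: measurableT_comp.
  - exact/measurable_EFinP.
  - by move=> w _; rewrite lee_fin ger0_norm// sqr_ge0.
have ir r : P.-integrable setT (EFin \o (fun w => r / 2 + (r^-1 / 2) * Y w ^+ 2)).
  apply: integrable_realD => //.
    exact: integrable_real_cst.
  exact: integrable_realZ.
have bd r w : 0 < r -> `|Y w| <= r / 2 + (r^-1 / 2) * Y w ^+ 2.
  move=> r0; rewrite -subr_ge0.
  have -> : r / 2 + (r^-1 / 2) * Y w ^+ 2 - `|Y w| = (r - `|Y w|) ^+ 2 / (2 * r).
    rewrite -[Y w ^+ 2]real_normK ?num_real//; field.
    by rewrite gt_eqF.
  by rewrite divr_ge0 ?sqr_ge0// mulr_ge0// ltW.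
have i1 : P.-integrable setT (EFin \o Y).
  apply: (@le_integrable _ _ _ P setT measurableT _ (EFin \o (fun w => 1 / 2 + (1^-1 / 2) * Y w ^+ 2))) => //.
  - exact/measurable_EFinP.
  - move=> w _ /=; rewrite lee_fin; apply: (le_trans (bd 1 w ltr01)); exact: ler_norm.
split=> //.
have q0 : 0 <= q.
  by rewrite -lee_fin; apply: le_trans Yq; apply: integral_ge0 => w _; rewrite lee_fin sqr_ge0.
have key r : 0 < r -> \int[P]_w `|Y w| <= (r + q / r) / 2.
  move=> r0; apply: (@le_trans _ _ (\int[P]_w (r / 2 + (r^-1 / 2) * Y w ^+ 2))).
    by apply: le_expect => //; [exact: (integrable_norm i1)|move=> w; exact: bd].
  rewrite expectD ?expect_cst ?RintegralZl//; last 2 first.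
  - exact: integrable_real_cst.
  - exact: integrable_realZ.
  have h : \int[P]_w Y w ^+ 2 <= q by rewrite -lee_fin EFin_expect.
  rewrite mulrDl lerD2l [leRHS](_ : _ = r^-1 / 2 * q); last by ring.
  by rewrite ler_wpM2l// divr_ge0// invr_ge0 ltW.
move: q0; rewrite le_eqVlt => /predU1P[q0|q0].
  rewrite -q0 sqrtr0; apply/ler_addgt0Pr => e e0; rewrite add0r.
  apply: (le_trans (key e e0)); rewrite -q0 mul0r addr0.
  by rewrite ler_pdivrMr// ler_peMr ?ler1n// ltW.
have r0 : 0 < Num.sqrt q by rewrite sqrtr_gt0.
apply: (le_trans (key _ r0)).
rewrite -[X in (_ + X / _) / _](sqr_sqrtr (ltW q0)).
by rewrite le_eqVlt; apply/orP; left; apply/eqP; field; rewrite gt_eqF.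
Qed.

Lemma expect_same_law P Q f : same_law P Q -> \int[P]_x f x = \int[Q]_x f x.
Proof.
by move=> PQ; congr fine; apply: eq_measure_integral => A mA _; exact: PQ.
Qed.

End bounded_expectation.

Section transfer.
Context d d' (T : measurableType d) (T' : measurableType d') (R : realType).

Lemma expect_distribution (P : probability T R) (X : {RV P >-> T'}) (f : T' -> R) :
  measurable_fun [set: T'] f -> P.-integrable setT (EFin \o (f \o X)) ->
  \int[distribution P X]_y f y = \int[P]_x f (X x).
Proof.
move=> mf fi; rewrite /Rintegral integral_distribution//.
exact/measurable_EFinP.
Qed.

Lemma has_law_distribution (P : probability T R) (X : {RV P >-> T'}) (Q : probability T' R) :
  has_law P X Q -> same_law (distribution P X) Q.
Proof. by move=> h A mA; rewrite -h. Qed.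

Lemma expect_has_law (P : probability T R) (X : {RV P >-> T'}) (Q : probability T' R) (f : T' -> R) :
  has_law P X Q -> measurable_fun [set: T'] f -> P.-integrable setT (EFin \o (f \o X)) ->
  \int[Q]_y f y = \int[P]_x f (X x).
Proof.
by move=> /has_law_distribution h mf fi; rewrite -(expect_same_law _ h) expect_distribution.
Qed.

Lemma bounded_measurable_expect (Q : probability T' R) (h : T * T' -> R) :
  bounded_measurable h -> bounded_measurable (fun v => \int[Q]_x h (v, x)).
Proof.
move=> [mh [M hM]]; split; last first.
  exists M => v; apply: le_expect_bound => //.
  exact: measurableT_comp.
have M0 z : 0 <= h z + M by have := hM z; rewrite ler_norml => /andP[]; lra.
have mhM : measurable_fun [set: T * T'] (fun z => (h z + M)%:E).
  by apply/measurable_EFinP; exact: measurable_funD.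
have E v : \int[Q]_x h (v, x) = fine (\int[Q]_x (h (v, x) + M)%:E)%E - M.
  rewrite -/(\int[Q]_x (h (v, x) + M)) expectD ?expect_cst ?addrK//.
    apply: bounded_measurable_integrable; split; last by exists M.
    exact: measurableT_comp.
  exact: integrable_real_cst.
rewrite (funext E); apply: measurable_funB => //.
apply: measurableT_comp => //.
exact: (@measurable_fun_fubini_tonelli_F _ _ _ _ _ Q (fun z => (h z + M)%:E) mhM (fun z => M0 z)).
Qed.

Lemma expect_fubini (P : probability T R) (Q : probability T' R) (h : T * T' -> R) :
  bounded_measurable h ->
  \int[((P \x Q)%E : probability (T * T')%type R)]_z h z = \int[P]_x \int[Q]_y h (x, y).
Proof.
move=> bh; rewrite /Rintegral; congr fine.
rewrite -integral12_prod_meas1; last first.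
  exact: (@bounded_measurable_integrable _ _ _ ((P \x Q)%E : probability (T * T')%type R) h bh).
apply: eq_integral => x _; rewrite /fubini_F /= fineK//.
apply: integrable_fin_num => //.
apply: bounded_measurable_integrable.
have [mh [M hM]] := bh.
by split; [exact: measurableT_comp|exists M].
Qed.

End transfer.

Section smear.
Context {R : realType}.

(** The expectation of f (y + sum_i s_i X_i) for independent X_i of laws mu i, as an
    iterated integral: the laws enter without any common probability space. *)
Fixpoint smear (I : Type) (s : I -> R) (mu : I -> probability R R) (r : seq I)
    (f : R -> R) (y : R) : R :=
  if r is i :: r' then \int[mu i]_x smear s mu r' f (y + s i * x) else f y.

(** Joint measurability in the coefficients and the starting point is what allows the
    coefficients to be random afterwards. *)
Lemma bounded_measurable_smear d (E : measurableType d) (I : Type)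
    (s : I -> E -> R) (mu : I -> probability R R) (r : seq I) (f : R -> R) :
  (forall i, measurable_fun [set: E] (s i)) -> bounded_measurable f ->
  bounded_measurable (fun z : E * R => smear (s^~ z.1) mu r f z.2).
Proof.
move=> ms bf; elim: r => [|i r IH] /=.
  exact: (bounded_measurable_comp measurable_snd bf).
apply: (@bounded_measurable_expect _ _ (E * R)%type _ R (mu i)
  (fun z => smear (s^~ z.1.1) mu r f (z.1.2 + s i z.1.1 * z.2))).
have mk : measurable_fun [set: (E * R) * R] (fun z : (E * R) * R => (z.1.1, z.1.2 + s i z.1.1 * z.2)).
  have m11 : measurable_fun [set: (E * R) * R] (fun z : (E * R) * R => z.1.1).
    exact: (measurableT_comp measurable_fst measurable_fst).
  apply: measurable_fun_pair => //; apply: measurable_funD.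
    exact: (measurableT_comp measurable_snd measurable_fst).
  by apply: measurable_funM => //; exact: (measurableT_comp (ms i) m11).
exact: (bounded_measurable_comp mk IH).
Qed.

Lemma bounded_measurable_smear1 (I : Type) (s : I -> R) (mu : I -> probability R R)
    (r : seq I) (f : R -> R) :
  bounded_measurable f -> bounded_measurable (smear s mu r f).
Proof.
move=> bf.
have H := @bounded_measurable_smear _ R I (fun i _ => s i) mu r f (fun i => measurable_cst _) bf.
have mk : measurable_fun [set: R] (fun y : R => (y, y)) by exact: measurable_fun_pair.
exact: (bounded_measurable_comp mk H).
Qed.

End smear.

Section independence.
Context {R : realType}.
Local Open Scope ereal_scope.

Definition indep_family dE dT (E : measurableType dE) (T : measurableType dT)
    (P : probability T R) (V : {RV P >-> E}) (I : eqType) (Z : I -> {RV P >-> R})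
    (mu : I -> probability R R) (r : seq I) : Prop :=
  forall (A : set E) (B : I -> set R), measurable A -> (forall i, measurable (B i)) ->
  P [set w | A (V w) /\ forall i, i \in r -> B i (Z i w)] =
  P [set w | A (V w)] * \prod_(i <- r) mu i (B i).

Lemma measurable_RV_set dE dT (E : measurableType dE) (T : measurableType dT)
    (P : probability T R) (V : {RV P >-> E}) (A : set E) : measurable A ->
  measurable [set w | A (V w)].
Proof.
by move=> mA; rewrite -[X in measurable X]setTI; exact: (@measurable_funPT _ _ _ _ V).
Qed.

Section indep_cons.
Context dE dT (E : measurableType dE) (T : measurableType dT)
  (P : probability T R) (V : {RV P >-> E}) (I : eqType) (Z : I -> {RV P >-> R})
  (mu : I -> probability R R) (i : I) (r : seq I).
Hypothesis ir : i \notin r.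
Hypothesis ind : indep_family V Z mu (i :: r).

Let mVZ : measurable_fun [set: T] (fun w => (V w, Z i w)).
Proof. by apply: measurable_fun_pair; exact: measurable_funPT. Qed.

Definition pair_RV : {RV P >-> (E * R)%type} := mfun_of mVZ.

Section event.
Variable B : I -> set R.
Hypothesis mB : forall j, measurable (B j).

Let Q := [set w | forall j, j \in r -> B j (Z j w)].

Let mQ : measurable Q.
Proof.
rewrite /Q; elim: r => [|j s IH].
  rewrite (_ : [set w | _] = setT)//.
  by apply/seteqP; split.
rewrite (_ : [set w | _] = [set w | B j (Z j w)] `&` [set w | forall j, j \in s -> B j (Z j w)]).
  by apply: measurableI => //; apply: measurable_RV_set.
apply/seteqP; split=> [w h|w [h1 h2] k]/=.
  by split=> [|k ks]; apply: h; rewrite in_cons ?eqxx ?ks ?orbT.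
by rewrite in_cons => /orP[/eqP->//|]; exact: h2.
Qed.

Let q := \prod_(j <- r) mu j (B j).

Let q0 : 0 <= q.
Proof. by rewrite /q; apply: prode_ge0 => j _. Qed.

Let qfin : q \is a fin_num.
Proof. by rewrite /q; elim/big_ind: _ => // [x y xf yf|j _]; rewrite ?fin_numM// fin_num_measure. Qed.

Let qq := NngNum (fine_ge0 q0).

(** With the event on the remaining variables fixed, both sides are finite measures in C
    that agree on rectangles. *)
Lemma indep_pair (C : set (E * R)) : measurable C ->
  P [set w | C (V w, Z i w) /\ Q w] = (distribution P V \x mu i) C * q.
Proof.
move=> mC.
(* the law of (V, Z i) restricted to the event Q on the other variables *)
pose m' := image_measure (mrestr P mQ) mVZ.
have E1 (A : set E) (B0 : set R) : measurable A -> measurable B0 ->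
    m' (A `*` B0) = mscale qq (distribution P V) A * mu i B0.
  move=> mA mB0.
  have := ind (A := A) (B := fun j => if j == i then B0 else B j) mA.
  rewrite big_cons eqxx.
  have -> : \prod_(j <- r) mu j (if j == i then B0 else B j) = q.
    rewrite /q big_seq [in RHS]big_seq; apply: eq_bigr => j jr.
    by case: eqP => // ji; rewrite ji (negbTE ir) in jr.
  move=> H; rewrite /mscale /= fineK// [q * _]muleC -muleA [q * _]muleC -H; last first.
    by move=> j; case: ifP.
  transitivity (P ((fun w => (V w, Z i w)) @^-1` (A `*` B0) `&` Q)); first by [].
  congr (P _); apply/seteqP; split=> [w [[/= Aw Bw] Qw]|w [/= Aw h]].
    split=> // j; rewrite in_cons => /orP[/eqP->|jr]; first by rewrite eqxx.
    by case: eqP => [ji|_]; [rewrite ji (negbTE ir) in jr|exact: Qw].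
  split; first by split=> //; have := h i (mem_head _ _); rewrite eqxx.
  move=> j jr; have := h j; rewrite in_cons jr orbT => /(_ isT).
  by case: eqP => // ji; rewrite ji (negbTE ir) in jr.
have <- : m' C = (distribution P V \x mu i) C * q.
  rewrite -(@product_measure_unique _ _ _ _ _ (mscale qq (distribution P V)) (mu i) m' E1 _ mC).
  rewrite (@product_measure_unique _ _ _ _ _ (mscale qq (distribution P V)) (mu i)
    (mscale qq (distribution P V \x mu i)) _ _ mC).
    transitivity ((fine q)%:E * (distribution P V \x mu i) C); first by [].
    by rewrite fineK// muleC.
  move=> A B0 mA mB0.
  have X := product_measure1E (distribution P V) (mu i) mA mB0.
  transitivity ((fine q)%:E * (distribution P V \x mu i) (A `*` B0)); first by [].
  transitivity ((fine q)%:E * (distribution P V A * mu i B0)); first by congr (_ * _); exact: X.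
  by rewrite muleA.
by rewrite /m' image_measureE /mrestr.
Qed.

End event.

Lemma pair_law (C : set (E * R)) : measurable C ->
  P [set w | C (V w, Z i w)] = (distribution P V \x mu i) C.
Proof.
move=> mC; have := @indep_pair (fun=> setT) (fun=> measurableT) C mC.
rewrite big1 ?mule1; last by move=> j _; rewrite probability_setT.
move=> <-; congr (P _); apply/seteqP; split=> w /=; last by case.
by move=> h; split.
Qed.

(** Absorbing Z i into V preserves independence; this is the induction step of
    [expect_sum_smear]. *)
Lemma indep_family_cons : indep_family pair_RV Z mu r.
Proof.
move=> C B mC mB; rewrite (indep_pair mB mC); congr (_ * _).
exact/esym/pair_law.
Qed.

End indep_cons.

End independence.

Section expect_smear.
Context {R : realType}.

(** Fubini for one variable at a time, the variables already treated being carried by the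
    pair (V, Z i). *)
Lemma expect_sum_smear dE dT (E : measurableType dE) (T : measurableType dT)
    (P : probability T R) (V : {RV P >-> E}) (I : eqType) (Z : I -> {RV P >-> R})
    (mu : I -> probability R R) (r : seq I) (s : I -> E -> R) (g : E -> R) (f : R -> R) :
  uniq r -> indep_family V Z mu r -> (forall i, measurable_fun [set: E] (s i)) ->
  measurable_fun [set: E] g -> bounded_measurable f ->
  \int[P]_w f (g (V w) + \sum_(i <- r) s i (V w) * Z i w) =
  \int[P]_w smear (s^~ (V w)) mu r f (g (V w)).
Proof.
elim: r dE E V s g => [|i r IH] dE E V s g /=.
  by move=> _ _ _ _ _; apply: eq_expect => w; rewrite big_nil addr0.
move=> /andP[ir ur] ind ms mg bf.
have ind' := indep_family_cons ir ind.
have ms' j : measurable_fun [set: E * R] (fun z : E * R => s j z.1) by exact: measurableT_comp.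
have mg' : measurable_fun [set: E * R] (fun z : E * R => g z.1 + s i z.1 * z.2).
  apply: measurable_funD; first exact: measurableT_comp.
  exact: measurable_funM.
have := IH _ _ (pair_RV V Z i) (fun j z => s j z.1) (fun z => g z.1 + s i z.1 * z.2) ur ind' ms' mg' bf.
move=> H; transitivity (\int[P]_w smear ((fun j z => s j z.1)^~ (V w, Z i w)) mu r f (g (V w) + s i (V w) * Z i w)).
  rewrite -[RHS]H; apply: eq_expect => w /=.
  by rewrite big_cons addrA.
pose h (z : E * R) := smear (s^~ z.1) mu r f (g z.1 + s i z.1 * z.2).
have bh : bounded_measurable h.
  have mk : measurable_fun [set: E * R] (fun z : E * R => (z.1, g z.1 + s i z.1 * z.2)).
    by apply: measurable_fun_pair.
  exact: (bounded_measurable_comp mk (bounded_measurable_smear mu r ms bf)).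
have bhV : bounded_measurable (h \o pair_RV V Z i).
  exact: (bounded_measurable_comp (@measurable_funPT _ _ _ _ (pair_RV V Z i)) bh).
have hl : has_law P (pair_RV V Z i) ((distribution P V \x mu i)%E : probability (E * R)%type R).
  by move=> C mC; exact: (pair_law ir ind mC).
have [mh _] := bh.
rewrite -(@expect_has_law _ _ _ _ _ P (pair_RV V Z i) _ h hl mh); last first.
  exact: bounded_measurable_integrable.
rewrite expect_fubini// expect_distribution//.
- by have [] := bounded_measurable_expect (mu i) bh.
- apply: bounded_measurable_integrable.
  exact: (bounded_measurable_comp (@measurable_funPT _ _ _ _ V) (bounded_measurable_expect (mu i) bh)).
Qed.

End expect_smear.

Section independent_copies.
Context {R : realType}.
Local Open Scope ereal_scope.

(** Each step adds one coordinate by a product with the next law. The variables are indexed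
    by all of nat, with junk beyond n, so that they keep their index along the induction. *)
Lemma independent_copies dE (E : measurableType dE) (D : probability E R)
    (mu : nat -> probability R R) (n : nat) :
  exists (d : measure_display) (T : measurableType d) (P : probability T R)
    (V : {RV P >-> E}) (Z : nat -> {RV P >-> R}),
    forall (A : set E) (B : nat -> set R), measurable A -> (forall k, measurable (B k)) ->
    P [set w | A (V w) /\ forall k, (k < n)%N -> B k (Z k w)] =
    D A * \prod_(k < n) mu k (B k).
Proof.
elim: n => [|n [d [T [P [V [Z H]]]]]].
  exists dE, E, D, (mfun_of (@measurable_id _ E setT)), (fun=> mfun_of (@measurable_cst _ _ E R setT 0%R)).
  move=> A B mA mB; rewrite big_ord0 mule1; congr (D _).
  by apply/seteqP; split=> w /=; [case|].
pose Q : probability (T * R)%type R := (P \x mu n).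
have mV : measurable_fun [set: T * R] (fun z : T * R => V z.1).
  by apply: (measurableT_comp (@measurable_funPT _ _ _ _ V)).
have mZ k : measurable_fun [set: T * R] (fun z : T * R => if k == n then z.2 else Z k z.1).
  case: eqP => _; first exact: measurable_snd.
  exact: (measurableT_comp (@measurable_funPT _ _ _ _ (Z k)) measurable_fst).
exists _, (T * R)%type, Q, (mfun_of mV), (fun k => mfun_of (mZ k)) => A B mA mB.
have mS : measurable [set w | A (V w) /\ forall k, (k < n)%N -> B k (Z k w)].
  rewrite (_ : [set w | _] = [set w | A (V w)] `&`
     \bigcap_(k in [set k | (k < n)%N]) [set w | B k (Z k w)]).
    apply: measurableI; first exact: measurable_RV_set.
    by apply: fin_bigcap_measurable => // k _; exact: measurable_RV_set.
  by apply/seteqP; split=> w /= [h1 h2].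
transitivity (Q ([set w | A (V w) /\ forall k, (k < n)%N -> B k (Z k w)] `*` B n)).
  congr (Q _); apply/seteqP; split=> -[w x] /=.
    move=> [Aw h]; split; last by have := h n (ltnSn n); rewrite eqxx.
    split=> // k kn; have := h k (ltnW kn); rewrite ltn_eqF//; exact.
  move=> [[Aw h] Bx]; split=> // k; rewrite ltnS leq_eqVlt => /predU1P[->|kn].
    by rewrite eqxx.
  by rewrite ltn_eqF//; exact: h.
transitivity (P [set w | A (V w) /\ forall k, (k < n)%N -> B k (Z k w)] * mu n (B n)).
  exact: product_measure1E.
by rewrite H// big_ord_recr/= muleA.
Qed.

End independent_copies.

(** * A Zolotarev distance contracted by the system *)

Section smooth_tests.
Context {R : realType}.
Implicit Types (f g : R -> R) (L K : R) (mu nu : probability R R).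

(** The tests of the Zolotarev distance of order 2. The quadratic Taylor bound makes them
    scale like s^2 and makes affine parts cancel between laws of equal mean. *)
Definition smooth_test L f :=
  bounded_measurable f /\
  exists g, measurable_fun [set: R] g /\
    forall x h, `|f (x + h) - f x - g x * h| <= L * h ^+ 2.

Lemma smooth_test_affine L f y s :
  smooth_test L f -> smooth_test (L * s ^+ 2) (fun x => f (y + s * x)).
Proof.
move=> [bf [g [mg fg]]].
have ma : measurable_fun [set: R] (fun x : R => y + s * x).
  by apply: measurable_funD => //; exact: measurable_funM.
split; first exact: (bounded_measurable_comp ma bf).
exists (fun x => s * g (y + s * x)); split.
  by apply: measurable_funM => //; exact: measurableT_comp.
move=> x h; rewrite mulrDr addrA.
have := fg (y + s * x) (s * h).
rewrite (_ : s * g (y + s * x) * h = g (y + s * x) * (s * h)); last by ring.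
by rewrite (_ : L * s ^+ 2 * h ^+ 2 = L * (s * h) ^+ 2); last by ring.
Qed.

Lemma smooth_test_expect L f mu s : smooth_test L f ->
  smooth_test L (fun y => \int[mu]_x f (y + s * x)).
Proof.
move=> [bf [g [mg fg]]].
have [mf [M fM]] := bf.
have bg : bounded_measurable g.
  split => //; exists (M + M + L) => x.
  have h1 := fg x 1; rewrite expr1n !mulr1 in h1.
  have -> : g x = (f (x + 1) - f x) - (f (x + 1) - f x - g x) by ring.
  by rewrite (le_trans (ler_normB _ _))// lerD// (le_trans (ler_normB _ _))// lerD.
have mk : measurable_fun [set: R * R] (fun z : R * R => z.1 + s * z.2).
  by apply: measurable_funD => //; exact: measurable_funM.
split; first exact: (bounded_measurable_expect mu (bounded_measurable_comp mk bf)).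
exists (fun y => \int[mu]_x g (y + s * x)); split.
  by have [] := bounded_measurable_expect mu (bounded_measurable_comp mk bg).
move=> y h.
have ms z : measurable_fun [set: R] (fun x : R => z + s * x).
  by apply: measurable_funD => //; exact: measurable_funM.
have If z : mu.-integrable setT (EFin \o (fun x => f (z + s * x))).
  exact/bounded_measurable_integrable/(bounded_measurable_comp (ms z) bf).
have Ig z : mu.-integrable setT (EFin \o (fun x => g (z + s * x) * h)).
  apply/bounded_measurable_integrable/bounded_measurableM.
    exact: (bounded_measurable_comp (ms z) bg).
  exact: bounded_measurable_cst.
have -> : \int[mu]_x f (y + h + s * x) - \int[mu]_x f (y + s * x) - (\int[mu]_x g (y + s * x)) * h =
    \int[mu]_x (f (y + h + s * x) - f (y + s * x) - g (y + s * x) * h).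
  rewrite expectB//; last first.
    apply/bounded_measurable_integrable/bounded_measurableB.
      exact: (bounded_measurable_comp (ms (y + h)) bf).
    exact: (bounded_measurable_comp (ms y) bf).
  rewrite expectB// RintegralZr//.
  exact/bounded_measurable_integrable/(bounded_measurable_comp (ms y) bg).
apply: le_expect_bound.
  apply: measurable_funB; first by apply: measurable_funB; apply: measurableT_comp.
  by apply: measurable_funM => //; apply: measurableT_comp.
move=> x; rewrite (_ : y + h + s * x = y + s * x + h); last by ring.
exact: fg.
Qed.

Lemma smooth_test_smear L f (I : Type) (s : I -> R) (mu : I -> probability R R) r :
  smooth_test L f -> smooth_test L (smear s mu r f).
Proof.
by move=> sf; elim: r => [//|i r IH] /=; exact: smooth_test_expect.
Qed.

Definition zolotarev_le K mu nu := forall L f, smooth_test L f ->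
  `|\int[mu]_x f x - \int[nu]_x f x| <= K * L.

(** The laws are replaced one at a time; the i-th replacement sees the test through an
    affine map of slope s i and costs K L (s i)^2. *)
Lemma smear_zolotarev K L f (I : eqType) (s : I -> R) (mu nu : I -> probability R R) r y :
  (forall i, zolotarev_le K (mu i) (nu i)) -> smooth_test L f ->
  `|smear s mu r f y - smear s nu r f y| <= K * L * \sum_(i <- r) s i ^+ 2.
Proof.
move=> mn sf; elim: r y => [|i r IH] y /=; first by rewrite big_nil subrr normr0 mulr0.
have ma : measurable_fun [set: R] (fun x : R => y + s i * x).
  by apply: measurable_funD => //; exact: measurable_funM.
have b1 : bounded_measurable (fun x => smear s mu r f (y + s i * x)).
  by apply: (bounded_measurable_comp ma); apply: bounded_measurable_smear1; have [] := sf.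
have b2 : bounded_measurable (fun x => smear s nu r f (y + s i * x)).
  by apply: (bounded_measurable_comp ma); apply: bounded_measurable_smear1; have [] := sf.
rewrite big_cons mulrDr.
have -> : \int[mu i]_x smear s mu r f (y + s i * x) - \int[nu i]_x smear s nu r f (y + s i * x)
  = (\int[mu i]_x smear s mu r f (y + s i * x) - \int[nu i]_x smear s mu r f (y + s i * x)) +
    \int[nu i]_x (smear s mu r f (y + s i * x) - smear s nu r f (y + s i * x)).
  by rewrite expectB; [ring|exact: bounded_measurable_integrable..].
rewrite (le_trans (ler_normD _ _))// lerD//.
  rewrite -mulrA; apply: mn; apply: smooth_test_affine; exact: smooth_test_smear.
apply: le_expect_bound; last by move=> x; exact: IH.
by have [] := bounded_measurableB b1 b2.
Qed.

Lemma in_M2_integrable A mu : in_M2 A mu ->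
  [/\ mu.-integrable setT (EFin \o (@id R)),
      mu.-integrable setT (EFin \o (fun x : R => x ^+ 2)) & \int[mu]_x x = A].
Proof.
rewrite /in_M2 unlock => -[m1 m2].
have q2 : (\int[mu]_x (x ^+ 2)%:E)%E \is a fin_num.
  by rewrite ge0_fin_numE//; apply: integral_ge0 => x _; rewrite lee_fin sqr_ge0.
have h2 : (\int[mu]_x (x ^+ 2)%:E <= (fine (\int[mu]_x (x ^+ 2)%:E))%:E)%E by rewrite fineK.
have [i2 i1 _] := square_integrable (@measurable_id _ R setT) h2.
split=> //; rewrite /Rintegral.
by have := m1; rewrite /= => ->.
Qed.

(** By the Taylor bound at 0 a test differs from an affine function by at most L x^2, and
    affine functions have the same expectation under both laws. This is where the means of
    the two laws have to agree. *)
Lemma in_M2_zolotarev A mu nu : in_M2 A mu -> in_M2 A nu ->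
  exists2 K, 0 <= K & zolotarev_le K mu nu.
Proof.
move=> /in_M2_integrable[i1 i2 eA] /in_M2_integrable[j1 j2 eA'].
exists (\int[mu]_x x ^+ 2 + \int[nu]_x x ^+ 2).
  by rewrite addr_ge0// Rintegral_ge0// => x _; exact: sqr_ge0.
move=> L f [bf [g [mg fg]]].
have key (la : probability R R) : la.-integrable setT (EFin \o (@id R)) ->
    la.-integrable setT (EFin \o (fun x : R => x ^+ 2)) -> \int[la]_x x = A ->
    `|\int[la]_x f x - (f 0 + g 0 * A)| <= L * \int[la]_x x ^+ 2.
  move=> k1 k2 eL.
  have Ic c : la.-integrable setT (EFin \o (fun _ : R => c)).
    exact: integrable_real_cst.
  have Ig : la.-integrable setT (EFin \o (fun x : R => g 0 * x)).
    by apply: integrable_realZ.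
  have Ia : la.-integrable setT (EFin \o (fun x : R => f 0 + g 0 * x)).
    by apply: integrable_realD.
  have If : la.-integrable setT (EFin \o f) by exact: bounded_measurable_integrable.
  have <- : \int[la]_x (f 0 + g 0 * x) = f 0 + g 0 * A.
    rewrite expectD// expect_cst RintegralZl//.
    by congr (_ + _ * _).
  rewrite -expectB// -RintegralZl//.
  apply: le_expect_norm.
  - by apply: integrable_realB.
  - by apply: integrable_realZ.
  - by move=> x; have := fg 0 x; rewrite add0r opprD addrA.
have -> : \int[mu]_x f x - \int[nu]_x f x =
  (\int[mu]_x f x - (f 0 + g 0 * A)) - (\int[nu]_x f x - (f 0 + g 0 * A)) by ring.
rewrite (le_trans (ler_normB _ _))// mulrDl ![_ * L]mulrC lerD//; exact: key.
Qed.

(** A continuously differentiable step; being rational on each side of 0, its Taylor bound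
    reduces to polynomial inequalities. *)
Definition soft_step (u : R) : R := if 0 < u then u ^+ 2 / (1 + u ^+ 2) else 0.

Let dstep (u : R) : R := if 0 < u then 2 * u / (1 + u ^+ 2) ^+ 2 else 0.

Let den_gt0 (u : R) : 0 < 1 + u ^+ 2.
Proof. by rewrite ltr_pwDl// sqr_ge0. Qed.

Let den_neq0 (u : R) : 1 + u ^+ 2 != 0.
Proof. by rewrite gt_eqF. Qed.

Lemma measurable_soft_step : measurable_fun [set: R] soft_step.
Proof.
apply: measurable_fun_ifT => //; first exact: measurable_fun_ltr.
rewrite (_ : (fun u : R => _) = fun u => u ^+ 2 * ((1 + u ^+ 2) `^ (-1))); last first.
  by apply/funext => u; rewrite powR_inv1// ltW.
apply: measurable_funM; first exact: exprn_measurable.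
apply: (measurableT_comp (measurable_powR _)).
by apply: measurable_funD => //; exact: exprn_measurable.
Qed.

Lemma soft_step_bounds u : 0 <= soft_step u <= 1.
Proof.
rewrite /soft_step; case: ifP => _; last by rewrite lexx ler01.
by rewrite divr_ge0 ?sqr_ge0 ?(ltW (den_gt0 u))//= ler_pdivrMr// mul1r lerDr.
Qed.

Lemma smooth_test_soft_step : smooth_test 3 soft_step.
Proof.
split.
  split; first exact: measurable_soft_step.
  by exists 1 => x; have /andP[h1 h2] := soft_step_bounds x; rewrite ger0_norm.
exists dstep; split.
  apply: measurable_fun_ifT => //; first exact: measurable_fun_ltr.
  rewrite (_ : (fun u : R => _) = fun u => 2 * u * (((1 + u ^+ 2) ^+ 2) `^ (-1))); last first.
    by apply/funext => u; rewrite powR_inv1// sqr_ge0.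
  apply: measurable_funM; first exact: measurable_funM.
  apply: (measurableT_comp (measurable_powR _)).
  apply: measurable_funX; apply: measurable_funD => //; exact: exprn_measurable.
have step_le u : soft_step u <= u ^+ 2.
  rewrite /soft_step; case: ifP => _; last exact: sqr_ge0.
  by rewrite ler_pdivrMr// ler_peMr ?sqr_ge0// lerDl sqr_ge0.
have dstep_le u : 0 < u -> 0 <= dstep u <= 2 * u.
  move=> u0; rewrite /dstep u0 divr_ge0 ?sqr_ge0 ?mulr_ge0 ?(ltW u0)//=.
  rewrite ler_pdivrMr ?exprn_gt0// ler_peMr ?mulr_ge0 ?(ltW u0)//.
  by rewrite -[leLHS](expr1n _ 2) lerXn2r ?nnegrE ?(ltW (den_gt0 _))// lerDl sqr_ge0.
move=> x h; set y := x + h; have hE : h = y - x by rewrite /y; ring.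
have [x0|x0] := ltP 0 x; have [y0|y0] := ltP 0 y.
- rewrite /soft_step /dstep x0 y0.
  have -> : y ^+ 2 / (1 + y ^+ 2) - x ^+ 2 / (1 + x ^+ 2) - 2 * x / (1 + x ^+ 2) ^+ 2 * h =
     h ^+ 2 * ((1 - x ^+ 2 - 2 * (x * y)) / ((1 + x ^+ 2) ^+ 2 * (1 + y ^+ 2))).
    by rewrite hE; field; rewrite !den_neq0.
  rewrite normrM ger0_norm ?sqr_ge0// mulrC ler_wpM2r ?sqr_ge0//.
  have d0 : 0 < (1 + x ^+ 2) ^+ 2 * (1 + y ^+ 2) by rewrite mulr_gt0 ?exprn_gt0.
  rewrite normrM normfV (gtr0_norm d0) ler_pdivrMr//.
  have x2 := sqr_ge0 x; have y2 := sqr_ge0 y.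
  have e1 : `|1 - x ^+ 2 - 2 * (x * y)| <= 1 + 2 * x ^+ 2 + y ^+ 2.
    have := sqr_ge0 (x + y); have := sqr_ge0 (x - y); rewrite ler_norml => h1 h2.
    by apply/andP; split; nra.
  apply: (le_trans e1).
  have : 1 + 2 * x ^+ 2 + y ^+ 2 <= (1 + x ^+ 2) ^+ 2 * (1 + y ^+ 2).
    have : 0 <= x ^+ 2 * y ^+ 2 by rewrite mulr_ge0.
    have : 0 <= (x ^+ 2) ^+ 2 * (1 + y ^+ 2) by rewrite mulr_ge0 ?sqr_ge0 ?addr_ge0.
    move: (x ^+ 2) (y ^+ 2) x2 y2 => u v u0 v0; nra.
  by lra.
- have -> : soft_step y = 0 by rewrite /soft_step ltNge y0.
  have /andP[d0 d1] := dstep_le x x0; have s1 := step_le x; have /andP[s0 _] := soft_step_bounds x.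
  have xh : x <= - h by rewrite hE; lra.
  rewrite sub0r -normrN opprD !opprK (le_trans (ler_normD _ _))// ger0_norm// normrM.
  rewrite (ger0_norm d0) (ler0_norm (_ : h <= 0)); last by lra.
  by nra.
- have -> : soft_step x = 0 by rewrite /soft_step ltNge x0.
  have -> : dstep x = 0 by rewrite /dstep ltNge x0.
  have s1 := step_le y; have /andP[s0 _] := soft_step_bounds y.
  have yh : y <= h by rewrite hE; lra.
  rewrite mul0r !subr0 ger0_norm//; nra.
- have -> : soft_step x = 0 by rewrite /soft_step ltNge x0.
  have -> : soft_step y = 0 by rewrite /soft_step ltNge y0.
  have -> : dstep x = 0 by rewrite /dstep ltNge x0.
  by rewrite mul0r !subr0 normr0 mulr_ge0 ?sqr_ge0.
Qed.

Lemma soft_step_cvg (a y : R) :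
  soft_step (n%:R * (y - a)) @[n --> \oo] --> (\1_(`]a, +oo[%classic : set R) y : R).
Proof.
rewrite indicE mem_setE in_itv/= andbT.
case: (ltP a y) => ay; last first.
  rewrite (_ : (fun n => _) = fun=> 0); first exact: cvg_cst.
  apply/funext => n; rewrite /soft_step ltNge mulr_ge0_le0//.
  by rewrite subr_le0.
have d0 : 0 < y - a by rewrite subr_gt0.
pose u n : R := n%:R * (y - a).
have cu : u n @[n --> \oo] --> +oo.
  apply/cvgryPge => A; near=> n; rewrite /u -ler_pdivrMr//.
  by near: n; exact: nbhs_infty_ger.
suff : 1 - (1 + u n ^+ 2)^-1 @[n --> \oo] --> (1 : R).
  apply: cvg_trans; apply: near_eq_cvg; near=> n.
  rewrite /soft_step pmulr_lgt0//.
  have -> : 0 < (n%:R : R) by rewrite ltr0n; near: n; exists 1%N.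
  rewrite -/(u n); field; exact: den_neq0.
rewrite -[X in _ --> X]subr0; apply: cvgB; first exact: cvg_cst.
apply/gtr0_cvgV0; first by near=> n; exact: den_gt0.
apply: (@ger_cvgy _ _ _ _ u).
  by near=> n; nra.
exact: cu.
Unshelve. all: by end_near. Qed.

(** The tests soft_step (n (y - a)) converge boundedly to the indicator of ]a, +oo[, and
    these rays generate the Borel sets. *)
Lemma same_law_smooth_tests mu nu :
  (forall L f, smooth_test L f -> \int[mu]_x f x = \int[nu]_x f x) -> same_law mu nu.
Proof.
move=> H.
have ray (a : R) : mu `]a, +oo[%classic = nu `]a, +oo[%classic.
  pose f n (y : R) := soft_step (n%:R * (y - a)).
  have sf n : smooth_test (3 * n%:R ^+ 2) (f n).
    have := smooth_test_affine (- (n%:R * a)) n%:R smooth_test_soft_step.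
    rewrite (_ : (fun x => _) = f n)//; apply/funext => x; rewrite /f; congr soft_step; ring.
  have E (la : probability R R) : (\int[la]_x (f n x)%:E)%E @[n --> \oo] --> la `]a, +oo[%classic.
    have mI : measurable (`]a, +oo[%classic : set R) by exact: measurable_itv.
    have -> : la `]a, +oo[%classic = (\int[la]_x (\1_(`]a, +oo[%classic : set R) x)%:E)%E.
      by rewrite integral_indic// setIT.
    have := @dominated_convergence _ R R la setT measurableT (fun n x => (f n x)%:E)
      (fun x => (\1_(`]a, +oo[%classic : set R) x)%:E) (EFin \o (fun=> 1)).
    case=> //.
    - by move=> n; apply/measurable_EFinP; have [[]] := sf n.
    - by apply/measurable_EFinP; exact: measurable_indic.
    - apply: aeW => x _; apply: cvg_EFin; first by near=> n.
      exact: soft_step_cvg.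
    - exact: (bounded_measurable_integrable la (@bounded_measurable_cst _ R R 1)).
    - apply: aeW => x n _; rewrite lee_fin.
      by have /andP[h1 h2] := soft_step_bounds (n%:R * (x - a)); rewrite ger0_norm.
  have En n : (\int[mu]_x (f n x)%:E = \int[nu]_x (f n x)%:E)%E.
    have [bf _] := sf n.
    rewrite -!EFin_expect; [|exact: bounded_measurable_integrable..].
    by rewrite (H _ _ (sf n)).
  apply: (@cvg_unique _ _ _ _ _ _ (E mu)) => //.
  by rewrite (funext En); exact: E.
move=> A mA.
apply: (measure_unique (@RGenOInfty.G R) (fun n => `](- n%:R)%R, +oo[%classic)) => //.
- exact: (RGenOInfty.measurableE R).
- move=> _ _ [x ->] [y ->]; exists (Num.max x y).
  by apply/seteqP; split=> z /=; rewrite !in_itv/= !andbT gt_max => /andP.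
- by move=> n; exists (- n%:R).
- apply/seteqP; split=> // x _; exists (Num.truncn `|x|).+1 => //=; rewrite in_itv/= andbT.
  rewrite ltrNl; apply: (le_lt_trans _ (truncnS_gt `|x|)).
  by rewrite -normrN ler_norm.
- by move=> _ [x ->]; exact: ray.
- by move=> k; rewrite -ge0_fin_numE// fin_num_measure//; exact: measurable_itv.
Unshelve. all: by end_near. Qed.

End smooth_tests.

Section smoothing.
Context {R : realType} (n : nat).
Local Notation simplex := (n.+1.-tuple R).
Implicit Types (D : probability simplex R) (sel : pred 'I_n.+1) (mu nu : probability R R).

Definition pick_law sel mu nu (k : 'I_n.+1) := if sel k then mu else nu.

(** The law la is that of sum_k V_k^sigma Z_k with V of law D and Z_k of law mu or nu
    according to sel; smooth tests suffice to identify la. *)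
Definition smoothing_image D (sigma : R) sel mu nu (la : probability R R) :=
  forall L f, smooth_test L f ->
    \int[la]_x f x = \int[D]_v smear (fun k => tnth v k `^ sigma) (pick_law sel mu nu) (index_enum 'I_n.+1) f 0.

Lemma measurable_tnth_power (sigma : R) (k : 'I_n.+1) :
  measurable_fun [set: simplex] (fun v : simplex => tnth v k `^ sigma).
Proof. by apply: (measurableT_comp (measurable_powR _)); exact: measurable_tnth. Qed.

Lemma bounded_measurable_smear_power sigma (mu : 'I_n.+1 -> probability R R) f y :
  bounded_measurable f ->
  bounded_measurable (fun v : simplex => smear (fun k => tnth v k `^ sigma) mu (index_enum 'I_n.+1) f y).
Proof.
move=> bf.
have H := @bounded_measurable_smear _ _ _ _ (fun k (v : simplex) => tnth v k `^ sigma) mu (index_enum 'I_n.+1) f (measurable_tnth_power sigma) bf.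
have mk : measurable_fun [set: simplex] (fun v : simplex => (v, y)) by apply: measurable_fun_pair.
exact: (bounded_measurable_comp mk H).
Qed.

Lemma pick_sum sel (F G : 'I_n.+1 -> R) :
  \sum_(k < n.+1 | sel k) F k + \sum_(k < n.+1 | ~~ sel k) G k =
  \sum_(k < n.+1) if sel k then F k else G k.
Proof. by rewrite [RHS](bigID sel)/=; congr (_ + _); apply: eq_bigr => k; [move=> -> | move=> /negbTE ->]. Qed.

Lemma has_law_expect dT (T : measurableType dT) (P : probability T R) (X : {RV P >-> R}) (la : probability R R) :
  (forall L f, smooth_test L f -> \int[P]_w f (X w) = \int[la]_x f x) -> has_law P X la.
Proof.
move=> H.
have h : same_law (distribution P X) la.
  apply: same_law_smooth_tests => L f sf; have [bf _] := sf.
  rewrite expect_distribution ?(H _ _ sf)//; first by have [] := bf.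
  exact/bounded_measurable_integrable/(bounded_measurable_comp (@measurable_funPT _ _ _ _ X) bf).
by move=> A mA; rewrite -h.
Qed.

Section independent_system.
Context dT (T : measurableType dT) (P : probability T R).
Variables (D : probability simplex R) (V : {RV P >-> simplex}) (X Y : 'I_n.+1 -> {RV P >-> R}).
Variables (mu nu : probability R R) (sigma : R) (sel : pred 'I_n.+1).
Hypothesis VD : has_law P V D.
Hypothesis XY : forall k, has_law P (X k) mu /\ has_law P (Y k) nu.
Hypothesis ind : all_independent V X Y.

Let Z k := if sel k then X k else Y k.

Let indZ : indep_family V Z (pick_law sel mu nu) (index_enum 'I_n.+1).
Proof.
move=> A B mA mB.
pose B1 k := if sel k then B k else setT.
pose B2 k := if sel k then setT else B k.
have mB1 k : measurable (B1 k) by rewrite /B1; case: ifP.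
have mB2 k : measurable (B2 k) by rewrite /B2; case: ifP.
have := ind mA mB1 mB2.
have -> : [set w | [/\ A (V w), forall k, B1 k (X k w) & forall k, B2 k (Y k w)]] =
   [set w | A (V w) /\ forall i, i \in index_enum 'I_n.+1 -> B i (Z i w)].
  apply/seteqP; split=> w /=.
    move=> [Aw h1 h2]; split=> // i _; have := h1 i; have := h2 i.
    by rewrite /B1 /B2 /Z; case: ifP.
  move=> [Aw h]; split=> // k; have := h k (mem_index_enum k);
    by rewrite /B1 /B2 /Z; case: ifP.
move=> ->; rewrite -muleA; congr (_ * _)%E.
rewrite -big_split/=; apply: eq_bigr => k _; rewrite /pick_law.
have [hX hY] := XY k.
rewrite (hX _ (mB1 k)) (hY _ (mB2 k)) /B1 /B2; case: ifP => _.
  by rewrite probability_setT mule1.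
by rewrite probability_setT mul1e.
Qed.

Lemma expect_system f : bounded_measurable f ->
  \int[P]_w f (\sum_(k < n.+1 | sel k) tnth (V w) k `^ sigma * X k w
          + \sum_(k < n.+1 | ~~ sel k) tnth (V w) k `^ sigma * Y k w) =
  \int[D]_v smear (fun k => tnth v k `^ sigma) (pick_law sel mu nu) (index_enum 'I_n.+1) f 0.
Proof.
move=> bf.
have bs := bounded_measurable_smear_power sigma (pick_law sel mu nu) 0 bf.
rewrite (expect_has_law VD (proj1 bs)); last first.
  exact/bounded_measurable_integrable/(bounded_measurable_comp (@measurable_funPT _ _ _ _ V) bs).
have := @expect_sum_smear R _ _ _ _ P V _ Z (pick_law sel mu nu) (index_enum 'I_n.+1)
  (fun k (v : simplex) => tnth v k `^ sigma) (fun=> 0) f (index_enum_uniq _) indZ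
  (measurable_tnth_power sigma) (measurable_cst _) bf.
move=> <-; apply: eq_expect => w; rewrite add0r pick_sum; congr f.
by apply: eq_bigr => k _; rewrite /Z; case: ifP.
Qed.

Lemma measurable_system_sum : measurable_fun [set: T] (fun w =>
  \sum_(k < n.+1 | sel k) tnth (V w) k `^ sigma * X k w
          + \sum_(k < n.+1 | ~~ sel k) tnth (V w) k `^ sigma * Y k w).
Proof.
have mV k : measurable_fun [set: T] (fun w => tnth (V w) k `^ sigma).
  by apply: (measurableT_comp (measurable_tnth_power sigma k)).
rewrite (_ : (fun w => _) = fun w => \sum_(k < n.+1)
   if sel k then tnth (V w) k `^ sigma * X k w else tnth (V w) k `^ sigma * Y k w).
  by apply: measurable_sum => k; case: (sel k); apply: measurable_funM => //.
by apply/funext => w; rewrite pick_sum.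
Qed.

(** This turns an equation of the system, about random variables on some space, into a
    statement about laws. *)
Lemma has_law_systemE la :
  has_law P (fun w => \sum_(k < n.+1 | sel k) tnth (V w) k `^ sigma * X k w
          + \sum_(k < n.+1 | ~~ sel k) tnth (V w) k `^ sigma * Y k w) la <->
  smoothing_image D sigma sel mu nu la.
Proof.
pose Z' : {RV P >-> R} := mfun_of measurable_system_sum.
split=> [h L f [bf _]|h].
  rewrite -(expect_system bf) (@expect_has_law _ _ _ _ _ P Z' _ f h (proj1 bf))//.
  exact/bounded_measurable_integrable/(bounded_measurable_comp (@measurable_funPT _ _ _ _ Z') bf).
apply: (@has_law_expect _ _ P Z') => L f sf; have [bf _] := sf.
by rewrite (h _ _ sf); exact: expect_system.
Qed.

End independent_system.

End smoothing.

Section system_smoothing.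
Context {R : realType}.

Lemma solves_system_smoothing (a c S : nat) (sigma : R)
    (D : probability (S.+1.-tuple R) R) mu nu :
  is_dirichlet (fun=> S%:R^-1) D -> solves_system a c S sigma mu nu ->
  smoothing_image D sigma (fun k : 'I_S.+1 => k < a.+1)%N mu nu mu /\
  smoothing_image D sigma (fun k : 'I_S.+1 => k < c)%N mu nu nu.
Proof.
move=> dD [d [T [P [D' [V [X [Y [[dD' VD'] XY ind hmu hnu]]]]]]]].
have VD : has_law P V D.
  by move=> A mA; rewrite VD'//; exact: (dirichlet_unique dD' dD).
have E p : (fun w => \sum_(k < S.+1 | (k < p)%N) tnth (V w) k `^ sigma * X k w
          + \sum_(k < S.+1 | (p <= k)%N) tnth (V w) k `^ sigma * Y k w) =
  (fun w => \sum_(k < S.+1 | (k < p)%N) tnth (V w) k `^ sigma * X k w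
          + \sum_(k < S.+1 | ~~ (k < p)%N) tnth (V w) k `^ sigma * Y k w).
  by apply/funext => w /=; congr (_ + _); apply: eq_bigl => k; rewrite -leqNgt.
rewrite E in hmu; rewrite E in hnu.
by split; [exact: (proj1 (has_law_systemE sigma _ VD XY ind mu) hmu)|exact: (proj1 (has_law_systemE sigma _ VD XY ind nu) hnu)].
Qed.

(** Among 2 (S + 1) independent variables the first S + 1 serve as the X k and the others as
    the Y k. *)
Lemma smoothing_solves_system (a c S : nat) (sigma : R)
    (D : probability (S.+1.-tuple R) R) mu nu :
  is_dirichlet (fun=> S%:R^-1) D ->
  smoothing_image D sigma (fun k : 'I_S.+1 => k < a.+1)%N mu nu mu ->
  smoothing_image D sigma (fun k : 'I_S.+1 => k < c)%N mu nu nu ->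
  solves_system a c S sigma mu nu.
Proof.
move=> dD smu snu.
pose N := S.+1.
have [d [T [P [V [Z H]]]]] := independent_copies D (fun k => if (k < N)%N then mu else nu) (N + N)%N.
pose X (k : 'I_S.+1) := Z k; pose Y (k : 'I_S.+1) := Z (N + k)%N.
have ind (A : set (N.-tuple R)) (B C : 'I_N -> set R) : measurable A ->
    (forall k, measurable (B k)) -> (forall k, measurable (C k)) ->
    P [set w | [/\ A (V w), forall k, B k (X k w) & forall k, C k (Y k w)]]
    = (D A * (\prod_(k < N) mu (B k)) * (\prod_(k < N) nu (C k)))%E.
  move=> mA mB mC.
  pose B' k : set R := if (k < N)%N then B (inord k) else C (inord (k - N)).
  have mB' k : measurable (B' k) by rewrite /B'; case: ifP.
  have Nk k : (N + k < N)%N = false by rewrite ltnNge leq_addr.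
  have := H A B' mA mB'.
  have -> : [set w | A (V w) /\ forall k, (k < N + N)%N -> B' k (Z k w)] =
     [set w | [/\ A (V w), forall k, B k (X k w) & forall k, C k (Y k w)]].
    apply/seteqP; split=> w /=.
      move=> [Aw h]; split=> // k.
        have := h k; rewrite /B' ltn_ord inord_val; apply.
        by rewrite ltn_addr.
      have := h (N + k)%N; rewrite /B' Nk addKn inord_val; apply.
      by rewrite ltn_add2l.
    move=> [Aw h1 h2]; split=> // k kN; rewrite /B'; case: ltnP => k1.
      by have := h1 (inord k); rewrite /X inordK.
    have := h2 (inord (k - N)); rewrite /Y inordK; last by rewrite ltn_subLR.
    by rewrite subnKC.
  move=> ->; rewrite -muleA; congr (_ * _)%E.
  rewrite big_split_ord/=; congr (_ * _)%E; apply: eq_bigr => k _.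
    by rewrite /B' ltn_ord inord_val.
  by rewrite Nk /B' Nk addKn inord_val.
have VD : has_law P V D.
  move=> A mA; have := ind A (fun=> setT) (fun=> setT) mA (fun=> measurableT) (fun=> measurableT).
  rewrite !big1 ?mule1; [|by move=> *; rewrite probability_setT..].
  move=> <-; congr (P _); apply/seteqP; split=> w /=; first by move=> Aw; split.
  by case.
have XY k : has_law P (X k) mu /\ has_law P (Y k) nu.
  split=> B mB.
    have := ind setT (fun j => if j == k then B else setT) (fun=> setT) measurableT _ (fun=> measurableT).
    rewrite probability_setT mul1e [in X in (_ * X)%E]big1; last by move=> *; rewrite probability_setT.
    rewrite (bigD1 k)//= eqxx big1 ?mule1; last by move=> j /negbTE ->; rewrite probability_setT.
    move=> <-; last by move=> j; case: ifP.
    congr (P _); apply/seteqP; split=> w /=.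
      by move=> Bw; split=> // j; case: eqP => // ->.
    by move=> [_ /(_ k)]; rewrite eqxx.
  have := ind setT (fun=> setT) (fun j => if j == k then B else setT) measurableT (fun=> measurableT) _.
  rewrite probability_setT mul1e [in X in (X * _)%E]big1; last by move=> *; rewrite probability_setT.
  rewrite mul1e (bigD1 k)//= eqxx big1 ?mule1; last by move=> j /negbTE ->; rewrite probability_setT.
  move=> <-; last by move=> j; case: ifP.
  congr (P _); apply/seteqP; split=> w /=.
    by move=> Bw; split=> // j; case: eqP => // ->.
  by move=> [_ _ /(_ k)]; rewrite eqxx.
have allind : all_independent V X Y.
  move=> A B C mA mB mC; rewrite ind//; congr (_ * _ * _)%E.
  - by rewrite -VD.
  - by apply: eq_bigr => k _; have [<-//] := XY k.
  - by apply: eq_bigr => k _; have [_ <-//] := XY k.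
have E p : (fun w => \sum_(k < S.+1 | (k < p)%N) tnth (V w) k `^ sigma * X k w
          + \sum_(k < S.+1 | (p <= k)%N) tnth (V w) k `^ sigma * Y k w) =
  (fun w => \sum_(k < S.+1 | (k < p)%N) tnth (V w) k `^ sigma * X k w
          + \sum_(k < S.+1 | ~~ (k < p)%N) tnth (V w) k `^ sigma * Y k w).
  by apply/funext => w /=; congr (_ + _); apply: eq_bigl => k; rewrite -leqNgt.
by exists d, T, P, D, V, X, Y; split=> //; rewrite E;
  [exact: (proj2 (has_law_systemE sigma _ VD XY allind mu) smu)
  |exact: (proj2 (has_law_systemE sigma _ VD XY allind nu) snu)].
Qed.

Definition dirichlet_powers (n : nat) (D : probability (n.+1.-tuple R) R) (p : R) :=
  forall e : nat -> R, (forall i, 0 <= e i) ->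
      (\int[D]_v (\prod_(k < n.+1) tnth v k `^ e k)%:E =
      ((\prod_(k < n.+1) (Gamma (p + e k) / Gamma p)) *
        (Gamma (p *+ n.+1) / Gamma (p *+ n.+1 + \sum_(k < n.+1) e k)))%:E)%E.

(** With p = 1/S one has E V_k^t = p / (p + t), so the sum is (1 + p) / (t + p), below 1
    because t > 1. For t = 2 sigma this is the contraction factor. *)
Lemma expect_power_sum (S : nat) (D : probability (S.+1.-tuple R) R) (t : R) :
  (0 < S)%N -> dirichlet_powers D S%:R^-1 -> 1 < t ->
  [/\ D.-integrable setT (EFin \o (fun v => \sum_(k < S.+1) tnth v k `^ t)),
    0 <= \int[D]_v (\sum_(k < S.+1) tnth v k `^ t) &
    \int[D]_v (\sum_(k < S.+1) tnth v k `^ t) < 1].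
Proof.
move=> S0 dp t1; have t0 : 0 < t by exact: lt_trans t1.
have S0' : 0 < S%:R :> R by rewrite ltr0n.
pose p : R := S%:R^-1; have p0 : 0 < p by rewrite invr_gt0.
have one (k : 'I_S.+1) : (\int[D]_v (tnth v k `^ t)%:E = (p / (p + t))%:E)%E.
  have := dp (fun i => if i == k :> nat then t else 0).
  rewrite (_ : (\int[D]_v _)%E = (\int[D]_v (tnth v k `^ t)%:E)%E); last first.
    apply: eq_integral => v _; congr EFin; rewrite (bigD1 k)//= eqxx big1 ?mulr1// => i ik.
    by rewrite (_ : (i == k :> nat) = false) ?powRr0//; apply/negbTE; exact: ik.
  move=> -> //; last by move=> i; case: ifP => // _; exact: ltW.
  congr EFin; rewrite -/p (bigD1 k)//= eqxx big1 ?mulr1; last first.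
    move=> i ik; rewrite (_ : (i == k :> nat) = false); last by apply/negbTE; exact: ik.
    by rewrite addr0 mulfV// gt_eqF// Gamma_gt0.
  rewrite (bigD1 k)//= eqxx big1 ?addr0; last first.
    by move=> i ik; rewrite (_ : (i == k :> nat) = false)//; apply/negbTE; exact: ik.
  have -> : p *+ S.+1 = p + 1.
    by rewrite mulrS -mulr_natl /p mulfV// gt_eqF.
  rewrite (_ : p + 1 + t = p + t + 1); last by ring.
  rewrite !GammaS ?addr_gt0//.
  have g1 : Gamma p != 0 by rewrite gt_eqF// Gamma_gt0.
  have g2 : Gamma (p + t) != 0 by rewrite gt_eqF// Gamma_gt0// addr_gt0.
  have g3 : p + t != 0 by rewrite gt_eqF// addr_gt0.
  move: (Gamma p) (Gamma (p + t)) g1 g2 => x y x0 y0.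
  by field; rewrite g3 x0 y0.
have ik (k : 'I_S.+1) : D.-integrable setT (EFin \o (fun v => tnth v k `^ t)).
  apply/integrableP; split; first by apply/measurable_EFinP; exact: measurable_tnth_power.
  rewrite (_ : (\int[D]_v _)%E = (\int[D]_v (tnth v k `^ t)%:E)%E); last first.
    by apply: eq_integral => v _ /=; rewrite ger0_norm ?powR_ge0.
  by rewrite one ltry.
split.
- rewrite (_ : _ \o _ = fun v => (\sum_(k <- index_enum 'I_S.+1) (tnth v k `^ t)%:E)%E).
    by apply: (@integrable_sum _ _ _ D setT measurableT _ _ predT (fun k v => (tnth v k `^ t)%:E)) => k _; exact: ik.
  by apply/funext => v /=; rewrite sumEFin.
- by apply: Rintegral_ge0 => v _; apply: sumr_ge0 => k _; exact: powR_ge0.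
- rewrite (expect_sum (index_enum 'I_S.+1) ik).
  rewrite (eq_bigr (fun=> p / (p + t))); last by move=> k _; rewrite /Rintegral one.
  rewrite sumr_const card_ord -mulr_natl mulrA ltr_pdivrMr ?addr_gt0// mul1r.
  have Sp : S%:R * p = 1 by rewrite /p mulfV// gt_eqF.
  by rewrite -natr1 mulrDl Sp mul1r addrC ltrD2l.
Qed.

(** The cost of [smear_zolotarev] for s_k = V_k^sigma, averaged over V. *)
Lemma smoothing_contracts (S : nat) (D : probability (S.+1.-tuple R) R) (sigma K : R)
    (sel : pred 'I_S.+1) (mu nu mu' nu' la la' : probability R R) :
  (0 < S)%N -> dirichlet_powers D S%:R^-1 -> 1 < 2 * sigma ->
  zolotarev_le K mu mu' -> zolotarev_le K nu nu' ->
  smoothing_image D sigma sel mu nu la -> smoothing_image D sigma sel mu' nu' la' ->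
  zolotarev_le (K * \int[D]_v (\sum_(k < S.+1) tnth v k `^ (2 * sigma))) la la'.
Proof.
move=> S0 dp s2 zmu znu h h' L f sf; have [bf _] := sf.
rewrite (h _ _ sf) (h' _ _ sf) -expectB; last 2 first.
- exact/bounded_measurable_integrable/bounded_measurable_smear_power.
- exact/bounded_measurable_integrable/bounded_measurable_smear_power.
have [iD _ _] := expect_power_sum S0 dp s2.
rewrite mulrAC -RintegralZl//.
apply: le_expect_norm.
- apply/bounded_measurable_integrable/bounded_measurableB; exact: bounded_measurable_smear_power.
- by apply: integrable_realZ.
move=> v.
rewrite (eq_bigr (fun k => (tnth v k `^ sigma) ^+ 2)); last first.
  move=> k _; rewrite mulrC powRrM powR_mulrn ?powR_ge0//.
apply: smear_zolotarev => // k; rewrite /pick_law; case: ifP => _ //.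
Qed.

(** The distance of two solutions is finite and is multiplied by a constant less than 1 when
    both equations are applied, so it is 0. *)
Lemma system_unique (a c S : nat) (sigma B C : R) (D : probability (S.+1.-tuple R) R)
    (mu nu mu' nu' : probability R R) :
  (0 < S)%N -> is_dirichlet (fun=> S%:R^-1) D -> dirichlet_powers D S%:R^-1 -> 1 < 2 * sigma ->
  in_M2 B mu -> in_M2 C nu -> in_M2 B mu' -> in_M2 C nu' ->
  solves_system a c S sigma mu nu -> solves_system a c S sigma mu' nu' ->
  same_law mu' mu /\ same_law nu' nu.
Proof.
move=> S0 dD dp s2 m1 m2 m1' m2' /(solves_system_smoothing dD)[h1 h2] /(solves_system_smoothing dD)[h1' h2'].
have [K1 K10 z1] := in_M2_zolotarev m1' m1.
have [K2 K20 z2] := in_M2_zolotarev m2' m2.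
pose K := K1 + K2.
have L0 L f : @smooth_test R L f -> 0 <= L.
  move=> [_ [g [_ H]]]; have h := H 0 1; rewrite expr1n !mulr1 in h.
  exact: le_trans (normr_ge0 _) h.
have zK1 : zolotarev_le K mu' mu.
  by move=> L f sf; rewrite (le_trans (z1 _ _ sf))// ler_wpM2r ?(L0 _ _ sf)// lerDl.
have zK2 : zolotarev_le K nu' nu.
  by move=> L f sf; rewrite (le_trans (z2 _ _ sf))// ler_wpM2r ?(L0 _ _ sf)// lerDr.
have [_ r0 r1] := expect_power_sum S0 dp s2.
set rho := \int[D]_v _ in r0 r1.
have it n : zolotarev_le (K * rho ^+ n) mu' mu /\ zolotarev_le (K * rho ^+ n) nu' nu.
  elim: n => [|n [i1 i2]]; first by rewrite expr0 mulr1.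
  rewrite exprSr mulrA; split.
    exact: (smoothing_contracts S0 dp s2 i1 i2 h1' h1).
  exact: (smoothing_contracts S0 dp s2 i1 i2 h2' h2).
have lim0 (x L : R) : (forall n, `|x| <= K * rho ^+ n * L) -> x = 0.
  move=> xn; apply/eqP; rewrite -normr_le0.
  have cv : K * rho ^+ n * L @[n --> \oo] --> K * 0 * L.
    apply: cvgM; last exact: cvg_cst.
    apply: cvgM; first exact: cvg_cst.
    by apply: cvg_expr; rewrite ger0_norm.
  rewrite mulr0 mul0r in cv.
  by rewrite -(cvg_lim (@Rhausdorff R) cv); apply: limr_ge; [apply/cvg_ex; exists 0|near=> n].
split; apply: same_law_smooth_tests => L f sf; apply/eqP; rewrite -subr_eq0; apply/eqP; apply: (lim0 _ L) => n.
  by have [i1 _] := it n; exact: i1.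
by have [_ i2] := it n; exact: i2.
Unshelve. all: by end_near. Qed.

End system_smoothing.

(** * Multinomial sums and the combinatorics of urn histories *)

Section multinomial.
Context {R : realType} {I : finType}.
Implicit Types (w : I -> R) (G : (I -> nat) -> R) (c : I -> nat).

Definition bump_at c (i : I) : I -> nat := fun j => (c j + (j == i))%N.

(** The sum over the words i_1 ... i_n of w i_1 ... w i_n times G of the numbers of
    occurrences of each letter. The recursion on one letter dispenses with multinomial
    coefficients. *)
Fixpoint multinomial_sum w n G : R :=
  if n is n'.+1 then \sum_i w i * multinomial_sum w n' (fun c => G (bump_at c i))
  else G (fun=> 0%N).

Lemma sum_bump_at c i : (\sum_j bump_at c i j = (\sum_j c j).+1)%N.
Proof.
rewrite big_split/= -addn1; congr addn.
by rewrite (bigD1 i)//= eqxx big1 ?addn0// => j /negbTE ->.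
Qed.

Lemma eq_multinomial_sum w n G G' : (forall c, (\sum_i c i)%N = n -> G c = G' c) ->
  multinomial_sum w n G = multinomial_sum w n G'.
Proof.
elim: n G G' => [|n IH] G G' GG /=; first by apply: GG; rewrite big1.
apply: eq_bigr => i _; congr (_ * _); apply: IH => c cn.
by apply: GG; rewrite sum_bump_at cn.
Qed.

Lemma multinomial_sumD w n G G' :
  multinomial_sum w n (fun c => G c + G' c) = multinomial_sum w n G + multinomial_sum w n G'.
Proof.
elim: n G G' => [//|n IH] G G' /=.
by rewrite -big_split/=; apply: eq_bigr => i _; rewrite IH mulrDr.
Qed.

Lemma multinomial_sumZ w n k G :
  multinomial_sum w n (fun c => k * G c) = k * multinomial_sum w n G.
Proof.
elim: n G => [//|n IH] G /=.
by rewrite mulr_sumr; apply: eq_bigr => i _; rewrite IH mulrCA.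
Qed.

Lemma multinomial_sum_sum w n (J : Type) (r : seq J) (G : J -> (I -> nat) -> R) :
  multinomial_sum w n (fun c => \sum_(j <- r) G j c) = \sum_(j <- r) multinomial_sum w n (G j).
Proof.
elim: r => [|j r IH].
  rewrite big_nil -[RHS](mul0r (multinomial_sum w n (fun=> 0))) -multinomial_sumZ.
  by apply: eq_multinomial_sum => c _; rewrite big_nil mul0r.
rewrite big_cons -IH -multinomial_sumD.
by apply: eq_multinomial_sum => c _; rewrite big_cons.
Qed.

(** The weight of a word depends on its letter counts only; taken inside G, it can be
    integrated over w. *)
Lemma multinomial_sum_weight w n G :
  multinomial_sum w n G = multinomial_sum (fun=> 1) n (fun c => (\prod_i w i ^+ c i) * G c).
Proof.
elim: n G => [|n IH] G /=; first by rewrite big1 ?mul1r// => i _; rewrite expr0.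
apply: eq_bigr => i _; rewrite mul1r IH -multinomial_sumZ.
apply: eq_multinomial_sum => c _; rewrite mulrA; congr (_ * _).
rewrite (bigD1 i)//= [in RHS](bigD1 i)//= /bump_at eqxx addn1 exprS mulrA; congr (_ * _).
by apply: eq_bigr => j /negbTE ->; rewrite addn0.
Qed.

Lemma le_multinomial_sum w n G G' : (forall i, 0 <= w i) ->
  (forall c, (\sum_i c i)%N = n -> G c <= G' c) ->
  multinomial_sum w n G <= multinomial_sum w n G'.
Proof.
move=> w0; elim: n G G' => [|n IH] G G' GG /=; first by apply: GG; rewrite big1.
apply: ler_sum => i _; rewrite ler_wpM2l//; apply: IH => c cn.
by apply: GG; rewrite sum_bump_at cn.
Qed.

Lemma multinomial_sum_cst w n k : \sum_i w i = 1 -> multinomial_sum w n (fun=> k) = k.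
Proof.
move=> w1; elim: n => [//|n IH] /=.
by rewrite -mulr_suml w1 mul1r IH.
Qed.

Lemma norm_multinomial_sum w n G : (forall i, 0 <= w i) ->
  `|multinomial_sum w n G| <= multinomial_sum w n (fun c => `|G c|).
Proof.
move=> w0; rewrite ler_norml -mulN1r -multinomial_sumZ; apply/andP; split.
  by apply: le_multinomial_sum => // c _; rewrite mulN1r lerNl ler_normr lexx orbT.
by apply: le_multinomial_sum => // c _; exact: ler_norm.
Qed.

(** The variance of a binomial variable. The centred increments have zero mean, so cross
    terms vanish along the recursion. *)
Lemma multinomial_variance w n k : (forall i, 0 <= w i) -> \sum_i w i = 1 ->
  multinomial_sum w n (fun c => ((c k)%:R - n%:R * w k) ^+ 2) <= n%:R.
Proof.
move=> w0 w1.
have wk1 : w k <= 1 by rewrite -w1 (bigD1 k)//= lerDl sumr_ge0.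
suff -> : multinomial_sum w n (fun c => ((c k)%:R - n%:R * w k) ^+ 2) = n%:R * (w k * (1 - w k)).
  rewrite ler_piMr// mulr_ile1 ?w0 ?subr_ge0//.
  by rewrite lerBlDr lerDl w0.
elim: n => [|n IH] /=; first by rewrite !mul0r subr0 expr0n.
(* the centred increment of the count of k when the letter i is added *)
pose e (i : I) : R := (k == i)%:R - w k.
have e0 : \sum_i w i * e i = 0.
  under eq_bigr do rewrite mulrBr.
  rewrite sumrB -mulr_suml w1 mul1r (bigD1 k)//= eqxx mulr1 big1 ?addr0 ?subrr//.
  by move=> i; rewrite eq_sym => /negbTE ->; rewrite mulr0.
have e2 : \sum_i w i * e i ^+ 2 = w k * (1 - w k).
  transitivity (\sum_i (w i * e i * (k == i)%:R - w k * (w i * e i))).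
    by apply: eq_bigr => i _; rewrite /e; ring.
  rewrite sumrB -mulr_sumr e0 mulr0 subr0 (bigD1 k)//= eqxx mulr1 big1 ?addr0.
    by rewrite /e eqxx.
  by move=> i; rewrite eq_sym => /negbTE ->; rewrite mulr0.
transitivity (\sum_i (w i * (n%:R * (w k * (1 - w k))) + 
    (w i * e i) * (2 * multinomial_sum w n (fun c => (c k)%:R - n%:R * w k)) + w i * e i ^+ 2)).
  apply: eq_bigr => i _; rewrite -IH -!mulrA -!mulrDr; congr (_ * _).
  rewrite -[e i ^+ 2](multinomial_sum_cst n _ w1) -!multinomial_sumZ -!multinomial_sumD.
  by apply: eq_multinomial_sum => c _; rewrite /bump_at /e natrD -natr1; ring.
by rewrite !big_split/= -!mulr_suml w1 e0 e2 -natr1; ring.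
Qed.

End multinomial.

Section urn_histories.
Context {R : realType} (a b c d S : nat).
Hypothesis (hS1 : (a + b)%N = S) (hS2 : (c + d)%N = S).
Implicit Types (u v : nat * nat) (f : nat * nat -> R).
Local Notation step := (urn_step a b c d).

Local Arguments urn_step : simpl never.

Definition urn_add u v : nat * nat := (u.1 + v.1, u.2 + v.2)%N.

Definition urn_size u : nat := (u.1 + u.2)%N.

Local Arguments urn_size : simpl never.

Lemma urn_size_step u r : urn_size (step u r) = (urn_size u + S)%N.
Proof. by rewrite /urn_size /urn_step; case: r => /=; [rewrite -hS1|rewrite -hS2]; lia. Qed.

(** Expectation before normalisation: each draw is weighted by the number of balls of its
    colour. In this form the dynamics is additive in the initial composition. *)
Fixpoint history_sum n u f : R :=
  if n is n'.+1 then u.1%:R * history_sum n' (step u true) f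
                   + u.2%:R * history_sum n' (step u false) f
  else f u.

Lemma eq_history_sum n u f f' : f =1 f' -> history_sum n u f = history_sum n u f'.
Proof. by move=> ff; elim: n u => [|n IH] u /=; rewrite ?ff ?IH. Qed.

Lemma history_sum_lin n u (x y : R) f f' :
  history_sum n u (fun v => x * f v + y * f' v) = x * history_sum n u f + y * history_sum n u f'.
Proof. by elim: n u => [//|n IH] u /=; rewrite !IH; ring. Qed.

Section tensor.
Context {I : finType}.
Implicit Types (us : I -> nat * nat) (cn : I -> nat) (r : seq I).

(** Separate urns us i, with cn i draws made in the i-th one, and f evaluated at the total
    composition. *)
Fixpoint history_tensor cn us r f u0 : R :=
  if r is i :: r' then history_sum (cn i) (us i) (fun u => history_tensor cn us r' f (urn_add u0 u))
  else f u0.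

Lemma eq_history_tensor cn cn' us us' r f u0 : {in r, cn =1 cn'} -> {in r, us =1 us'} ->
  history_tensor cn us r f u0 = history_tensor cn' us' r f u0.
Proof.
elim: r u0 => [//|i r IH] u0 cc uu /=; rewrite cc ?mem_head// uu ?mem_head//.
apply: eq_history_sum => u; apply: IH => j jr; [apply: cc|apply: uu];
  by rewrite in_cons jr orbT.
Qed.

Definition update_at us (i : I) (red : bool) : I -> nat * nat :=
  fun j => if j == i then step (us j) red else us j.

(** The additional draw in the i-th urn is made before all others, to match the first draw
    of the whole urn. *)
Lemma history_tensor_bump cn us r f u0 i : uniq r -> i \in r ->
  history_tensor (bump_at cn i) us r f u0 =
  (us i).1%:R * history_tensor cn (update_at us i true) r f u0 +
  (us i).2%:R * history_tensor cn (update_at us i false) r f u0.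
Proof.
elim: r u0 => [//|j r IH] u0 /= /andP[jr ur]; rewrite in_cons => /predU1P[->|ir].
  rewrite /bump_at /update_at !eqxx addn1 /=.
  have E red u : history_tensor (bump_at cn j) us r f u =
      history_tensor cn (update_at us j red) r f u.
    apply: eq_history_tensor => k kr; rewrite /bump_at /update_at;
      by case: eqP => [kj|_]; [rewrite kj (negbTE jr) in kr|rewrite ?addn0].
  congr (_ * _ + _ * _); apply: eq_history_sum => u; [exact: (E true)|exact: (E false)].
have ji : (j == i) = false by apply/negbTE; apply: contraNneq jr => ->.
rewrite {1}/bump_at {1 3}/update_at ji addn0 -history_sum_lin.
by apply: eq_history_sum => u; rewrite IH.
Qed.

Definition urn_total us : nat * nat := (\sum_i (us i).1, \sum_i (us i).2)%N.

Lemma urn_total_update us i red : urn_total (update_at us i red) = step (urn_total us) red.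
Proof.
rewrite /urn_total /update_at.
rewrite [in X in (X, _)](bigD1 i)//= [in X in (_, X)](bigD1 i)//= eqxx.
rewrite (eq_bigr (fun j => (us j).1)); last by move=> j /negbTE ->.
rewrite [in X in (_, X)](eq_bigr (fun j => (us j).2)); last by move=> j /negbTE ->.
have E1 : (\sum_j (us j).1 = (us i).1 + \sum_(j | j != i) (us j).1)%N by rewrite (bigD1 i).
have E2 : (\sum_j (us j).2 = (us i).2 + \sum_(j | j != i) (us j).2)%N by rewrite (bigD1 i).
rewrite E1 E2 /urn_step; case: red => /=; congr pair; lia.
Qed.

Lemma history_tensor0 us r f u0 : history_tensor (fun=> 0%N) us r f u0 =
  f (u0.1 + \sum_(i <- r) (us i).1, u0.2 + \sum_(i <- r) (us i).2)%N.
Proof.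
elim: r u0 => [|i r IH] u0 /=; first by rewrite !big_nil !addn0 -surjective_pairing.
by rewrite IH !big_cons /urn_add /= !addnA.
Qed.

(** The Leibniz rule: the first drawn ball belongs to one of the parts us i, with
    multiplicity the number of its balls of that colour, and only this part is changed. So a
    history of the whole urn is a shuffle of histories of the parts. *)
Lemma history_sum_total n us f :
  history_sum n (urn_total us) f =
  multinomial_sum (fun=> 1) n (fun cn => history_tensor cn us (index_enum I) f (0, 0)%N).
Proof.
elim: n us => [|n IH] us; first by rewrite /= history_tensor0/= !add0n.
rewrite [LHS]/= !natr_sum !mulr_suml -big_split/=; apply: eq_bigr => i _.
rewrite -(urn_total_update us i true) -(urn_total_update us i false) !IH mul1r.
rewrite -!multinomial_sumZ -multinomial_sumD; apply: eq_multinomial_sum => cn _.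
by rewrite history_tensor_bump// ?index_enum_uniq ?mem_index_enum.
Qed.

End tensor.

(** The expectation of f at the composition after n draws from u. *)
Fixpoint urn_mean n u f : R :=
  if n is n'.+1 then (u.1%:R * urn_mean n' (step u true) f
                   + u.2%:R * urn_mean n' (step u false) f) / (urn_size u)%:R
  else f u.

(** The total weight of the histories of length n from an urn of size s, as each draw adds S
    balls. *)
Definition rising (s n : nat) : R := \prod_(i < n) (s + i * S)%:R.

Lemma risingS s n : rising s n.+1 = s%:R * rising (s + S)%N n.
Proof.
rewrite /rising big_ord_recl/= mul0n addn0; congr (_ * _).
by apply: eq_bigr => i _; rewrite /bump/= add1n mulSn addnA.
Qed.

Lemma rising_gt0 s n : (0 < s)%N -> 0 < rising s n.
Proof. by move=> s0; apply: prodr_gt0 => i _; rewrite ltr0n ltn_addr. Qed.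

Lemma history_sum_mean n u f : (0 < urn_size u)%N ->
  history_sum n u f = rising (urn_size u) n * urn_mean n u f.
Proof.
elim: n u => [|n IH] u u0 /=; first by rewrite /rising big_ord0 mul1r.
have hs r : (0 < urn_size (step u r))%N by rewrite urn_size_step ltn_addr.
rewrite !IH// !urn_size_step risingS.
by field; rewrite pnatr_eq0 -lt0n.
Qed.

Lemma eq_urn_mean n u f f' : f =1 f' -> urn_mean n u f = urn_mean n u f'.
Proof. by move=> ff; elim: n u => [|n IH] u /=; rewrite ?ff ?IH. Qed.

Lemma urn_mean_lin n u (x y : R) f f' :
  urn_mean n u (fun v => x * f v + y * f' v) = x * urn_mean n u f + y * urn_mean n u f'.
Proof. by elim: n u => [//|n IH] u /=; rewrite !IH; ring. Qed.

Lemma urn_mean_cst n u k : (0 < urn_size u)%N -> urn_mean n u (fun=> k) = k.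
Proof.
elim: n u => [//|n IH] u u0 /=.
have hs r : (0 < urn_size (step u r))%N by rewrite urn_size_step ltn_addr.
rewrite !IH//.
have -> : (urn_size u)%:R = u.1%:R + u.2%:R :> R by rewrite -natrD.
rewrite -mulrDl mulrAC mulfV ?mul1r//.
by rewrite -natrD pnatr_eq0 -lt0n.
Qed.

Lemma le_urn_mean n u f f' : (forall v, f v <= f' v) -> urn_mean n u f <= urn_mean n u f'.
Proof.
move=> ff; elim: n u => [//|n IH] u /=.
by rewrite ler_wpM2r ?invr_ge0// lerD// ler_wpM2l.
Qed.

Lemma urn_meanB n u f f' :
  urn_mean n u (fun v => f v - f' v) = urn_mean n u f - urn_mean n u f'.
Proof.
have := urn_mean_lin n u 1 (-1) f f'; rewrite mul1r mulN1r => <-.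
by apply: eq_urn_mean => v; rewrite mul1r mulN1r.
Qed.

Lemma norm_urn_mean n u f : `|urn_mean n u f| <= urn_mean n u (fun v => `|f v|).
Proof.
rewrite ler_norml; apply/andP; split; last by apply: le_urn_mean => v; exact: ler_norm.
have := urn_mean_lin n u (-1) 0 (fun v => `|f v|) f; rewrite mul0r addr0 mulN1r => <-.
by apply: le_urn_mean => v; rewrite mul0r addr0 mulN1r lerNl ler_normr lexx orbT.
Qed.

Section mean_tensor.
Context {I : finType}.
Implicit Types (us : I -> nat * nat) (cn : I -> nat) (r : seq I).

Fixpoint mean_tensor cn us r f u0 : R :=
  if r is i :: r' then urn_mean (cn i) (us i) (fun u => mean_tensor cn us r' f (urn_add u0 u))
  else f u0.

Lemma history_tensor_mean cn us r f u0 : (forall i, urn_size (us i) = 1%N) ->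
  history_tensor cn us r f u0 = (\prod_(i <- r) rising 1 (cn i)) * mean_tensor cn us r f u0.
Proof.
move=> u1; elim: r u0 => [|i r IH] u0 /=; first by rewrite big_nil mul1r.
rewrite (eq_history_sum _ _ (fun u => IH (urn_add u0 u))).
set K := \prod_(i <- r) _.
have E : history_sum (cn i) (us i) (fun u => K * mean_tensor cn us r f (urn_add u0 u) + 0 * 0)
    = K * history_sum (cn i) (us i) (fun u => mean_tensor cn us r f (urn_add u0 u)).
  by rewrite history_sum_lin mul0r addr0.
rewrite big_cons -/K mulrAC -mulrA [_ * K]mulrC.
transitivity (K * history_sum (cn i) (us i) (fun u => mean_tensor cn us r f (urn_add u0 u))).
  by rewrite -E; apply: eq_history_sum => u; rewrite mul0r addr0.
by rewrite history_sum_mean ?u1// mulrCA.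
Qed.

(** Normalising the Leibniz rule produces the weights of a Dirichlet-multinomial law on the
    numbers of draws made in the parts. *)
Lemma urn_mean_total n us f : (forall i, urn_size (us i) = 1%N) -> (0 < #|I|)%N ->
  urn_mean n (urn_total us) f =
  multinomial_sum (fun=> 1) n (fun cn =>
    (\prod_i rising 1 (cn i)) / rising #|I| n * mean_tensor cn us (index_enum I) f (0, 0)%N).
Proof.
move=> u1 I0.
have sz : urn_size (urn_total us) = #|I|.
  rewrite /urn_size /urn_total/= -big_split/= -sum1_card.
  by apply: eq_bigr => i _; exact: u1.
have := history_sum_total n us f.
rewrite history_sum_mean sz// => E.
have r0 : rising #|I| n != 0 by rewrite gt_eqF// rising_gt0.
apply: (mulfI r0); rewrite E -multinomial_sumZ; apply: eq_multinomial_sum => cn _.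
by rewrite history_tensor_mean//; field.
Qed.

End mean_tensor.


Section second_moment.
Let m : R := a%:R - c%:R.
Hypothesis S0 : (0 < S)%N.
Local Notation x := (u2 R b c S).

Definition urn_growth n (s : nat) : R := \prod_(i < n) (1 + m / (s + i * S)%:R).

Lemma urn_growthS n s : urn_growth n.+1 s = (1 + m / s%:R) * urn_growth n (s + S).
Proof.
rewrite /urn_growth big_ord_recl/= mul0n addn0; congr (_ * _).
by apply: eq_bigr => i _; rewrite /bump/= add1n mulSn addnA.
Qed.

Let SE : S%:R = a%:R + b%:R :> R. Proof. by rewrite -hS1 natrD. Qed.
Let SE' : S%:R = c%:R + d%:R :> R. Proof. by rewrite -hS2 natrD. Qed.
Let Sn0 : S%:R != 0 :> R. Proof. by rewrite pnatr_eq0 -lt0n. Qed.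

(** The linear form u2 is an eigenform of the replacement matrix for the eigenvalue m. *)
Lemma u2_step u (r : bool) : x (step u r) = x u + (if r then b%:R else - c%:R) * (m / S%:R).
Proof.
rewrite /u2 /urn_step /m; case: r => /=; rewrite !natrD; first by field.
have -> : a%:R = c%:R + d%:R - b%:R :> R by rewrite -SE' SE addrK.
by field.
Qed.

Lemma u2D u v : x (urn_add u v) = x u + x v.
Proof. by rewrite /u2 /urn_add/= !natrD; field. Qed.

Lemma urn_mean_u2 n u : (0 < urn_size u)%N -> urn_mean n u x = urn_growth n (urn_size u) * x u.
Proof.
elim: n u => [|n IH] u u0 /=; first by rewrite /urn_growth big_ord0 mul1r.
have hs r : (0 < urn_size (step u r))%N by rewrite urn_size_step ltn_addr.
rewrite !IH// !urn_size_step urn_growthS !u2_step.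
have sn0 : u.1%:R + u.2%:R != 0 :> R by rewrite -natrD pnatr_eq0 -lt0n.
rewrite [(urn_size u)%:R]natrD /u2.
by field; rewrite sn0 Sn0.
Qed.

Variable B : R.
Hypothesis hB : ((b%:R + c%:R) * (m / S%:R)) ^+ 2 + B * S%:R <= 2 * m * B.
Hypothesis B0 : 0 <= B.

(** The right-hand side dominates its own conditional expectation after one draw; this is
    what hB says. Such a B exists because 2 m > S, and its term linear in the size absorbs
    the variance added by each draw. *)
Lemma urn_mean_u2_sq n u : (0 < urn_size u)%N ->
  urn_mean n u (fun v => x v ^+ 2) <=
  (x u ^+ 2 + B * (urn_size u)%:R) * urn_growth n (urn_size u) ^+ 2
   - B * (urn_size u + n * S)%:R.
Proof.
elim: n u => [|n IH] u u0 /=.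
  by rewrite /urn_growth big_ord0 expr1n mulr1 mul0n addn0 addrK.
have hs r : (0 < urn_size (step u r))%N by rewrite urn_size_step ltn_addr.
have s0 : 0 < (urn_size u)%:R :> R by rewrite ltr0n.
rewrite ler_pdivrMr//.
apply: (le_trans (lerD (ler_wpM2l (ler0n _ _) (IH _ (hs true))) (ler_wpM2l (ler0n _ _) (IH _ (hs false))))).
rewrite !urn_size_step urn_growthS !u2_step.
rewrite (_ : (urn_size u + S + n * S = urn_size u + n.+1 * S)%N); last by rewrite mulSn addnA.
set g := urn_growth n _; set N := (_ + n.+1 * S)%:R.
have sE : (urn_size u)%:R = u.1%:R + u.2%:R :> R by rewrite -natrD.
rewrite natrD; set s : R := (urn_size u)%:R in s0 sE *.
set r1 : R := u.1%:R in sE *; set r2 : R := u.2%:R in sE *.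
have r10 : 0 <= r1 by exact: ler0n.
have r20 : 0 <= r2 by exact: ler0n.
pose y := x u; rewrite -/y.
have hB' := hB; set k := m / S%:R in hB' *.
have yE : r1 * b%:R - r2 * c%:R = y * S%:R.
  by rewrite /y /u2 divfK// mulrC [_ * r2]mulrC.
have step2 : r1 * ((y + b%:R * k) ^+ 2 + B * (s + S%:R)) + r2 * ((y + - c%:R * k) ^+ 2 + B * (s + S%:R))
    <= (y ^+ 2 + B * s) * (1 + m / s) ^+ 2 * s.
  have kS : k * S%:R = m by rewrite /k divfK.
  have ->: r1 * ((y + b%:R * k) ^+ 2 + B * (s + S%:R)) + r2 * ((y + - c%:R * k) ^+ 2 + B * (s + S%:R))
     = s * y ^+ 2 + 2 * y * (k * (r1 * b%:R - r2 * c%:R)) + (r1 * (b%:R * k) ^+ 2 + r2 * (c%:R * k) ^+ 2) + s * (B * (s + S%:R)).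
    by rewrite sE; ring.
  rewrite yE (_ : k * (y * S%:R) = m * y); last by rewrite -kS; ring.
  have -> : (y ^+ 2 + B * s) * (1 + m / s) ^+ 2 * s =
     s * y ^+ 2 + 2 * m * y ^+ 2 + B * s ^+ 2 + 2 * m * B * s + (y ^+ 2 + B * s) * m ^+ 2 / s.
    by field; rewrite gt_eqF.
  have last0 : 0 <= (y ^+ 2 + B * s) * m ^+ 2 / s.
    by rewrite divr_ge0 ?(ltW s0)// mulr_ge0 ?sqr_ge0// addr_ge0 ?sqr_ge0// mulr_ge0// ltW.
  have b0 : 0 <= b%:R :> R by []. have c0 : 0 <= c%:R :> R by [].
  have q1 : (b%:R * k) ^+ 2 <= ((b%:R + c%:R) * k) ^+ 2.
    rewrite exprMn [leRHS]exprMn; apply: ler_wpM2r; first exact: sqr_ge0.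
    by rewrite lerXn2r ?nnegrE ?addr_ge0 ?lerDl ?lerDr.
  have q2 : (c%:R * k) ^+ 2 <= ((b%:R + c%:R) * k) ^+ 2.
    rewrite exprMn [leRHS]exprMn; apply: ler_wpM2r; first exact: sqr_ge0.
    by rewrite lerXn2r ?nnegrE ?addr_ge0 ?lerDl ?lerDr.
  have q : r1 * (b%:R * k) ^+ 2 + r2 * (c%:R * k) ^+ 2 <= s * ((b%:R + c%:R) * k) ^+ 2.
    by rewrite sE mulrDl lerD// ler_wpM2l.
  have : s * (((b%:R + c%:R) * k) ^+ 2 + B * S%:R) <= s * (2 * m * B) by rewrite ler_pM2l.
  lra.
have g2 : 0 <= g ^+ 2 by exact: sqr_ge0.
have := ler_wpM2r g2 step2.
rewrite exprMn => h.
have -> : r1 * (((y + b%:R * k) ^+ 2 + B * (s + S%:R)) * g ^+ 2 - B * N) +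
  r2 * (((y + - c%:R * k) ^+ 2 + B * (s + S%:R)) * g ^+ 2 - B * N) =
  (r1 * ((y + b%:R * k) ^+ 2 + B * (s + S%:R)) + r2 * ((y + - c%:R * k) ^+ 2 + B * (s + S%:R))) * g ^+ 2 - s * (B * N).
  by rewrite sE; ring.
apply: (le_trans (lerD h (lexx _))).
by rewrite le_eqVlt; apply/orP; left; apply/eqP; ring.
Qed.

Lemma urn_variance n u : (0 < urn_size u)%N ->
  urn_mean n u (fun v => (x v - urn_growth n (urn_size u) * x u) ^+ 2) <=
  B * (urn_size u)%:R * urn_growth n (urn_size u) ^+ 2.
Proof.
move=> u0; set g := urn_growth _ _.
have -> : urn_mean n u (fun v => (x v - g * x u) ^+ 2) =
   urn_mean n u (fun v => x v ^+ 2) - 2 * (g * x u) * urn_mean n u x + (g * x u) ^+ 2.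
  transitivity (urn_mean n u (fun v => 1 * (1 * x v ^+ 2 + - (2 * (g * x u)) * x v) + 1 * (g * x u) ^+ 2)).
    by apply: eq_urn_mean => v; ring.
  rewrite (urn_mean_lin n u 1 1 (fun v => 1 * x v ^+ 2 + - (2 * (g * x u)) * x v) (fun=> (g * x u) ^+ 2)).
  by rewrite urn_mean_lin urn_mean_cst//; ring.
rewrite urn_mean_u2// -/g.
have := urn_mean_u2_sq n u0; rewrite -/g.
have : 0 <= B * (urn_size u + n * S)%:R by rewrite mulr_ge0.
lra.
Qed.

End second_moment.

(** The expectation of a function of the whole history, needed for joint laws of
    compositions at two times. *)
Fixpoint path_mean n u (F : seq bool -> R) : R :=
  if n is n'.+1 then (u.1%:R * path_mean n' (step u true) (fun h => F (true :: h))
                   + u.2%:R * path_mean n' (step u false) (fun h => F (false :: h))) / (urn_size u)%:R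
  else F [::].

Lemma eq_path_mean n u F F' : F =1 F' -> path_mean n u F = path_mean n u F'.
Proof.
elim: n u F F' => [|n IH] u F F' FF /=; first exact: FF.
by congr ((_ * _ + _ * _) / _); apply: IH => h; exact: FF.
Qed.

Lemma path_mean_after n u f :
  path_mean n u (fun h => f (urn_after a b c d u h)) = urn_mean n u f.
Proof. by elim: n u => [//|n IH] u /=; rewrite -!IH. Qed.

Lemma path_mean_cat k j u F : path_mean (k + j) u F =
  path_mean k u (fun h => path_mean j (urn_after a b c d u h) (fun h' => F (h ++ h'))).
Proof. by elim: k u F => [//|k IH] u F /=; rewrite !IH. Qed.

Lemma le_path_mean_size n u (F F' : seq bool -> R) :
  (forall h, size h = n -> F h <= F' h) -> path_mean n u F <= path_mean n u F'.
Proof.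
elim: n u F F' => [|n IH] u F F' FF /=; first exact: FF.
rewrite ler_wpM2r ?invr_ge0// lerD// ler_wpM2l//; apply: IH => h hn; apply: FF; rewrite /= hn//.
Qed.

Lemma path_mean_cst n u k : (0 < urn_size u)%N -> path_mean n u (fun=> k) = k :> R.
Proof.
move=> uu; transitivity (urn_mean n u (fun=> k)); last exact: urn_mean_cst.
exact: (path_mean_after n u (fun=> k)).
Qed.

End urn_histories.

(** * Urn limits solve the system *)

Section power_modulus.
Context {R : realType}.
Implicit Types s w sigma : R.

Lemma powR_subadditive sigma w s : 0 < sigma <= 1 -> 0 <= w <= s ->
  s `^ sigma <= w `^ sigma + (s - w) `^ sigma.
Proof.
move=> /andP[sg0 sg1] /andP[w0 ws].
have [s0|s0] := leP s 0.
  have -> : s = 0 by apply/eqP; rewrite eq_le s0 (le_trans w0 ws).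
  by rewrite powR0 ?gt_eqF// addr_ge0 ?powR_ge0.
have frac (x : R) : 0 <= x <= s -> x / s * s `^ sigma <= x `^ sigma.
  move=> /andP[]; rewrite le_eqVlt => /predU1P[<- _|x0 xs]; first by rewrite mul0r mul0r powR_ge0.
  have -> : x `^ sigma = (x / s) `^ sigma * s `^ sigma.
    by rewrite -powRM ?divfK ?gt_eqF// ?divr_ge0 ?ltW.
  rewrite ler_wpM2r ?powR_ge0// ger1_powR// divr_gt0//=.
  by rewrite ler_pdivrMr// mul1r.
have -> : s `^ sigma = w / s * s `^ sigma + (s - w) / s * s `^ sigma.
  by rewrite -mulrDl -mulrDl addrC subrK mulfV ?mul1r// gt_eqF.
apply: lerD; apply: frac; first by rewrite w0.
by rewrite subr_ge0 ws/= lerBlDr lerDl.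
Qed.

Lemma powR_dist sigma s w : 0 < sigma <= 1 -> 0 <= s -> 0 <= w ->
  `|s `^ sigma - w `^ sigma| <= `|s - w| `^ sigma.
Proof.
move=> sg; wlog ws : s w / w <= s.
  move=> H s0 w0; have [ws|/ltW sw] := leP w s; first exact: H.
  by rewrite distrC [`|s - w|]distrC H.
move=> s0 w0; have /andP[sg0 _] := sg.
rewrite [`|s - w|]ger0_norm ?subr_ge0// ger0_norm ?subr_ge0.
  by rewrite lerBlDl powR_subadditive// w0.
by apply: ge0_ler_powR; rewrite ?nnegrE// ltW.
Qed.

(** If |s - w| is below delta = e^(1/sigma), Hoelder continuity gives e; otherwise the left
    side is at most 1, hence at most (s - w)^2 / delta^2. The quadratic term is what a
    variance bound controls. *)
Lemma powR_modulus sigma (e : R) : 0 < sigma <= 1 -> 0 < e ->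
  exists2 C : R, 0 <= C & forall s w, 0 <= s <= 1 -> 0 <= w <= 1 ->
    `|s `^ sigma - w `^ sigma| <= e + C * (s - w) ^+ 2.
Proof.
move=> sg e0; have /andP[sg0 sg1] := sg.
(* the Hoelder modulus del^sigma equals e *)
pose del := e `^ sigma^-1.
have del0 : 0 < del by exact: powR_gt0.
exists (del ^- 2); first by rewrite invr_ge0 sqr_ge0.
move=> s w /andP[s0 s1] /andP[w0 w1].
have [h|h] := leP `|s - w| del.
  apply: (@le_trans _ _ e); last by rewrite lerDl mulr_ge0 ?sqr_ge0// invr_ge0 sqr_ge0.
  apply: (le_trans (powR_dist sg s0 w0)).
  have -> : e = del `^ sigma by rewrite /del -powRrM mulVf ?powRr1 ?gt_eqF// ltW.
  by apply: ge0_ler_powR; rewrite ?nnegrE// ltW.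
apply: (@le_trans _ _ 1).
  have p1 (x : R) : 0 <= x <= 1 -> 0 <= x `^ sigma <= 1.
    move=> /andP[x0 x1]; rewrite powR_ge0/=.
    have e1 : 1 `^ sigma = 1 :> R by rewrite powR1.
    rewrite -[leRHS]e1.
    by apply: ge0_ler_powR; rewrite ?nnegrE// ltW.
  have /andP[? ?] := p1 s (introT andP (conj s0 s1)).
  have /andP[? ?] := p1 w (introT andP (conj w0 w1)).
  by rewrite ler_norml; apply/andP; split; lra.
apply: (@le_trans _ _ (del ^- 2 * (s - w) ^+ 2)); last by rewrite lerDr ltW.
rewrite -ler_pdivrMl ?invr_gt0 ?exprn_gt0// invrK mulr1 -[leRHS]real_normK ?num_real//.
by rewrite lerXn2r ?nnegrE// ltW.
Qed.

End power_modulus.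

Section lipschitz_smear.
Context {R : realType}.
Implicit Types (f : R -> R) (L : R).

Definition lipschitz_test L f := bounded_measurable f /\ forall x y, `|f x - f y| <= L * `|x - y|.

(** The increment bound at h = 1 shows that g is bounded, which gives the Lipschitz bound
    for |h| <= 1; for |h| >= 1 boundedness of f suffices. *)
Lemma smooth_lipschitz_test L f : smooth_test L f -> exists2 K, 0 <= K & lipschitz_test K f.
Proof.
move=> [bf [g [mg fg]]]; have [mf [M fM]] := bf.
have M0 : 0 <= M by apply: le_trans (fM 0).
have L0 : 0 <= L.
  by have := fg 0 1; rewrite expr1n !mulr1; apply: le_trans.
have gM x : `|g x| <= M + M + L.
  have h1 := fg x 1; rewrite expr1n !mulr1 in h1.
  have -> : g x = (f (x + 1) - f x) - (f (x + 1) - f x - g x) by ring.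
  by rewrite (le_trans (ler_normB _ _))// lerD// (le_trans (ler_normB _ _))// lerD.
exists (M + M + L + L); first by rewrite !addr_ge0.
split=> // y x; pose h := y - x; have yE : y = x + h by rewrite /h; ring.
rewrite -/h yE; have [h1|h1] := leP `|h| 1.
  have -> : f (x + h) - f x = (f (x + h) - f x - g x * h) + g x * h by ring.
  rewrite (le_trans (ler_normD _ _))// [leRHS]mulrDl addrC lerD//.
    by rewrite normrM ler_wpM2r.
  apply: (le_trans (fg x h)).
  by rewrite ler_wpM2l// -[leLHS]real_normK ?num_real// expr2 ler_piMl.
apply: (@le_trans _ _ (M + M)); first by rewrite (le_trans (ler_normB _ _))// lerD.
rewrite -[leLHS]mulr1 ler_pM ?addr_ge0 ?(ltW h1)//; lra.
Qed.

Lemma lipschitz_test_affine L f y s :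
  lipschitz_test L f -> lipschitz_test (L * `|s|) (fun x => f (y + s * x)).
Proof.
move=> [bf Lf]; split.
  have ma : measurable_fun [set: R] (fun x : R => y + s * x).
    by apply: measurable_funD => //; exact: measurable_funM.
  exact: (bounded_measurable_comp ma bf).
move=> x z; apply: (le_trans (Lf _ _)).
by rewrite (_ : y + s * x - (y + s * z) = s * (x - z)) ?normrM ?mulrA//; ring.
Qed.

(** Both sides are expectations over the same variables, so only the coefficients and
    starting points differ. *)
Lemma smear_shift_dist (I : eqType) (s s' : I -> R) (mu : I -> probability R R) (r : seq I) f L M y y' :
  0 <= L -> lipschitz_test L f ->
  (forall i, (mu i).-integrable setT (EFin \o (@id R))) ->
  (forall i, \int[mu i]_x `|x| <= M) ->
  `|smear s mu r f y - smear s' mu r f y'| <= L * (`|y - y'| + M * \sum_(i <- r) `|s i - s' i|).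
Proof.
move=> L0 [bf Lf] im mM; elim: r y y' => [|i r IH] y y' /=.
  by rewrite big_nil mulr0 addr0.
have ma (z t : R) : measurable_fun [set: R] (fun x : R => z + t * x).
  by apply: measurable_funD => //; exact: measurable_funM.
have b1 := bounded_measurable_comp (ma y (s i)) (bounded_measurable_smear1 s mu r bf).
have b2 := bounded_measurable_comp (ma y' (s' i)) (bounded_measurable_smear1 s' mu r bf).
rewrite -expectB; [|exact: bounded_measurable_integrable..].
have ia : (mu i).-integrable setT (EFin \o (fun x : R => `|x|)).
  by have := integrable_norm (im i).
pose K := `|y - y'| + M * \sum_(j <- r) `|s j - s' j|.
have ig : (mu i).-integrable setT (EFin \o (fun x : R => L * `|s i - s' i| * `|x|)).
  exact: integrable_realZ.
have ik : (mu i).-integrable setT (EFin \o (fun _ : R => L * K)).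
  exact: integrable_real_cst.
apply: (@le_trans _ _ (\int[mu i]_x (L * K + L * `|s i - s' i| * `|x|))).
  apply: le_expect_norm.
  - exact/bounded_measurable_integrable/bounded_measurableB.
  - by apply: integrable_realD.
  - move=> x; apply: (le_trans (IH _ _)).
    rewrite (_ : L * K + _ = L * ((`|y - y'| + `|s i - s' i| * `|x|) + M * \sum_(j <- r) `|s j - s' j|)); last by rewrite /K; ring.
    rewrite ler_wpM2l// lerD2r.
    rewrite (_ : y + s i * x - (y' + s' i * x) = (y - y') + (s i - s' i) * x); last by ring.
    by rewrite (le_trans (ler_normD _ _))// normrM.
rewrite expectD// expect_cst RintegralZl// big_cons /K.
rewrite -mulrA -mulrDr ler_wpM2l//.
rewrite mulrDr -addrA lerD2l addrC lerD2r mulrC ler_wpM2r//.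
Qed.

Lemma smear_lipschitz_test (I : eqType) (s : I -> R) (mu : I -> probability R R) (r : seq I) f L :
  0 <= L -> lipschitz_test L f -> lipschitz_test L (smear s mu r f).
Proof.
move=> L0 [bf Lf]; split; first exact: bounded_measurable_smear1.
elim: r => [//|i r IH] x y /=.
have ma (z : R) : measurable_fun [set: R] (fun x : R => z + s i * x).
  by apply: measurable_funD => //; exact: measurable_funM.
have b z := bounded_measurable_comp (ma z) (bounded_measurable_smear1 s mu r bf).
rewrite -expectB; [|exact: (bounded_measurable_integrable _ (b x))|exact: (bounded_measurable_integrable _ (b y))].
apply: le_expect_bound; first by have [] := bounded_measurableB (b x) (b y).
move=> z; apply: (le_trans (IH _ _)).
by rewrite (_ : x + s i * z - (y + s i * z) = x - y)//; ring.
Qed.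

End lipschitz_smear.

Section simplex_coordinates.
Context {R : realType} (n : nat).
Local Notation simplex := (n.+1.-tuple R).
Implicit Types (D : probability simplex R) (v : simplex).

(** The coordinates of v, replaced by those of a vertex off the simplex: almost surely
    nothing changes, and the weights form a probability vector for every v, as the estimates
    on multinomial sums require. *)
Definition simplex_coord v (k : 'I_n.+1) : R :=
  if in_simplex v then tnth v k else (k == ord0)%:R.

Lemma simplex_coord_ge0 v k : 0 <= simplex_coord v k.
Proof.
rewrite /simplex_coord; case: ifPn => [/andP[/forallP/(_ k)/andP[]]|] //.
Qed.

Lemma simplex_coord_sum v : \sum_k simplex_coord v k = 1.
Proof.
have [vs|/negbTE vs] := boolP (in_simplex v).
  rewrite (eq_bigr (tnth v)); last by move=> k _; rewrite /simplex_coord vs.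
  by move: vs => /andP[_ /eqP].
rewrite (eq_bigr (fun k => (k == ord0)%:R)); last by move=> k _; rewrite /simplex_coord vs.
by rewrite (bigD1 ord0)//= big1 ?addr0// => i /negbTE ->.
Qed.

Lemma simplex_coord_le1 v k : simplex_coord v k <= 1.
Proof.
by rewrite -(simplex_coord_sum v) (bigD1 k)//= lerDl sumr_ge0// => i _; exact: simplex_coord_ge0.
Qed.

Lemma measurable_simplex_coord k : measurable_fun [set: simplex] (simplex_coord^~ k).
Proof.
have mb : measurable_fun [set: simplex] (fun v : simplex => in_simplex v).
  apply: (@measurable_fun_bool _ _ _ _ true).
  rewrite setTI (_ : _ @^-1` _ = [set v : simplex | in_simplex v]); first exact: measurable_in_simplex.
  by apply/seteqP; split=> v.
by apply: measurable_fun_ifT => //; exact: measurable_tnth.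
Qed.

Lemma bounded_measurable_simplex_coord k : bounded_measurable (simplex_coord^~ k).
Proof.
split; first exact: measurable_simplex_coord.
by exists 1 => v; rewrite ger0_norm ?simplex_coord_ge0 ?simplex_coord_le1.
Qed.

Lemma expect_eq_simplex (p : 'I_n.+1 -> R) D (f g : simplex -> R) : is_dirichlet p D ->
  measurable_fun [set: simplex] f -> measurable_fun [set: simplex] g ->
  (forall v, in_simplex v -> f v = g v) -> \int[D]_v f v = \int[D]_v g v.
Proof.
move=> dD mf mg fg; congr fine; apply: ae_eq_integral => //.
- exact/measurable_EFinP.
- exact/measurable_EFinP.
exists (~` [set v : simplex | in_simplex v]); split.
- by apply: measurableC; exact: measurable_in_simplex.
- have := probability_setC D (@measurable_in_simplex R n).
  by rewrite (dirichlet_in_simplex dD) subee.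
- move=> v /= h vs; apply: h => _; by rewrite fg.
Qed.

End simplex_coordinates.

Section multinomial_mixture.
Context {R : realType}.

Lemma bounded_measurable_multinomial d (T : measurableType d) (I : finType) n
    (w : T -> I -> R) (G : (I -> nat) -> T -> R) :
  (forall i, bounded_measurable (w^~ i)) -> (forall c, bounded_measurable (G c)) ->
  bounded_measurable (fun v => multinomial_sum (w v) n (fun c => G c v)).
Proof.
move=> bw; elim: n G => [|n IH] G bG /=; first exact: bG.
elim: (index_enum I) => [|i r IHr].
  rewrite (_ : (fun v => _) = fun=> 0); first exact: bounded_measurable_cst.
  by apply/funext => v; rewrite big_nil.
rewrite (_ : (fun v => _) = fun v => w v i * multinomial_sum (w v) n (fun c => G (bump_at c i) v) +
   \sum_(j <- r) w v j * multinomial_sum (w v) n (fun c => G (bump_at c j) v)); last first.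
  by apply/funext => v; rewrite big_cons.
apply: bounded_measurableD => //.
by apply: bounded_measurableM => //; exact: IH.
Qed.

Lemma expect_multinomial_sum d (T : measurableType d) (P : probability T R) (I : finType) n
    (G : (I -> nat) -> T -> R) : (forall c, bounded_measurable (G c)) ->
  \int[P]_v multinomial_sum (fun=> 1) n (fun c => G c v) =
  multinomial_sum (fun=> 1) n (fun c => \int[P]_v G c v).
Proof.
elim: n G => [//|n IH] G bG /=.
rewrite expect_sum; last first.
  move=> i; apply: bounded_measurable_integrable; apply: bounded_measurableM.
    exact: bounded_measurable_cst.
  apply: (@bounded_measurable_multinomial _ _ _ _ (fun _ _ => 1)) => // i'.
  exact: bounded_measurable_cst.
apply: eq_bigr => i _; rewrite mul1r -IH//.
by apply: eq_expect => v; rewrite mul1r.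
Qed.

Context (S : nat) (D : probability (S.+1.-tuple R) R).
Hypothesis S0 : (0 < S)%N.
Hypothesis dD : is_dirichlet (fun=> S%:R^-1) D.
Hypothesis dp : dirichlet_powers D S%:R^-1.

(** The moment formula turns into rising factorials by the functional equation of Gamma; the
    factors S come from multiplying each term 1/S + i by S. *)
Lemma expect_simplex_monomial n (c : 'I_S.+1 -> nat) : (\sum_k c k)%N = n ->
  \int[D]_v (\prod_k simplex_coord v k ^+ c k) =
  (\prod_k rising S 1 (c k)) / rising S S.+1 n.
Proof.
move=> cn.
have Sr0 : S%:R != 0 :> R by rewrite pnatr_eq0 -lt0n.
pose p : R := S%:R^-1; have p0 : 0 < p by rewrite invr_gt0 ltr0n.
pose e (k : nat) : R := (c (inord k))%:R.
have -> : \int[D]_v (\prod_k simplex_coord v k ^+ c k) = \int[D]_v (\prod_(k < S.+1) tnth v k `^ e k).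
  apply: (expect_eq_simplex dD).
  - apply: measurable_prod => k _; apply: measurable_funX; exact: measurable_simplex_coord.
  - apply: measurable_prod => k _; exact: measurable_tnth_power.
  - move=> v vs; apply: eq_bigr => k _; rewrite /e inord_val /simplex_coord vs powR_mulrn//.
    by move: vs => /andP[/forallP/(_ k)/andP[]].
rewrite /Rintegral dp; last by move=> i; exact: ler0n.
rewrite /= -/p.
have E1 k : Gamma (p + e (k : 'I_S.+1)) / Gamma p = rising S 1 (c k) / S%:R ^+ c k.
  rewrite /e inord_val Gamma_prod// mulrAC mulfV ?mul1r ?gt_eqF ?Gamma_gt0//.
  have -> : S%:R ^+ c k = \prod_(i < c k) (S%:R : R) by rewrite prodr_const card_ord.
  rewrite /rising -prodf_div; apply: eq_bigr => i _.
  by rewrite natrD natrM /p; field.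
rewrite (eq_bigr (fun k : 'I_S.+1 => rising S 1 (c k) / S%:R ^+ c k)); last by move=> k _; exact: E1.
have -> : \sum_(k < S.+1) e k = n%:R.
  by rewrite -cn natr_sum; apply: eq_bigr => k _; rewrite /e inord_val.
have ps0 : 0 < p *+ S.+1 by rewrite mulrn_wgt0.
rewrite prodf_div.
have -> : \prod_(k < S.+1) S%:R ^+ c k = S%:R ^+ n :> R.
  by rewrite -cn; elim/big_rec2: _ => [|k y x _ ->]; rewrite ?expr0// exprD.
rewrite (Gamma_prod _ ps0).
have E2 : \prod_(i < n) (p *+ S.+1 + i%:R) = rising S S.+1 n / S%:R ^+ n.
  have -> : S%:R ^+ n = \prod_(i < n) (S%:R : R) by rewrite prodr_const card_ord.
  rewrite /rising -prodf_div; apply: eq_bigr => i _.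
  by rewrite natrD natrM /p -mulr_natl; field.
rewrite E2.
have g0 : Gamma (p *+ S.+1) != 0 by rewrite gt_eqF// Gamma_gt0.
have r0 : rising S S.+1 n != 0 :> R by rewrite gt_eqF// rising_gt0.
have Sn0 : S%:R ^+ n != 0 :> R by rewrite expf_neq0.
move: (Gamma _) (\prod_(i < S.+1) _) g0 => x y x0.
by field; rewrite x0 r0 Sn0.
Qed.

(** A multinomial law with Dirichlet weights is Dirichlet-multinomial. *)
Lemma expect_multinomial_mixture n (G : ('I_S.+1 -> nat) -> R) :
  \int[D]_v multinomial_sum (simplex_coord v) n G =
  multinomial_sum (fun=> 1) n (fun c => (\prod_k rising S 1 (c k)) / rising S S.+1 n * G c).
Proof.
under eq_Rintegral do rewrite multinomial_sum_weight.
have bm (c : 'I_S.+1 -> nat) : bounded_measurable (fun v : S.+1.-tuple R => \prod_k simplex_coord v k ^+ c k).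
  split.
    by apply: measurable_prod => k _; apply: measurable_funX; exact: measurable_simplex_coord.
  exists 1 => v; rewrite ger0_norm; last by apply: prodr_ge0 => k _; rewrite exprn_ge0// simplex_coord_ge0.
  apply: prodr_ile1 => k _; rewrite exprn_ge0 ?simplex_coord_ge0//=.
  by rewrite exprn_ile1 ?simplex_coord_ge0 ?simplex_coord_le1.
rewrite (expect_multinomial_sum D n (G := fun c v => (\prod_k simplex_coord v k ^+ c k) * G c)); last first.
  by move=> c; apply: bounded_measurableM => //; exact: bounded_measurable_cst.
apply: eq_multinomial_sum => c cn.
rewrite RintegralZr//; last exact: bounded_measurable_integrable.
by rewrite (expect_simplex_monomial cn).
Qed.

End multinomial_mixture.

Section urn_limit.
Context {R : realType} (a b c d S : nat) (sigma : R).
Hypotheses (hS1 : (a + b)%N = S) (hS2 : (c + d)%N = S).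
Hypothesis S0 : (0 < S)%N.
Hypothesis sg : 0 < sigma <= 1.
Local Notation urn_mean := (urn_mean a b c d).
Local Notation x := (u2 R b c S).

(** The composition after j draws is close in law, on Lipschitz tests, to j^sigma times a
    variable of law mu, with an error eps j. An error in the mean of Lipschitz tests
    survives addition of independent parts, unlike convergence in law without a rate. *)
Definition urn_approx (u0 : nat * nat) (mu : probability R R) (eps : nat -> R) :=
  forall j L h, 0 <= L -> lipschitz_test L h ->
    `|urn_mean j u0 (fun u => h (x u)) - \int[mu]_y h (j%:R `^ sigma * y)| <= L * eps j.

(** The parts of the urn are replaced one at a time by their limit laws. Each replacement is
    an instance of [urn_approx], since the rest of the sum is a Lipschitz test for the part. *)
Lemma mean_tensor_smear (I : finType) (us : I -> nat * nat) (mu : I -> probability R R) eps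
    (r : seq I) (cn : I -> nat) f L t u0 :
  (forall i, urn_size (us i) = 1%N) -> (forall i, urn_approx (us i) (mu i) eps) ->
  0 <= L -> lipschitz_test L f ->
  `|mean_tensor a b c d cn us r (fun u => f (t * x u)) u0 -
    smear (fun i => t * (cn i)%:R `^ sigma) mu r f (t * x u0)| <=
  L * `|t| * \sum_(i <- r) eps (cn i).
Proof.
move=> us1 ap L0 Lf; elim: r u0 => [|i r IH] u0 /=.
  by rewrite big_nil mulr0 subrr normr0.
set A := mean_tensor a b c d cn us r _ in IH *.
set Q := smear _ mu r f in IH *.
rewrite big_cons mulrDr.
pose h y := Q (t * x u0 + t * y).
have Lh : lipschitz_test (L * `|t|) h by apply: lipschitz_test_affine; exact: smear_lipschitz_test.
have := ap i (cn i) _ h (mulr_ge0 L0 (normr_ge0 t)) Lh.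
have -> : \int[mu i]_y h ((cn i)%:R `^ sigma * y) = \int[mu i]_y Q (t * x u0 + t * (cn i)%:R `^ sigma * y).
  by apply: eq_expect => y; rewrite /h mulrA.
set Z := \int[_]_y _ => H.
have E : urn_mean (cn i) (us i) (fun u => h (x u)) = urn_mean (cn i) (us i) (fun u => Q (t * x (urn_add u0 u))).
  by apply: eq_urn_mean => u; rewrite /h u2D// mulrDr.
rewrite {}E in H.
apply: (le_trans (ler_distD (urn_mean (cn i) (us i) (fun u => Q (t * x (urn_add u0 u)))) _ _)).
rewrite addrC; apply: lerD => //.
rewrite -urn_meanB; apply: (le_trans (norm_urn_mean _ _ _ _ _ _ _)).
rewrite -[leRHS](@urn_mean_cst R a b c d S hS1 hS2 (cn i) (us i)) ?us1//.
by apply: le_urn_mean => u; exact: IH.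
Qed.

Definition unit_ball (red : bool) : nat * nat := if red then (1, 0)%N else (0, 1)%N.

Lemma u2_0 : x (0, 0)%N = 0.
Proof. by rewrite /u2 !mulr0 subrr mul0r. Qed.

Section smoothing_limit.
Variables (D : probability (S.+1.-tuple R) R).
Hypothesis dD : is_dirichlet (fun=> S%:R^-1) D.
Hypothesis dp : dirichlet_powers D S%:R^-1.
Variables (sel : 'I_S.+1 -> bool) (mu nu : probability R R) (eps : nat -> R) (M : R).
Hypothesis im : forall red : bool, (if red then mu else nu).-integrable setT (EFin \o (@id R)).
Hypothesis iM : forall red : bool, \int[if red then mu else nu]_y `|y| <= M.
Hypothesis ap : forall red : bool, urn_approx (unit_ball red) (if red then mu else nu) eps.
Hypothesis eps_small : forall e, 0 < e -> exists n0, forall n j,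
  (n0 <= n)%N -> (j <= n)%N -> eps j <= e * n%:R `^ sigma.

Local Notation us := (fun k => unit_ball (sel k)).
Local Notation mus := (pick_law sel mu nu).
Local Notation w := (@simplex_coord R S).
Local Notation coord_smear f v := (smear (fun k => w v k `^ sigma) mus (index_enum 'I_S.+1) f 0).

Lemma urn_mean_mixture n f : urn_mean n (urn_total us) f =
  \int[D]_v multinomial_sum (w v) n
    (fun cn => mean_tensor a b c d cn us (index_enum 'I_S.+1) f (0, 0)%N).
Proof.
rewrite expect_multinomial_mixture// (@urn_mean_total R a b c d S)//.
- by rewrite card_ord.
- by move=> k; rewrite /unit_ball; case: (sel k).
- by rewrite card_ord.
Qed.

(** Given the weights v, the parts are replaced by their limits, at cost eta, and the
    proportions c_k / (n+1) by v_k: by [powR_modulus] the latter costs e plus a multiple of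
    the variance of the proportions, of order 1/n. *)
Lemma multinomial_smear_dist n f L e C eta v : 0 <= L -> lipschitz_test L f -> 0 <= C -> 0 <= M ->
  (forall s z : R, 0 <= s <= 1 -> 0 <= z <= 1 -> `|s `^ sigma - z `^ sigma| <= e + C * (s - z) ^+ 2) ->
  (forall j, (j <= n.+1)%N -> eps j <= eta * n.+1%:R `^ sigma) ->
  `|multinomial_sum (w v) n (fun cn => mean_tensor a b c d cn us (index_enum 'I_S.+1)
       (fun u => f ((n.+1%:R `^ sigma)^-1 * x u)) (0, 0)%N) - coord_smear f v| <=
  L * (S.+1%:R * (eta + M * (e + C * (2 / n.+1%:R)))).
Proof.
move=> L0 Lf C0 M0 mod_ epsn.
have N0 : 0 < n.+1%:R :> R by rewrite ltr0n.
set t := (n.+1%:R `^ sigma)^-1.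
have t0 : 0 < t by rewrite invr_gt0 powR_gt0.
have w1 := simplex_coord_sum v; have w0 := @simplex_coord_ge0 R S v.
set Q := smear _ _ _ f 0.
rewrite -(multinomial_sum_cst n Q w1) -[X in _ - X]mul1r -mulN1r mulrA mulr1 -multinomial_sumZ -multinomial_sumD.
apply: (le_trans (norm_multinomial_sum _ _ w0)).
pose q k (cn : 'I_S.+1 -> nat) : R := ((cn k)%:R - n%:R * w v k) ^+ 2.
pose Z cn := L * (S.+1%:R * (eta + M * e)) + L * M * C / n.+1%:R ^+ 2 * \sum_k (2 * q k cn + 2).
apply: (@le_trans _ _ (multinomial_sum (w v) n Z)).
  apply: le_multinomial_sum => // cn cnn.
  have ck k : (cn k <= n)%N by rewrite -cnn (bigD1 k)//= leq_addr.
  have us1 k : urn_size (unit_ball (sel k)) = 1%N by rewrite /unit_ball; case: (sel k).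
  have apk k : urn_approx (unit_ball (sel k)) (mus k) eps by exact: ap (sel k).
  have := mean_tensor_smear (index_enum 'I_S.+1) cn t (0, 0)%N us1 apk L0 Lf.
  rewrite u2_0 mulr0 (gtr0_norm t0) => H1.
  have S1 : L * t * \sum_i eps (cn i) <= L * (S.+1%:R * eta).
    rewrite -mulrA; apply: ler_wpM2l => //.
    have -> : S.+1%:R * eta = t * \sum_(i < S.+1) (eta * n.+1%:R `^ sigma).
      rewrite sumr_const card_ord -mulr_natl /t; field.
      by rewrite gt_eqF// powR_gt0.
    apply: ler_wpM2l; first exact: ltW.
    by apply: ler_sum => k _; apply: epsn; apply: (leq_trans (ck k)).
  have imk k : (mus k).-integrable setT (EFin \o (@id R)) by exact: im (sel k).
  have iMk k : \int[mus k]_y `|y| <= M by exact: iM (sel k).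
  have H2 := smear_shift_dist (fun k => t * (cn k)%:R `^ sigma) (fun k => w v k `^ sigma)
    (index_enum 'I_S.+1) 0 0 L0 Lf imk iMk.
  have S2 : \sum_k `|t * (cn k)%:R `^ sigma - w v k `^ sigma| <=
      S.+1%:R * e + C / n.+1%:R ^+ 2 * \sum_k (2 * q k cn + 2).
    have -> : S.+1%:R * e = \sum_(k < S.+1) e by rewrite sumr_const card_ord mulr_natl.
    rewrite mulr_sumr -big_split/=; apply: ler_sum => k _.
    have -> : t * (cn k)%:R `^ sigma = ((cn k)%:R / n.+1%:R) `^ sigma.
      rewrite powRM ?invr_ge0// mulrC; congr (_ * _).
      by rewrite /t -powRN -[in RHS]powR_inv1 ?(ltW N0)// -powRrM mulN1r.
    have ck1 : 0 <= ((cn k)%:R / n.+1%:R : R) <= 1.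
      by rewrite divr_ge0//= ler_pdivrMr// mul1r ler_nat (leq_trans (ck k)).
    have wk1 : 0 <= w v k <= 1 by rewrite w0 simplex_coord_le1.
    apply: (le_trans (mod_ _ _ ck1 wk1)); rewrite lerD2l -mulrA; apply: ler_wpM2l => //.
    have -> : ((cn k)%:R / n.+1%:R - w v k) ^+ 2 = n.+1%:R ^- 2 * (((cn k)%:R - n%:R * w v k) - w v k) ^+ 2.
      by rewrite -natr1; field; rewrite natr1 gt_eqF.
    apply: ler_wpM2l; first by rewrite invr_ge0 sqr_ge0.
    rewrite /q; set p := (cn k)%:R - _.
    move: wk1 => /andP[wk0 wk1].
    have := sqr_ge0 (p + w v k); have : w v k ^+ 2 <= 1 by rewrite exprn_ile1.
    by rewrite !expr2; lra.
  rewrite mulN1r; apply: (le_trans (ler_distD (smear (fun i => t * (cn i)%:R `^ sigma) mus (index_enum 'I_S.+1) f 0) _ _)).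
  apply: (le_trans (lerD (le_trans H1 S1) H2)).
  rewrite subrr normr0 add0r -mulrDr.
  have := ler_wpM2l L0 (ler_wpM2l M0 S2).
  set s1 := \sum_k `|_|; set s2 := \sum_k _ => h.
  rewrite /Z -/s2 mulrDr; apply: (le_trans (lerD (lexx _) h)).
  by rewrite le_eqVlt; apply/orP; left; apply/eqP; ring.
rewrite /Z multinomial_sumD multinomial_sum_cst// multinomial_sumZ.
rewrite (multinomial_sum_sum (w v) n (index_enum 'I_S.+1) (fun k cn => 2 * q k cn + 2)).
have V k : multinomial_sum (w v) n (fun cn => 2 * q k cn + 2) <= 2 * n.+1%:R.
  rewrite multinomial_sumD multinomial_sumZ multinomial_sum_cst//.
  by have := multinomial_variance n k w0 w1; rewrite -natr1 -/(q k); lra.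
have V' : \sum_k multinomial_sum (w v) n (fun cn => 2 * q k cn + 2) <= S.+1%:R * (2 * n.+1%:R).
  apply: (@le_trans _ _ (\sum_(k < S.+1) (2 * n.+1%:R : R))); first by apply: ler_sum.
  by rewrite sumr_const card_ord [leRHS]mulr_natl.
have K0 : 0 <= L * M * C / n.+1%:R ^+ 2 by rewrite divr_ge0 ?mulr_ge0.
apply: (le_trans (lerD (lexx _) (ler_wpM2l K0 V'))).
by rewrite le_eqVlt; apply/orP; left; apply/eqP; field; rewrite gt_eqF.
Qed.

Lemma bounded_measurable_coord_smear f : bounded_measurable f ->
  bounded_measurable (fun v : S.+1.-tuple R => coord_smear f v).
Proof.
move=> bf.
have ms k : measurable_fun [set: S.+1.-tuple R] (fun v => w v k `^ sigma).
  by apply: (measurableT_comp (measurable_powR _)); exact: measurable_simplex_coord.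
have H := @bounded_measurable_smear _ _ _ _ (fun k (v : S.+1.-tuple R) => w v k `^ sigma) mus (index_enum 'I_S.+1) f ms bf.
have mk : measurable_fun [set: S.+1.-tuple R] (fun v : S.+1.-tuple R => (v, 0 : R)) by apply: measurable_fun_pair.
exact: (bounded_measurable_comp mk H).
Qed.

(** By hypothesis the first draw splits the urn into S + 1 single balls. At time n + 1 the
    left side is within L eps / n^sigma of the limit law, the right side is the Dirichlet
    mixture controlled by [multinomial_smear_dist], and n is arbitrary. *)
Lemma urn_smoothing u0 (la : probability R R) L f : 0 <= L -> lipschitz_test L f ->
  (forall n (g : nat * nat -> R), urn_mean n.+1 u0 g = urn_mean n (urn_total us) g) ->
  urn_approx u0 la eps ->
  \int[la]_y f y = \int[D]_v smear (fun k => tnth v k `^ sigma) mus (index_enum 'I_S.+1) f 0.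
Proof.
move=> L0 Lf first apu; have [bf _] := Lf.
have bQ := bounded_measurable_coord_smear bf.
have -> : \int[D]_v smear (fun k => tnth v k `^ sigma) mus (index_enum 'I_S.+1) f 0 = \int[D]_v coord_smear f v.
  have [mQ _] := bQ; have [mQ' _] := bounded_measurable_smear_power sigma mus 0 bf.
  apply: (expect_eq_simplex dD) => // v vs.
  congr (smear _ _ _ _ _); apply/funext => k.
  by rewrite /simplex_coord vs.
have M0 : 0 <= M by apply: le_trans (iM true); apply: Rintegral_ge0.
pose K := L + L * (S.+1%:R * (1 + M + M)).
have K0 : 0 <= K by rewrite addr_ge0 ?mulr_ge0 ?addr_ge0.
suff key e : 0 < e -> `|\int[la]_y f y - \int[D]_v coord_smear f v| <= K * e.
  apply/eqP; rewrite -subr_eq0 -normr_le0.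
  apply/ler_addgt0Pr => e e0; rewrite add0r.
  have := key (e / (K + 1)) (divr_gt0 e0 (ltr_wpDl K0 ltr01)).
  move=> /le_trans; apply; rewrite mulrA ler_pdivrMr ?ltr_wpDl//.
  by rewrite mulrC ler_wpM2l ?ltW// ltrDl.
move=> e0.
have [C C0 modC] := powR_modulus sg e0.
have [n0 Hn0] := eps_small e0.
(* large enough for eps_small and for the variance term C (2 / (n+1)) <= e *)
pose n := (n0 + Num.trunc (2 * C / e))%N.
have N0 : 0 < n.+1%:R :> R by rewrite ltr0n.
have Cn : C * (2 / n.+1%:R) <= e.
  rewrite mulrA ler_pdivrMr// [e * _]mulrC -ler_pdivrMr// [C * 2]mulrC.
  have h : 2 * C / e < (Num.trunc (2 * C / e)).+1%:R by rewrite truncnS_gt.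
  apply: ltW; apply: (lt_le_trans h); rewrite ler_nat ltnS /n leq_addl//.
have epsn j : (j <= n.+1)%N -> eps j <= e * n.+1%:R `^ sigma.
  by apply: Hn0; rewrite /n -addnS leq_addr.
pose t := (n.+1%:R `^ sigma)^-1.
have p0 : 0 < n.+1%:R `^ sigma by rewrite powR_gt0.
have t0 : 0 < t by rewrite invr_gt0.
have Lt : lipschitz_test (L * `|t|) (fun y => f (t * y)).
  by have := lipschitz_test_affine 0 t Lf; rewrite (_ : (fun y => f (0 + _)) = (fun y => f (t * y)))//; apply/funext => y; rewrite add0r.
have := apu n.+1 _ _ (mulr_ge0 L0 (normr_ge0 t)) Lt.
rewrite first urn_mean_mixture (gtr0_norm t0).
have -> : \int[la]_y f (t * (n.+1%:R `^ sigma * y)) = \int[la]_y f y.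
  by apply: eq_expect => y; rewrite mulrA mulVf ?mul1r// gt_eqF.
set J := \int[D]_v multinomial_sum _ _ _ => H1.
have {}H1 : `|J - \int[la]_y f y| <= L * e.
  apply: (le_trans H1); rewrite -mulrA ler_wpM2l// mulrC ler_pdivrMr//.
  exact: epsn.
have bJ : bounded_measurable (fun v => multinomial_sum (w v) n
    (fun cn => mean_tensor a b c d cn us (index_enum 'I_S.+1) (fun u => f (t * x u)) (0, 0)%N)).
  apply: (@bounded_measurable_multinomial _ _ _ _ _ (fun v k => w v k) (fun cn _ => _)).
    exact: bounded_measurable_simplex_coord.
  by move=> cn; exact: bounded_measurable_cst.
have H2 : `|J - \int[D]_v coord_smear f v| <= L * (S.+1%:R * (e + M * (e + C * (2 / n.+1%:R)))).
  rewrite /J -expectB; [|exact: (bounded_measurable_integrable _ bJ)|exact: (bounded_measurable_integrable _ bQ)].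
  apply: le_expect_bound; first by have [] := bounded_measurableB bJ bQ.
  by move=> v; exact: multinomial_smear_dist.
apply: (le_trans (ler_distD J _ _)).
rewrite distrC; apply: (le_trans (lerD H1 H2)).
have -> : K * e = L * e + L * (S.+1%:R * (e + M * (e + e))) by rewrite /K; ring.
by rewrite lerD2l !ler_wpM2l// lerD2l ler_wpM2l// lerD2l.
Qed.

End smoothing_limit.
End urn_limit.

(** * The urn process and its limit in mean square *)

Section urn_process.
Context {R : realType} (a b c d S : nat).
Hypotheses (hS1 : (a + b)%N = S) (hS2 : (c + d)%N = S).
Context (disp : measure_display) (T : measurableType disp) (P : probability T R).
Variables (draw : nat -> {RV P >-> bool}) (u0 : nat * nat).
Hypothesis u0_gt0 : (0 < urn_size u0)%N.
Hypothesis Hdraw : urn_draws a b c d u0 draw.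
Local Notation prefix n w := (mkseq (fun i => draw i w) n).
Local Notation after := (urn_after a b c d).
Implicit Types (F : seq bool -> R) (h : seq bool).

Lemma urn_size_after u h : urn_size (after u h) = (urn_size u + size h * S)%N.
Proof.
elim: h u => [|r h IH] u /=; first by rewrite mul0n addn0.
by rewrite IH (urn_size_step hS1 hS2) mulSn addnA.
Qed.

Lemma measurable_draw n r : measurable [set w | draw n w = r].
Proof. by apply: (@measurable_RV_set R _ _ _ _ P (draw n) [set r]). Qed.

Lemma measurable_prefix n h : measurable [set w | prefix n w = h].
Proof.
elim: n h => [|n IH] h.
  have [->|hn] := eqVneq h [::]; first by rewrite (_ : [set w | _] = setT)//; apply/seteqP; split.
  rewrite (_ : [set w | _] = set0)//; apply/seteqP; split=> w //= H.
  by move: hn; rewrite -H.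
case/lastP: h => [|h r].
  rewrite (_ : [set w | _] = set0)//; apply/seteqP; split=> w //= H.
rewrite (_ : [set w | _] = [set w | prefix n w = h] `&` [set w | draw n w = r]).
  by apply: measurableI => //; exact: measurable_draw.
apply/seteqP; split=> w /=; rewrite mkseqS; first by move=> /rcons_inj[-> ->].
by move=> [-> ->].
Qed.

Lemma prefix_sum n F w :
  F (prefix n w) = \sum_(t : n.-tuple bool) F t * \1_[set w | prefix n w = t] w.
Proof.
rewrite (bigD1 (Tuple (introT eqP (size_mkseq (fun i => draw i w) n))))//= big1 ?addr0 => [|t tn].
  by rewrite indicE mem_set// mulr1.
rewrite indicE memNset ?mulr0//= => H; move: tn; apply/negP; rewrite negbK.
by apply/eqP/val_inj; rewrite /= H.
Qed.

Lemma bounded_measurable_prefix n F : bounded_measurable (fun w => F (prefix n w)).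
Proof.
under eq_fun do rewrite prefix_sum.
apply: bounded_measurable_sum => t; apply: bounded_measurableM.
  exact: bounded_measurable_cst.
exact/bounded_measurable_indic/measurable_prefix.
Qed.

Lemma expect_prefix n F : \int[P]_w F (prefix n w) =
  \sum_(t : n.-tuple bool) F t * fine (P [set w | prefix n w = t]).
Proof.
under eq_Rintegral do rewrite prefix_sum.
have bi (t : n.-tuple bool) := bounded_measurable_indic R (measurable_prefix n t).
rewrite expect_sum; last first.
  by move=> t; apply: bounded_measurable_integrable; apply: bounded_measurableM => //; exact: bounded_measurable_cst.
apply: eq_bigr => t _; rewrite RintegralZl//; last exact: bounded_measurable_integrable.
by rewrite expect_indic//; exact: measurable_prefix.
Qed.

(** The rule of the draws is the conditional law of one draw given the previous ones;
    summing over all prefixes of length n integrates it. *)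
Lemma expect_prefixS n F : \int[P]_w F (prefix n.+1 w) =
  \int[P]_w path_mean a b c d 1 (after u0 (prefix n w)) (fun h' => F (prefix n w ++ h')).
Proof.
rewrite (expect_prefix n (fun h => path_mean a b c d 1 (after u0 h) (fun h' => F (h ++ h')))).
pose A (t : n.-tuple bool) := [set w | prefix n w = t].
pose A1 (t : n.-tuple bool) := [set w | prefix n w = t /\ draw n w = true].
have mA t : measurable (A t) by exact: measurable_prefix.
have mA1 t : measurable (A1 t).
  by rewrite (_ : A1 t = A t `&` [set w | draw n w = true])//; apply: measurableI => //; exact: measurable_draw.
have bA t := bounded_measurable_indic R (mA t).
have bA1 t := bounded_measurable_indic R (mA1 t).
pose G (t : n.-tuple bool) w := F (rcons t true) * \1_(A1 t) w + F (rcons t false) * (\1_(A t) w - \1_(A1 t) w).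
have bG t : bounded_measurable (G t).
  apply: bounded_measurableD; apply: bounded_measurableM => //; try exact: bounded_measurable_cst.
  exact: bounded_measurableB.
transitivity (\int[P]_w (\sum_(t : n.-tuple bool) G t w)).
  apply: eq_expect => w; rewrite (bigD1 (Tuple (introT eqP (size_mkseq (fun i => draw i w) n))))//= big1 ?addr0 => [|t tn].
    set t0 := Tuple _; have At : \1_(A t0) w = 1 :> R by rewrite indicE mem_set.
    rewrite /G At mkseqS; case rE: (draw n w).
      have -> : \1_(A1 t0) w = 1 :> R by rewrite indicE mem_set.
      by rewrite subrr mulr0 mulr1 addr0.
    have -> : \1_(A1 t0) w = 0 :> R by rewrite indicE memNset// => -[_]; rewrite rE.
    by rewrite subr0 mulr0 mulr1 add0r.
  have nt : prefix n w <> t.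
    by move=> H; move: tn; apply/negP; rewrite negbK; apply/eqP/val_inj; rewrite /= H.
  by rewrite /G /A /A1 !indicE !memNset/= ?subrr ?mulr0 ?addr0// => -[].
rewrite expect_sum; last by move=> t; exact: bounded_measurable_integrable.
apply: eq_bigr => t _.
have int1 := bounded_measurable_integrable P (bA1 t).
have int2 := bounded_measurable_integrable P (bounded_measurableB (bA t) (bA1 t)).
have intc k f : bounded_measurable f -> P.-integrable setT (EFin \o (fun w => k * f w)).
  by move=> bf; apply: bounded_measurable_integrable; apply: bounded_measurableM => //; exact: bounded_measurable_cst.
rewrite /G expectD; [|exact: intc|apply: intc; exact: bounded_measurableB].
rewrite !RintegralZl// expectB; [|exact: bounded_measurable_integrable..].
rewrite !expect_indic//.
have E : P (A1 t) = (P (A t) * ((after u0 t).1%:R / (urn_size (after u0 t))%:R)%:E)%E.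
  by have := Hdraw t; rewrite size_tuple.
rewrite E fineM ?fin_num_measure//= !cats1.
have s0 : (after u0 t).1%:R + (after u0 t).2%:R != 0 :> R.
  by rewrite -natrD -/(urn_size _) pnatr_eq0 -lt0n urn_size_after ltn_addr.
rewrite [(urn_size _)%:R]natrD; by field.
Qed.

(** The law of the first n draws is determined by the one-step rule. *)
Lemma expect_path n F : \int[P]_w F (prefix n w) = path_mean a b c d n u0 F.
Proof.
elim: n F => [|n IH] F; first exact: (expect_cst P (F [::])).
rewrite expect_prefixS.
rewrite (IH (fun h => path_mean a b c d 1 (after u0 h) (fun h' => F (h ++ h')))).
by rewrite -path_mean_cat addn1.
Qed.

End urn_process.

Section power_growth.
Context {R : realType}.

Lemma powR_unbounded (s K : R) : 0 < s -> exists n0, forall n, (n0 <= n)%N -> K <= n%:R `^ s.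
Proof.
move=> s0; exists (Num.trunc (`|K| `^ s^-1)).+1 => n nn.
have h : `|K| `^ s^-1 <= n%:R.
  by apply: ltW; apply: (lt_le_trans (truncnS_gt _)); rewrite ler_nat.
apply: (le_trans (ler_norm K)).
have -> : `|K| = (`|K| `^ s^-1) `^ s by rewrite -powRrM mulVf ?powRr1// gt_eqF.
by apply: ge0_ler_powR => //; rewrite ?nnegrE ?powR_ge0// ltW.
Qed.

(** An error which is o(j^sigma) is o(n^sigma) uniformly over j <= n: finitely many j are
    bounded by a constant, and the others use that j^sigma increases. *)
Lemma eventually_uniformly_small (sigma : R) (eps : nat -> R) : 0 < sigma ->
  (forall e, 0 < e -> exists j0, forall j, (j0 <= j)%N -> eps j <= e * j%:R `^ sigma) ->
  forall e, 0 < e -> exists n0, forall n j, (n0 <= n)%N -> (j <= n)%N ->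
    eps j <= e * n%:R `^ sigma.
Proof.
move=> sg0 small e e0; have [j0 Hj0] := small e e0.
(* bounds the finitely many errors before j0 *)
pose K := \sum_(j < j0) `|eps j|.
have [n0 Hn0] := powR_unbounded (K / e) sg0.
exists n0 => n j nn jn; have [jj|jj] := leqP j0 j.
  apply: (le_trans (Hj0 _ jj)); apply: ler_wpM2l; first exact: ltW.
  by apply: ge0_ler_powR; rewrite ?nnegrE ?(ltW sg0)// ler_nat.
apply: (@le_trans _ _ K).
  rewrite /K (bigD1 (Ordinal jj))//= (le_trans (ler_norm _))// lerDl.
  by apply: sumr_ge0.
by rewrite mulrC -ler_pdivrMr// Hn0.
Qed.

End power_growth.

Section limits_of_variables.
Context d (T : measurableType d) (R : realType) (P : probability T R).

Lemma in_M2_distribution (X : {RV P >-> R}) A : P.-integrable setT (EFin \o X) ->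
  P.-integrable setT (EFin \o (fun w => X w ^+ 2)) -> \int[P]_w X w = A ->
  in_M2 A (distribution P X).
Proof.
move=> i1 i2 XA; rewrite /in_M2 unlock; split.
  transitivity (\int[P]_w (X w)%:E)%E; last by rewrite -EFin_expect// XA.
  by rewrite integral_distribution.
rewrite ge0_integral_distribution//; last 2 first.
- by apply/measurable_EFinP; exact: exprn_measurable.
- by move=> y; rewrite lee_fin sqr_ge0.
rewrite (_ : (fun _ => _) = (EFin \o (fun w => X w ^+ 2))); last exact/funext.
by rewrite -EFin_expect// ltry.
Qed.

(** Fatou's lemma carries the bound on the second moment to the limit without any
    domination. *)
Lemma ae_limit_square_le (X : nat -> T -> R) (Y : T -> R) q :
  (forall n, bounded_measurable (X n)) -> measurable_fun [set: T] Y ->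
  {ae P, forall w, X n w @[n --> \oo] --> Y w} ->
  (forall n, \int[P]_w (X n w ^+ 2) <= q) -> (\int[P]_w (Y w ^+ 2)%:E <= q%:E)%E.
Proof.
move=> bX mY XY Xq.
have bX2 n : bounded_measurable (fun w => X n w ^+ 2) by under eq_fun do rewrite expr2; exact: bounded_measurableM.
pose f n w := (X n w ^+ 2)%:E.
have mf n : measurable_fun [set: T] (f n) by apply/measurable_EFinP; have [] := bX2 n.
have f0 n w : setT w -> (0 <= f n w)%E by rewrite lee_fin sqr_ge0.
have H := fatou P measurableT mf f0.
have -> : (\int[P]_w (Y w ^+ 2)%:E = \int[P]_w limn_einf (f^~ w))%E.
  apply: ge0_ae_eq_integral => //.
  - by apply/measurable_EFinP; exact: measurable_funX.
  - have E : (fun w => limn_einf (f^~ w)) = (fun w => - limn_esup (-%E \o f^~ w))%E.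
      by apply/funext => w; rewrite limn_esupN oppeK.
    rewrite E; apply: measurableT_comp => //.
    apply: (@measurable_fun_limn_esup _ _ _ setT (fun n w => - f n w)%E) => n.
    exact: measurableT_comp.
  - by move=> w _; rewrite lee_fin sqr_ge0.
  - move=> w _; rewrite limn_einf_lim.
    apply: lime_ge; first exact: is_cvg_einfs.
    by apply: nearW => n; apply: le_ereal_inf_tmp => _ [k /= _ <-]; exact: f0.
  case: XY => N [mN N0 sN]; exists N; split=> // w /= h; apply: sN => /= cw; apply: h => _.
  have : f n w @[n --> \oo] --> (Y w ^+ 2)%:E.
    by apply: cvg_EFin; [exact: nearW|exact: cvgM].
  by move=> /cvg_limn_einf_sup[-> _].
apply: (le_trans H); rewrite limn_einf_lim.
apply: lime_le; first exact: is_cvg_einfs.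
apply: nearW => n; apply: (@le_trans _ _ (\int[P]_w f n w)%E).
  by apply: ereal_inf_lbound; exists n => /=.
by rewrite /f -EFin_expect ?lee_fin//; exact: bounded_measurable_integrable.
Qed.

(** The sum of the increments has finite expectation, so the telescoping series converges
    absolutely almost surely. Multiplying by the indicator of a measurable set of full
    measure makes the limit exist everywhere, hence measurable. *)
Lemma summable_ae_cvg (X : nat -> T -> R) : (forall n, bounded_measurable (X n)) ->
  (forall n, \int[P]_w `|X n.+1 w - X n w| <= 1 / (2 ^ n.+1)%:R) ->
  exists2 W : T -> R, measurable_fun [set: T] W &
    {ae P, forall w, X n w @[n --> \oo] --> W w}.
Proof.
move=> bX smallX.
have bD n := bounded_measurable_norm (bounded_measurableB (bX n.+1) (bX n)).
pose f n w := (`|X n.+1 w - X n w|)%:E.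
have mf n : measurable_fun [set: T] (f n) by apply/measurable_EFinP; have [] := bD n.
have f0 n w : [set: T] w -> (0 <= f n w)%E by rewrite lee_fin.
have intF : P.-integrable setT (fun w => \sum_(n <oo) f n w)%E.
  apply/integrableP; split; first by apply: ge0_emeasurable_sum => [k w _ _|k _]; [exact: f0|exact: mf].
  rewrite (_ : (\int[P]_w _ = \int[P]_w (\sum_(n <oo) f n w))%E); last first.
    by apply: eq_integral => w _; rewrite gee0_abs//; apply: nneseries_ge0 => n _ _; exact: f0.
  rewrite integral_nneseries//.
  apply: (@le_lt_trans _ _ (1 : R)%:E); last exact: ltry.
  apply: le_trans (epsilon_trick0 xpredT (@ler01 R)).
  apply: lee_nneseries => [n _ _|n _]; first by apply: integral_ge0 => w _; exact: f0.
  by rewrite /f -EFin_expect ?lee_fin//; exact: bounded_measurable_integrable.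
have [N [mN N0 sN]] := integrable_ae measurableT intF.
have cX w : ~ N w -> cvgn (X^~ w).
  move=> Nw.
  have : (\sum_(n <oo) f n w)%E \is a fin_num.
    apply: contrapT => H; apply: Nw; apply: sN => /= /(_ I); exact: H.
  move=> fin.
  have : cvgn [normed series (telescope (X^~ w))].
    apply: nondecreasing_is_cvgn.
      by apply: nondecreasing_series => n _ _; exact: normr_ge0.
    exists (fine (\sum_(n <oo) f n w)%E) => _ [k _ <-].
    rewrite -lee_fin fineK//.
    apply: le_trans (nneseries_lim_ge (P := xpredT) k (fun n _ _ => f0 n w I)).
    by rewrite /= sumEFin lee_fin.
  move=> /normed_cvg; rewrite telescopeK => h.
  have -> : X^~ w = (fun n => (X n w - X 0%N w) + X 0%N w) by apply/funext => n; rewrite subrK.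
  by apply: is_cvgD => //; exact: is_cvg_cst.
pose W w := lim (X n w * \1_(~` N) w @[n --> \oo]).
have cW w : X n w * \1_(~` N) w @[n --> \oo] --> W w.
  have [Nw|Nw] := pselect (N w).
    have E : (fun n => X n w * \1_(~` N) w) = cst 0.
      by apply/funext => n; rewrite indicE memNset ?mulr0//; exact.
    by rewrite /W E; exact: is_cvg_cst.
  apply: is_cvgM; last exact: is_cvg_cst.
  exact: cX.
exists W.
  apply: (measurable_fun_cvg (h := fun n w => X n w * \1_(~` N) w)) => // n.
  apply: measurable_funM; first by have [] := bX n.
  by apply: measurable_indic; exact: measurableC.
exists N; split=> // w /= h; apply: contrapT => Nw; apply: h.
have E : (fun n => X n w * \1_(~` N) w) = X^~ w.
  by apply/funext => n; rewrite indicE mem_set// mulr1.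
by have := cW w; rewrite E.
Qed.

End limits_of_variables.

Section urn_normalised.
Context {R : realType} (a b c d S : nat).
Hypotheses (hS1 : (a + b)%N = S) (hS2 : (c + d)%N = S).
Hypothesis S0 : (0 < S)%N.
Let m : R := a%:R - c%:R.
Hypotheses (m0 : 0 < m) (mS : m < S%:R) (large : S%:R < 2 * m).
Let sigma := m / S%:R.
Local Notation x := (u2 R b c S).
Local Notation growth n := (@urn_growth R a c S n 1).

Let Sr0 : 0 < S%:R :> R. Proof. by rewrite ltr0n. Qed.
Let sg0 : 0 < sigma. Proof. exact: divr_gt0. Qed.

Lemma urn_growth_gt0 n s : 0 < @urn_growth R a c S n s.
Proof. by apply: prodr_gt0 => i _; rewrite ltr_wpDr// divr_ge0// ltW. Qed.

Lemma urn_growth_cat k j s :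
  @urn_growth R a c S (k + j) s = urn_growth a c S k s * urn_growth a c S j (s + k * S).
Proof.
elim: k s => [|k IH] s; first by rewrite /urn_growth big_ord0 mul1r mul0n addn0.
by rewrite addSn !urn_growthS IH mulrA mulSn addnA.
Qed.

(** The limit of urn_growth n 1 / n^sigma. *)
Definition growth_limit : R := Gamma S%:R^-1 / Gamma (S%:R^-1 + sigma).

Lemma urn_growth_cvg : growth n / n%:R `^ sigma @[n --> \oo] --> growth_limit.
Proof.
have p0 : 0 < S%:R^-1 :> R by rewrite invr_gt0.
have s01 : 0 < sigma < 1 by rewrite sg0/= ltr_pdivrMr// mul1r.
have := prod_ratio_cvg p0 s01; rewrite -/growth_limit.
rewrite (_ : (fun n => _) = (fun n => growth n / n%:R `^ sigma))//.
apply/funext => n; congr (_ / _); apply: eq_bigr => i _.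
have h : (S%:R : R)^-1 + i%:R != 0 by rewrite gt_eqF// ltr_wpDr.
have h1 : 1 + i%:R * S%:R != 0 :> R by rewrite gt_eqF// ltr_wpDr// mulr_ge0.
rewrite natrD natrM /sigma -/m; field.
by rewrite h1 gt_eqF.
Qed.

Lemma growth_limit_gt0 : 0 < growth_limit.
Proof. by rewrite divr_gt0// Gamma_gt0// ?addr_gt0// invr_gt0. Qed.

(** The constant B for which the hypothesis hB of the variance estimate is an equality. *)
Definition variance_bound : R := ((b%:R + c%:R) * sigma) ^+ 2 / (2 * m - S%:R).

Lemma variance_bound_ge0 : 0 <= variance_bound.
Proof. by rewrite divr_ge0 ?sqr_ge0// subr_ge0 ltW. Qed.
Local Notation B := variance_bound.

(** A bound on E|W| for the limit W of the normalised urn, the same for both initial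
    colours. *)
Definition mean_bound : R := Num.sqrt (2 * (B + (b%:R + c%:R) ^+ 2)).

(** The first term bounds the distance in L^1 between u2 at time j and urn_growth j 1 times
    the limit of the normalised urn, the second the replacement of urn_growth j 1 by its
    equivalent. *)
Definition urn_error (j : nat) : R :=
  Num.sqrt (B * (1 + j%:R * S%:R)) + `|growth j - growth_limit * j%:R `^ sigma| * mean_bound.

Lemma mean_bound_ge0 : 0 <= mean_bound.
Proof. exact: sqrtr_ge0. Qed.

(** The first term of the error is of order j^(1/2), which is o(j^sigma) because sigma >
    1/2; the second is o(j^sigma) by [urn_growth_cvg]. *)
Lemma urn_error_small e : 0 < e -> exists n0, forall n j,
  (n0 <= n)%N -> (j <= n)%N -> urn_error j <= e * n%:R `^ sigma.
Proof.
apply: (eventually_uniformly_small sg0) => {}e e0.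
have e2 : 0 < e / 2 by rewrite divr_gt0.
have M1 : 0 < mean_bound + 1 by rewrite ltr_wpDl// mean_bound_ge0.
have := urn_growth_cvg => /cvgrPdist_le/(_ (e / 2 / (mean_bound + 1)) (divr_gt0 e2 M1)).
case=> n1 _ Hn1.
have t0 : 0 < 2 * sigma - 1.
  by rewrite subr_gt0 /sigma mulrA ltr_pdivlMr// mul1r.
have [n2 Hn2] := powR_unbounded (B * (1 + S%:R) / (e / 2) ^+ 2) t0.
exists (maxn 1 (maxn n1 n2)) => j; rewrite !geq_max => /andP[j0 /andP[j1 j2]].
have jr0 : 0 < j%:R :> R by rewrite ltr0n.
have jp0 : 0 < j%:R `^ sigma by exact: powR_gt0.
rewrite /urn_error [e]splitr mulrDl; apply: lerD.
  have -> : e / 2 * j%:R `^ sigma = Num.sqrt ((e / 2 * j%:R `^ sigma) ^+ 2).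
    by rewrite sqrtr_sqr ger0_norm// mulr_ge0 ?(ltW e2)// powR_ge0.
  rewrite ler_wsqrtr//.
  apply: (@le_trans _ _ (B * (1 + S%:R) * j%:R)).
    rewrite -mulrA; apply: ler_wpM2l; first exact: variance_bound_ge0.
    by rewrite mulrDl mul1r [S%:R * _]mulrC lerD2r ler1n.
  rewrite exprMn.
  have -> : (j%:R `^ sigma) ^+ 2 = j%:R `^ (2 * sigma - 1) * j%:R.
    rewrite -powR_mulrn ?powR_ge0// -powRrM.
    rewrite -[X in _ = _ * X](powRr1 (ltW jr0)) -powRD; last by apply/implyP => _; rewrite gt_eqF.
    by congr (_ `^ _); ring.
  rewrite mulrA ler_pM2r// [leRHS]mulrC -ler_pdivrMr ?exprn_gt0//.
  exact: Hn2.
have h := Hn1 j j1; rewrite /= in h.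
have -> : growth j - growth_limit * j%:R `^ sigma = - (growth_limit - growth j / j%:R `^ sigma) * j%:R `^ sigma.
  move: growth_limit => k; field.
  by rewrite gt_eqF.
rewrite normrM normrN [`|_ `^ _|]gtr0_norm// mulrAC ler_pM2r//.
apply: (le_trans (ler_wpM2r mean_bound_ge0 h)).
by rewrite mulrAC ler_pdivrMr// ler_pM2l// lerDl.
Qed.

Lemma urn_fluctuation_small e : 0 < e -> exists n0, forall n, (n0 <= n)%N ->
  Num.sqrt (B * (1 + n%:R * S%:R)) <= e * growth n.
Proof.
move=> e0; have kap0 := growth_limit_gt0.
have k2 : 0 < growth_limit / 2 by rewrite divr_gt0.
have ek : 0 < e * (growth_limit / 2) by rewrite mulr_gt0.
have [n1 Hn1] := urn_error_small ek.
have := urn_growth_cvg => /cvgrPdist_le/(_ _ k2)[n2 _ Hn2].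
exists (maxn 1 (maxn n1 n2)) => n; rewrite !geq_max => /andP[nn0 /andP[nn1 nn2]].
have np0 : 0 < n%:R `^ sigma by rewrite powR_gt0// ltr0n.
apply: (@le_trans _ _ (urn_error n)).
  by rewrite lerDl mulr_ge0// sqrtr_ge0.
apply: (le_trans (Hn1 n n nn1 (leqnn n))).
rewrite -mulrA; apply: ler_wpM2l; first exact: ltW.
have := Hn2 n nn2; rewrite /= ler_norml => /andP[_ h].
have {}h : growth_limit / 2 <= growth n / n%:R `^ sigma.
  move: h; set y := growth n / _; move: y (growth_limit) => y k; lra.
by rewrite -ler_pdivlMr.
Qed.

End urn_normalised.

Section urn_limit_law.
Context {R : realType} (a b c d S : nat).
Hypotheses (hS1 : (a + b)%N = S) (hS2 : (c + d)%N = S).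
Hypothesis S0 : (0 < S)%N.
Let m : R := a%:R - c%:R.
Hypotheses (m0 : 0 < m) (mS : m < S%:R) (large : S%:R < 2 * m).
Let sigma := m / S%:R.
Local Notation x := (u2 R b c S).
Local Notation growth n := (@urn_growth R a c S n 1).
Local Notation B := (variance_bound a b c S : R).
Local Notation kappa := (growth_limit a c S : R).
Local Notation M1 := (mean_bound a b c S : R).
Context (disp : measure_display) (T : measurableType disp) (P : probability T R).
Variables (draw : nat -> {RV P >-> bool}) (red : bool).
Local Notation u0 := (unit_ball red).
Hypothesis Hdraw : urn_draws a b c d u0 draw.

(** The martingale: u2 divided by the growth factor of its expectation. *)
Definition normalised_urn (n : nat) (w : T) : R :=
  x (urn_composition a b c d u0 draw n w) / growth n.

Let u01 : urn_size u0 = 1%N. Proof. by rewrite /unit_ball; case: red. Qed.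
Let u0_gt0 : (0 < urn_size u0)%N. Proof. by rewrite u01. Qed.
Let Sn0 : S%:R != 0 :> R. Proof. by rewrite pnatr_eq0 -lt0n. Qed.
Let Sr0 : 0 < S%:R :> R. Proof. by rewrite ltr0n. Qed.
Let g0 n s : 0 < @urn_growth R a c S n s. Proof. exact: urn_growth_gt0. Qed.

Lemma bounded_measurable_urn n (f : nat * nat -> R) :
  bounded_measurable (fun w => f (urn_composition a b c d u0 draw n w)).
Proof. exact: (bounded_measurable_prefix draw n (fun h => f (urn_after a b c d u0 h))). Qed.

Lemma expect_urn n (f : nat * nat -> R) :
  \int[P]_w f (urn_composition a b c d u0 draw n w) = urn_mean a b c d n u0 f.
Proof.
rewrite -path_mean_after.
exact: (expect_path hS1 hS2 u0_gt0 Hdraw n (fun h => f (urn_after a b c d u0 h))).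
Qed.

Lemma bounded_measurable_normalised n : bounded_measurable (normalised_urn n).
Proof. exact: (bounded_measurable_urn n (fun u => x u / growth n)). Qed.

Lemma expect_normalised n : \int[P]_w normalised_urn n w = x u0.
Proof.
rewrite (expect_urn n (fun u => x u / growth n)).
have := urn_mean_lin a b c d n u0 (growth n)^-1 0 x x; rewrite mul0r addr0 => E.
rewrite (eq_urn_mean _ _ _ _ _ _ (f' := fun v => (growth n)^-1 * x v + 0 * x v)).
  by rewrite E (urn_mean_u2 hS1 hS2 S0 n u0_gt0) u01 mulKf// gt_eqF.
by move=> v; rewrite mul0r addr0 mulrC.
Qed.

Lemma variance_bound_eq : ((b%:R + c%:R) * (m / S%:R)) ^+ 2 + B * S%:R <= 2 * m * B.
Proof.
have h : 2 * m - S%:R != 0 by rewrite gt_eqF// subr_gt0.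
rewrite le_eqVlt; apply/orP; left; apply/eqP; rewrite /variance_bound -/m.
by field; rewrite h Sn0.
Qed.

(** Given the first k draws, the urn restarts from its composition; the variance bound for j
    draws from there does not depend on j after normalisation. *)
Lemma normalised_increment k j :
  \int[P]_w ((normalised_urn (k + j) w - normalised_urn k w) ^+ 2) <=
  B * (1 + k%:R * S%:R) / growth k ^+ 2.
Proof.
pose F h : R := (x (urn_after a b c d u0 h) / growth (k + j) - x (urn_after a b c d u0 (take k h)) / growth k) ^+ 2.
have -> : \int[P]_w ((normalised_urn (k + j) w - normalised_urn k w) ^+ 2) = path_mean a b c d (k + j) u0 F.
  rewrite -(expect_path hS1 hS2 u0_gt0 Hdraw); apply: eq_expect => w.
  by rewrite /F /normalised_urn /urn_composition -map_take take_iota (minn_idPl (leq_addr _ _)).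
rewrite path_mean_cat.
set K := _ / _; rewrite -[K](path_mean_cst hS1 hS2 k K u0_gt0).
apply: le_path_mean_size => h hk.
set v := urn_after a b c d u0 h.
have vs : urn_size v = (1 + k * S)%N by rewrite /v (urn_size_after hS1 hS2) u01 hk.
pose G := @urn_growth R a c S j (1 + k * S).
have G0 : 0 < G by exact: g0.
have gk0 : 0 < growth k by exact: g0.
have gE : growth (k + j) = growth k * G by rewrite urn_growth_cat.
pose f u : R := (growth k * G) ^- 2 * (x u - G * x v) ^+ 2.
have -> : path_mean a b c d j v (fun h' => F (h ++ h')) = urn_mean a b c d j v f.
  rewrite -path_mean_after; apply: eq_path_mean => h'.
  rewrite /F /f take_size_cat// -/v /urn_after foldl_cat -/(urn_after _ _ _ _ _ _) -/v gE.
  move: (x (foldl _ _ _)) (x v) => y z; field.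
  by rewrite !gt_eqF.
have -> : urn_mean a b c d j v f = (growth k * G) ^- 2 * urn_mean a b c d j v (fun u => (x u - G * x v) ^+ 2).
  have := urn_mean_lin a b c d j v ((growth k * G) ^- 2) 0 (fun u => (x u - G * x v) ^+ 2) (fun=> 0).
  rewrite [0 * urn_mean _ _ _ _ _ _ _]mul0r addr0 => <-; apply: eq_urn_mean => u.
  by rewrite mul0r addr0.
have B0 : 0 <= B by exact: variance_bound_ge0.
have v0 : (0 < urn_size v)%N by rewrite vs.
have := urn_variance hS1 hS2 S0 variance_bound_eq B0 j v0; rewrite vs -/G => H.
have K0 : 0 <= (growth k * G) ^- 2 by rewrite invr_ge0 sqr_ge0.
apply: (le_trans (ler_wpM2l K0 H)).
rewrite le_eqVlt; apply/orP; left; apply/eqP; rewrite /K natrD natrM.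
by field; rewrite !gt_eqF.
Qed.

Lemma increment_dist k l : (k <= l)%N ->
  growth k * \int[P]_w `|normalised_urn l w - normalised_urn k w| <=
  Num.sqrt (B * (1 + k%:R * S%:R)).
Proof.
move=> kl; have gk0 : 0 < growth k by exact: g0.
have bY := bounded_measurableB (bounded_measurable_normalised l) (bounded_measurable_normalised k).
have [mY _] := bY.
have bY2 : bounded_measurable (fun w => (normalised_urn l w - normalised_urn k w) ^+ 2).
  by under eq_fun do rewrite expr2; exact: bounded_measurableM.
have hq : (\int[P]_w ((normalised_urn l w - normalised_urn k w) ^+ 2)%:E <=
    (B * (1 + k%:R * S%:R) / growth k ^+ 2)%:E)%E.
  rewrite -EFin_expect ?lee_fin; last exact: bounded_measurable_integrable.
  by have := normalised_increment k (l - k); rewrite subnKC.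
have [_ _ h] := square_integrable mY hq.
rewrite mulrC -ler_pdivlMr//; apply: (le_trans h).
have B0 : 0 <= B by exact: variance_bound_ge0.
rewrite sqrtrM; last by rewrite mulr_ge0// addr_ge0// mulr_ge0.
by rewrite sqrtrV ?sqr_ge0// sqrtr_sqr gtr0_norm.
Qed.

(** Along a subsequence phi for which the increments are bounded in L^1 by 2^-n, almost sure
    convergence needs no martingale theory. *)
Lemma normalised_urn_ae_cvg : exists (W : T -> R) (phi : nat -> nat),
  [/\ measurable_fun [set: T] W, forall n, (n <= phi n)%N &
    {ae P, forall w, normalised_urn (phi n) w @[n --> \oo] --> W w}].
Proof.
have e0 n : 0 < 1 / (2 ^ n.+1)%:R :> R by rewrite divr_gt0// ltr0n expn_gt0.
have /choice[psi Hpsi] n : exists k, (n <= k)%N /\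
    Num.sqrt (B * (1 + k%:R * S%:R)) <= 1 / (2 ^ n.+1)%:R * growth k.
  have [n0 Hn0] := urn_fluctuation_small b S0 m0 mS large (e0 n).
  by exists (maxn n n0); rewrite leq_maxl; split=> //; apply: Hn0; rewrite leq_maxr.
pose bound n k := Num.sqrt (B * (1 + k%:R * S%:R)) <= 1 / (2 ^ n.+1)%:R * growth k.
have small n k l : bound n k -> (k <= l)%N ->
    \int[P]_w `|normalised_urn l w - normalised_urn k w| <= 1 / (2 ^ n.+1)%:R.
  move=> bk kl; have gk0 : 0 < growth k by exact: g0.
  rewrite -(ler_pM2l gk0) [leRHS]mulrC; apply: (le_trans (increment_dist kl)); exact: bk.
pose X n := normalised_urn (psi n).
have bX n : bounded_measurable (X n) by exact: bounded_measurable_normalised.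
have [W mW cW] : exists2 W : T -> R, measurable_fun [set: T] W &
    {ae P, forall w, X n w @[n --> \oo] --> W w}.
  apply: summable_ae_cvg => // n.
  have [_ b1] := Hpsi n; have [_ b2] := Hpsi n.+1.
  have [le|/ltnW le] := leqP (psi n) (psi n.+1); first exact: small.
  under eq_Rintegral do rewrite distrC.
  apply: (le_trans (small _ _ _ b2 le)).
  rewrite ler_pM2l// lef_pV2 ?posrE ?ltr0n ?expn_gt0// ler_nat.
  by rewrite leq_exp2l.
by exists W, psi; split=> // n; have [] := Hpsi n.
Qed.

Section almost_sure_limit.
Variables (X : {RV P >-> R}) (phi : nat -> nat).
Definition rescaled_limit (w : T) : R := X w / kappa.
Local Notation W := rescaled_limit.
Hypothesis phi_ge : forall n, (n <= phi n)%N.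
Hypothesis limW : {ae P, forall w, normalised_urn (phi n) w @[n --> \oo] --> W w}.

Let kap0 : 0 < kappa. Proof. exact: growth_limit_gt0. Qed.

Let mW : measurable_fun [set: T] W.
Proof. by apply: measurable_funM => //; exact: measurable_funPT. Qed.

Let XE w : X w = kappa * W w.
Proof. by rewrite /rescaled_limit mulrC divfK// gt_eqF. Qed.

Let mM k : measurable_fun [set: T] (normalised_urn k).
Proof. by have [] := bounded_measurable_normalised k. Qed.

(** The bound on the increments between times k and phi n passes to the limit in n. *)
Lemma limit_square_dist k :
  (\int[P]_w ((W w - normalised_urn k w) ^+ 2)%:E <= (B * (1 + k%:R * S%:R) / growth k ^+ 2)%:E)%E.
Proof.
apply: (@ae_limit_square_le _ _ _ _ (fun n w => normalised_urn (phi (n + k)) w - normalised_urn k w)).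
- by move=> n; apply: bounded_measurableB; exact: bounded_measurable_normalised.
- exact: measurable_funB.
- case: limW => N [mN N0 sN]; exists N; split=> // w /= h; apply: sN => /= cw; apply: h.
  apply: cvgB; last exact: cvg_cst.
  by have := cw; rewrite -(cvg_shiftn k).
- move=> n; have kp : (k <= phi (n + k))%N by exact: leq_trans (leq_addl _ _) (phi_ge _).
  by have := normalised_increment k (phi (n + k) - k); rewrite subnKC.
Qed.

Lemma limit_dist k : [/\ P.-integrable setT (EFin \o (fun w => W w - normalised_urn k w)) &
  growth k * \int[P]_w `|W w - normalised_urn k w| <= Num.sqrt (B * (1 + k%:R * S%:R))].
Proof.
have gk0 : 0 < growth k by exact: g0.
have mY : measurable_fun [set: T] (fun w => W w - normalised_urn k w) by exact: measurable_funB.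
have [_ i1 h] := square_integrable mY (limit_square_dist k).
split=> //; rewrite mulrC -ler_pdivlMr//; apply: (le_trans h).
have B0 : 0 <= B by exact: variance_bound_ge0.
rewrite sqrtrM; last by rewrite mulr_ge0// addr_ge0// mulr_ge0.
by rewrite sqrtrV ?sqr_ge0// sqrtr_sqr gtr0_norm.
Qed.

Lemma limit_square : (\int[P]_w (W w ^+ 2)%:E <= (2 * (B + (b%:R + c%:R) ^+ 2))%:E)%E.
Proof.
have mY : measurable_fun [set: T] (fun w => W w - normalised_urn 0 w) by exact: measurable_funB.
have [i2 _ _] := square_integrable mY (limit_square_dist 0).
have E0 w : normalised_urn 0 w = x u0.
  by rewrite /normalised_urn /urn_growth big_ord0 divr1.
have x2 : x u0 ^+ 2 <= (b%:R + c%:R) ^+ 2.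
  have S1 : 1 <= S%:R :> R by rewrite ler1n.
  have q0 : 0 <= b%:R + c%:R :> R by rewrite addr_ge0.
  rewrite -[leLHS]real_normK ?num_real// lerXn2r ?nnegrE//.
  rewrite /u2 normrM [`|_^-1|]gtr0_norm ?invr_gt0// ler_pdivrMr//.
  apply: (@le_trans _ _ (b%:R + c%:R)); last by rewrite ler_peMr.
  by rewrite /unit_ball; case: red; rewrite !mulr0 mulr1 ?subr0 ?sub0r ?normrN normr_nat ?lerDl ?lerDr.
have ib : P.-integrable setT (EFin \o (fun w => 2 * (W w - normalised_urn 0 w) ^+ 2)).
  exact: integrable_realZ.
have ic : P.-integrable setT (EFin \o (fun _ : T => 2 * x u0 ^+ 2)).
  exact: integrable_real_cst.
apply: (@le_trans _ _ (\int[P]_w (2 * (W w - normalised_urn 0 w) ^+ 2 + 2 * x u0 ^+ 2)%:E)%E).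
  apply: ge0_le_integral => //.
  - by move=> w _; rewrite lee_fin sqr_ge0.
  - by apply/measurable_EFinP; exact: measurable_funX.
  - by apply/measurable_EFinP; apply: measurable_funD => //; apply: measurable_funM => //; exact: measurable_funX.
  - move=> w _; rewrite lee_fin E0.
    by have := sqr_ge0 (W w - 2 * x u0); rewrite !expr2; lra.
rewrite -EFin_expect; last first.
  by apply: integrable_realD.
rewrite lee_fin expectD// expect_cst RintegralZl// -mulrDr ler_wpM2l// lerD//.
rewrite -lee_fin EFin_expect//; apply: (le_trans (limit_square_dist 0)).
by rewrite lee_fin mul0r addr0 mulr1 /urn_growth big_ord0 expr1n divr1.
Qed.

Lemma limit_integrable : [/\ P.-integrable setT (EFin \o (fun w => W w ^+ 2)),
  P.-integrable setT (EFin \o W) & \int[P]_w `|W w| <= M1].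
Proof. exact: (square_integrable mW limit_square). Qed.

(** The means are constant along the martingale, and L^1 convergence follows from the bound
    in L^2. *)
Lemma limit_mean : \int[P]_w W w = x u0.
Proof.
have [_ iW _] := limit_integrable.
apply/eqP; rewrite -subr_eq0 -normr_le0; apply/ler_addgt0Pr => e e0; rewrite add0r.
have [n Hn] := urn_fluctuation_small b S0 m0 mS large e0.
have gn0 : 0 < growth n by exact: g0.
have [iY hY] := limit_dist n.
have -> : \int[P]_w W w - x u0 = \int[P]_w (W w - normalised_urn n w).
  rewrite expectB ?expect_normalised//.
  exact/bounded_measurable_integrable/bounded_measurable_normalised.
apply: (@le_trans _ _ (\int[P]_w `|W w - normalised_urn n w|)).
  by apply: le_expect_norm => //; exact: (integrable_norm iY).
by rewrite -(ler_pM2l gn0) [leRHS]mulrC; apply: (le_trans hY); exact: Hn.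
Qed.


Lemma limit_law_in_M2 : in_M2 (kappa * x u0) (distribution P X).
Proof.
have [i2 i1 _] := limit_integrable.
have iX : P.-integrable setT (EFin \o X).
  rewrite (_ : EFin \o X = (fun w => (kappa%:E * (EFin \o W) w)%E)); first exact: integrableZl.
  by apply/funext => w /=; rewrite XE.
apply: in_M2_distribution => //.
  rewrite (_ : EFin \o _ = (fun w => ((kappa ^+ 2)%:E * (EFin \o (fun w => W w ^+ 2)%R) w)%E)); first exact: integrableZl.
  by apply/funext => w /=; rewrite XE exprMn.
by rewrite (eq_expect P XE) RintegralZl// limit_mean.
Qed.

Lemma limit_law_abs : \int[distribution P X]_y `|y| <= kappa * M1.
Proof.
have [i2 i1 h] := limit_integrable.
have iX : P.-integrable setT (EFin \o (fun w => `|X w|)).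
  rewrite (_ : EFin \o _ = (fun w => (kappa%:E * (EFin \o (fun w => `|W w|)%R) w)%E)).
    exact: (integrableZl _ _ (integrable_norm i1)).
  by apply/funext => w /=; rewrite [X in `|X|]XE normrM (gtr0_norm kap0).
rewrite expect_distribution//.
rewrite (eq_expect P (g := fun w => kappa * `|W w|)).
  rewrite RintegralZl//; last exact: (integrable_norm i1).
  by rewrite ler_pM2l.
by move=> w; rewrite [X in `|X|]XE normrM (gtr0_norm kap0).
Qed.

(** A Lipschitz test turns the distance in L^1 between u2 at time j and j^sigma X into the
    required bound. *)
Lemma limit_law_approx : urn_approx a b c d S sigma u0 (distribution P X) (urn_error a b c S).
Proof.
move=> j L h L0 [bh Lh]; have [i2 i1 hW] := limit_integrable.
have gj0 : 0 < growth j by exact: g0.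
set t := j%:R `^ sigma.
have mt : measurable_fun [set: R] (fun y : R => t * y) by exact: measurable_funM.
have mX : measurable_fun [set: T] X by exact: measurable_funPT.
have bth := bounded_measurable_comp mt bh.
have b2 : bounded_measurable (fun w => h (t * X w)) by exact: (bounded_measurable_comp mX bth).
rewrite expect_distribution; [|by have [] := bth|exact: bounded_measurable_integrable].
rewrite -(expect_urn j (fun u => h (x u))).
have b1 := bounded_measurable_urn j (fun u => h (x u)).
rewrite -expectB; [|exact: bounded_measurable_integrable..].
have [iY hY] := limit_dist j.
pose e1 w := L * growth j * `|W w - normalised_urn j w|.
pose e2 w := L * `|growth j - kappa * t| * `|W w|.
have ie1 : P.-integrable setT (EFin \o e1).
  apply: integrable_realZ; exact: (integrable_norm iY).
have ie2 : P.-integrable setT (EFin \o e2).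
  apply: integrable_realZ; exact: (integrable_norm i1).
apply: (@le_trans _ _ (\int[P]_w (e1 w + e2 w))).
  apply: le_expect_norm.
  - exact/bounded_measurable_integrable/bounded_measurableB.
  - by apply: integrable_realD.
  - move=> w; apply: (le_trans (Lh _ _)); rewrite /e1 /e2 -[L * growth j * _]mulrA -[L * `|_| * _]mulrA -mulrDr ler_wpM2l//.
    set y := x _.
    have -> : y - t * X w = - (growth j * (W w - normalised_urn j w)) + (growth j - kappa * t) * W w.
      have -> : y = growth j * normalised_urn j w by rewrite /normalised_urn mulrC divfK// gt_eqF.
      by rewrite XE; move: kappa => k; ring.
    by rewrite (le_trans (ler_normD _ _))// normrN !normrM (gtr0_norm gj0).
rewrite expectD// RintegralZl//; last exact: (integrable_norm iY).
rewrite RintegralZl//; last exact: (integrable_norm i1).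
rewrite /urn_error mulrDr -[L * growth j * _]mulrA -[L * `|_| * _]mulrA.
apply: lerD; first exact: ler_wpM2l.
by apply: ler_wpM2l => //; apply: ler_wpM2l.
Qed.

End almost_sure_limit.

End urn_limit_law.

(** * An urn process on the unit interval *)

Section uniform_intervals.
Context {R : realType}.
Local Notation P := (uniform_prob (@ltr01 R) : probability (measurableTypeR R) R).

Lemma uniform_prob_itv (l r : R) : 0 <= l -> l <= r -> r <= 1 -> P `[l, r[%classic = (r - l)%:E.
Proof.
move=> l0 lr r1.
transitivity (\int[lebesgue_measure]_(x in `[l, r[) (uniform_pdf 0 1 x)%:E)%E; first by [].
transitivity (\int[lebesgue_measure]_(x in `[l, r[) (1 : R)%:E)%E.
  apply: eq_integral => x; rewrite inE/= in_itv/= => /andP[lx xr].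
  by rewrite /uniform_pdf (le_trans l0 lx) (le_trans (ltW xr) r1)/= subr0 invr1.
rewrite integral_cst//= mul1e lebesgue_measure_itv/= lte_fin.
move: lr; rewrite le_eqVlt => /predU1P[->|lr]; first by rewrite ltxx subrr.
by rewrite lr -EFinB.
Qed.

(** A measurable set which meets [0,1[ in an interval; what happens outside [0,1[, where the
    histories below are not controlled, has probability 0. *)
Lemma uniform_prob_cell (A : set R) (l r : R) : 0 <= l -> l <= r -> r <= 1 ->
  measurable (A : set (measurableTypeR R)) -> (forall x, 0 <= x < 1 -> A x <-> l <= x < r) -> P A = (r - l)%:E.
Proof.
move=> l0 lr r1 mA AE.
have mI : measurable (`[0, 1[%classic : set (measurableTypeR R)) by exact: measurable_itv.
have PI : P `[0, 1[%classic = 1%E by rewrite uniform_prob_itv ?subr0.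
have PC : P (~` `[0, 1[%classic) = 0%E.
  by transitivity (1 - P `[0%R, 1%R[%classic)%E; [exact: probability_setC|rewrite PI subee].
rewrite -(setIT A) -(setvU `[0, 1[%classic) setIUr measureU; last 3 first.
- by apply: measurableI => //; exact: measurableC.
- exact: measurableI.
- by rewrite setIACA setIid setICl setI0.
rewrite [X in (X + _)%E](_ : _ = 0%E); last first.
  apply: (@subset_measure0 _ _ _ P _ (~` `[0, 1[%classic)) => //.
  - by apply: measurableI => //; exact: measurableC.
  - exact: measurableC.
rewrite add0e -uniform_prob_itv//; congr (P _).
apply/seteqP; split=> x /=.
  by rewrite !in_itv/= => -[Ax x01]; apply/(AE x x01).
rewrite !in_itv/= => /andP[lx xr].
have x01 : 0 <= x < 1 by rewrite (le_trans l0 lx) (lt_le_trans xr r1).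
by split=> //; apply/(AE x x01); rewrite lx.
Qed.

End uniform_intervals.

Section interval_process.
Context {R : realType} (a b c d S : nat).
Hypotheses (hS1 : (a + b)%N = S) (hS2 : (c + d)%N = S).
Variable u0 : nat * nat.
Hypothesis u0_gt0 : (0 < urn_size u0)%N.
Local Notation I01 := (measurableTypeR R).
Local Notation P := (uniform_prob (@ltr01 R) : probability I01 R).

Definition red_share (u : nat * nat) : R := u.1%:R / (urn_size u)%:R.

Definition cell_step (s : R * R * (nat * nat)) (r : bool) : R * R * (nat * nat) :=
  let p := red_share s.2 in
  (if r then (s.1.1, s.1.2 * p) else (s.1.1 + s.1.2 * p, s.1.2 * (1 - p)), urn_step a b c d s.2 r).

(** The interval of the points whose first draws are h, given by its left end and its
    length, with the composition of the urn after h. *)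
Definition cell (h : seq bool) := foldl cell_step (0, 1, u0) h.

(** The interval of h is cut in the proportion of red balls; the left part is the interval
    of h followed by a red draw. *)
Definition cell_cut (h : seq bool) : R := (cell h).1.1 + (cell h).1.2 * red_share (cell h).2.

Fixpoint cell_history (n : nat) (x : R) : seq bool :=
  if n is n'.+1 then rcons (cell_history n' x) (x < cell_cut (cell_history n' x)) else [::].

Definition cell_draw (n : nat) (x : I01) : bool := x < cell_cut (cell_history n x).

Lemma mkseq_cell_draw n x : mkseq (fun i => cell_draw i x) n = cell_history n x.
Proof. by elim: n => [//|n IH]; rewrite mkseqS IH. Qed.

Lemma cell_urn h : (cell h).2 = urn_after a b c d u0 h.
Proof.
elim/last_ind: h => [//|h r IH].
by rewrite /cell /urn_after !foldl_rcons -/(cell h) /= IH.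
Qed.

Lemma red_share01 u : 0 <= red_share u <= 1.
Proof.
rewrite /red_share divr_ge0//=; have [->|u1] := posnP (urn_size u).
  by rewrite invr0 mulr0.
by rewrite ler_pdivrMr ?ltr0n// mul1r ler_nat leq_addr.
Qed.

Lemma cell_bounds h : [/\ 0 <= (cell h).1.1, 0 <= (cell h).1.2 & (cell h).1.1 + (cell h).1.2 <= 1].
Proof.
elim/last_ind: h => [|h r]; first by rewrite /= add0r.
rewrite /cell foldl_rcons -/(cell h); case: (cell h) => [[l w] u] /= [l0 w0 lw].
have /andP[p0 p1] := red_share01 u.
have wp0 : 0 <= w * red_share u by rewrite mulr_ge0.
have wp1 : w * red_share u <= w by rewrite ler_piMr.
by case: r => /=; rewrite ?mulrBr ?mulr1; split => //; lra.
Qed.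

(** On [0,1[ the prefix read off a point is h exactly when the point lies in the interval of
    h. *)
Lemma cell_historyP h x : 0 <= x < 1 ->
  cell_history (size h) x = h <-> (cell h).1.1 <= x < (cell h).1.1 + (cell h).1.2.
Proof.
move=> x01; elim/last_ind: h => [|h r IH]; first by rewrite /= add0r.
rewrite size_rcons /=; split.
  move=> /rcons_inj[hE]; rewrite hE => rE.
  have /IH := hE; rewrite -rE /cell_cut /cell foldl_rcons -/(cell h).
  case: (cell h) => [[l w] u] /= /andP[lx xr].
  have [xc|xc] := ltP x (l + w * red_share u); first by rewrite /= lx.
  by rewrite /= mulrBr mulr1 xc/=; lra.
have /andP[p0 p1] := red_share01 (cell h).2.
have [_ w0 _] := cell_bounds h.
rewrite /cell foldl_rcons -/(cell h) => H.
suff [hh rr] : (cell h).1.1 <= x < (cell h).1.1 + (cell h).1.2 /\ (x < cell_cut h) = r.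
  by move/IH: hh => ->; rewrite rr.
move: w0 H; rewrite /cell_cut; move: (cell h) p0 p1 => [[l w] u] /= p0 p1 w0.
have wp0 : 0 <= w * red_share u by rewrite mulr_ge0.
have wp1 : w * red_share u <= w by rewrite ler_piMr.
case: r => /= /andP[lx xr].
  by rewrite lx xr; split=> //=; lra.
split; last by apply/negbTE; rewrite -leNgt.
move: xr; rewrite mulrBr mulr1 => xr; apply/andP; split; lra.
Qed.

Lemma measurable_cell_history n h : measurable [set x : I01 | cell_history n x = h].
Proof.
elim: n h => [|n IH] h /=.
  have [->|hn] := eqVneq h [::]; first by rewrite (_ : [set x | _] = setT)//; apply/seteqP; split.
  rewrite (_ : [set x | _] = set0)//; apply/seteqP; split=> x //= H.
  by move: hn; rewrite -H.
case/lastP: h => [|h r].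
  rewrite (_ : [set x | _] = set0)//; apply/seteqP; split=> x //=.
  by case: (cell_history n x).
have mc : measurable [set x : I01 | (x < cell_cut h) = r].
  have mlt : measurable_fun [set: I01] (fun x : I01 => x < cell_cut h).
    by apply: measurable_fun_ltr => //; exact: measurable_id.
  by have := mlt measurableT [set r] I; rewrite setTI.
rewrite (_ : [set x | _] = [set x : I01 | cell_history n x = h] `&` [set x : I01 | (x < cell_cut h) = r]).
  by apply: measurableI => //; exact: IH.
apply/seteqP; split=> x /=; first by move=> /rcons_inj[-> ->].
by move=> [-> ->].
Qed.

Lemma size_cell_history n x : size (cell_history n x) = n.
Proof. by elim: n => [//|n IH] /=; rewrite size_rcons IH. Qed.

Lemma measurable_cell_draw n : measurable_fun [set: I01] (cell_draw n).
Proof.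
apply: (@measurable_fun_bool _ _ _ _ true); rewrite setTI.
rewrite (_ : _ @^-1` _ = \bigcup_(t in [set: n.-tuple bool]) [set x : I01 | cell_history n.+1 x = rcons t true]).
  by apply: fin_bigcup_measurable => // t _; exact: measurable_cell_history.
apply/seteqP; split=> x /=; rewrite /cell_draw.
  move=> H; exists (Tuple (introT eqP (size_cell_history n x))) => //=.
  by rewrite H.
by move=> [t _ /= /rcons_inj[_ ->]].
Qed.

Definition cell_draw_RV (n : nat) : {RV P >-> bool} := mfun_of (measurable_cell_draw n).

(** The uniform probability of an interval is its length, and the cut gives the prescribed
    conditional probability. *)
Lemma urn_draws_cell : urn_draws a b c d u0 cell_draw_RV.
Proof.
move=> h /=.
have [l0 w0 lw] := cell_bounds h.
have E1 : P [set w | mkseq (fun i => cell_draw i w) (size h) = h] = ((cell h).1.2)%:E.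
  rewrite (@uniform_prob_cell _ _ (cell h).1.1 ((cell h).1.1 + (cell h).1.2))//.
  - by rewrite addrAC subrr add0r.
  - by rewrite lerDl.
  - under eq_set do rewrite mkseq_cell_draw; exact: measurable_cell_history.
  - by move=> x x01; rewrite /= mkseq_cell_draw; exact: cell_historyP.
rewrite E1 -EFinM.
have /andP[p0 p1] := red_share01 (cell h).2.
have E x : (mkseq (fun i => cell_draw i x) (size h) = h /\ cell_draw (size h) x = true) <->
    cell_history (size (rcons h true)) x = rcons h true.
  rewrite mkseq_cell_draw size_rcons /= /cell_draw; split; first by move=> [-> ->].
  by move=> /rcons_inj[-> ->].
rewrite (@uniform_prob_cell _ _ (cell h).1.1 ((cell h).1.1 + (cell h).1.2 * red_share (cell h).2))//.
- by rewrite addrAC subrr add0r cell_urn.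
- by rewrite lerDl mulr_ge0.
- by apply: le_trans lw; rewrite lerD2l ler_piMr.
- rewrite (_ : [set w | _] = [set x : I01 | cell_history (size (rcons h true)) x = rcons h true]).
    exact: measurable_cell_history.
  by apply/seteqP; split=> x /= /E.
- move=> x x01; rewrite /= E cell_historyP// /cell foldl_rcons -/(cell h).
  by case: (cell h) => [[l w] u].
Qed.

End interval_process.

(** * Scaling of solutions and the theorem *)

Section scaling.
Context {R : realType}.
Implicit Types (mu nu : probability R R) (t : R).

Lemma measurable_scaling t : measurable_fun [set: R] (fun x : R => t * x).
Proof. exact: measurable_funM. Qed.

Definition scaled_law t mu : probability R R := distribution mu (mfun_of (measurable_scaling t)).

Lemma in_M2_scaled t A mu : in_M2 A mu -> in_M2 (t * A) (scaled_law t mu).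
Proof.
move=> /in_M2_integrable[i1 i2 EA]; apply: in_M2_distribution.
- exact: integrable_realZ.
- rewrite (_ : EFin \o _ = (fun w => ((t ^+ 2)%:E * (EFin \o (fun x : R => x ^+ 2)%R) w)%E)).
    exact: (integrableZl _ _ i2).
  by apply/funext => w /=; rewrite exprMn.
- by rewrite -EA RintegralZl.
Qed.

Lemma has_law_scaled d (T : measurableType d) (P : probability T R) (F : T -> R) t mu :
  has_law P F mu -> has_law P (fun w => t * F w) (scaled_law t mu).
Proof.
move=> h A mA; apply: (h ((fun x : R => t * x) @^-1` A)).
by rewrite -[X in measurable X]setTI; exact: measurable_scaling.
Qed.

Lemma solves_system_scaled (a c S : nat) (sigma t : R) mu nu :
  solves_system a c S sigma mu nu ->
  solves_system a c S sigma (scaled_law t mu) (scaled_law t nu).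
Proof.
move=> [d [T [P [D [V [X [Y [hV hXY ind h1 h2]]]]]]]].
have mt (Z : {RV P >-> R}) : measurable_fun [set: T] (fun w => t * Z w).
  by apply: measurable_funM => //; exact: measurable_funPT.
exists d, T, P, D, V, (fun k => mfun_of (mt (X k))), (fun k => mfun_of (mt (Y k))).
have E (s : 'I_S.+1 -> T -> R) p :
  (fun w => \sum_(k < S.+1 | (k < p)%N) s k w * (t * X k w) +
            \sum_(k < S.+1 | (p <= k)%N) s k w * (t * Y k w)) =
  (fun w => t * (\sum_(k < S.+1 | (k < p)%N) s k w * X k w +
            \sum_(k < S.+1 | (p <= k)%N) s k w * Y k w)).
  apply/funext => w; rewrite mulrDr !mulr_sumr.
  by congr (_ + _); apply: eq_bigr => k _; rewrite mulrCA.
split=> //.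
- by move=> k; have [hX hY] := hXY k; split; exact: has_law_scaled.
- move=> A B C mA mB mC.
  have mp (Q : set R) : measurable Q -> measurable ((fun x : R => t * x) @^-1` Q).
    by move=> mQ; rewrite -[X in measurable X]setTI; exact: measurable_scaling.
  exact: (ind A (fun k => (fun x : R => t * x) @^-1` B k) (fun k => (fun x : R => t * x) @^-1` C k)
    mA (fun k => mp _ (mB k)) (fun k => mp _ (mC k))).
- by rewrite (E (fun k w => tnth (V w) k `^ sigma)); exact: has_law_scaled.
- by rewrite (E (fun k w => tnth (V w) k `^ sigma)); exact: has_law_scaled.
Qed.

End scaling.

Section urn_solution.
Context {R : realType} (a b c d S : nat).
Hypotheses (hS1 : (a + b)%N = S) (hS2 : (c + d)%N = S).
Hypothesis S0 : (0 < S)%N.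
Let m : R := a%:R - c%:R.
Hypotheses (m0 : 0 < m) (mS : m < S%:R) (large : S%:R < 2 * m).
Let sigma := m / S%:R.
Local Notation kappa := (growth_limit a c S : R).
Variable D : probability (S.+1.-tuple R) R.
Hypotheses (dD : is_dirichlet (fun=> S%:R^-1) D) (dp : dirichlet_powers D S%:R^-1).

Lemma sum_ord_lt n p : (\sum_(k < n) (k < p) = minn n p)%N.
Proof.
elim: n => [|n IH]; first by rewrite big_ord0 min0n.
by rewrite big_ord_recr/= IH; lia.
Qed.

(** After the first draw from a single ball, the urn is the union of S + 1 single balls, of
    which the first p are red. *)
Lemma urn_total_balls n p : (p <= n)%N ->
  urn_total (fun k : 'I_n => unit_ball (k < p)%N) = (p, n - p)%N.
Proof.
move=> pn; rewrite /urn_total /unit_ball.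
have E1 : (\sum_(k < n) (if (k < p)%N then (1, 0) else (0, 1)).1 = p)%N.
  rewrite -[RHS](minn_idPr pn) -sum_ord_lt; apply: eq_bigr => k _; by case: ifP.
have E2 : (\sum_(k < n) (if (k < p)%N then (1, 0) else (0, 1)).1 +
           \sum_(k < n) (if (k < p)%N then (1, 0) else (0, 1)).2 = n)%N.
  rewrite -big_split/= -[RHS]card_ord -sum1_card; apply: eq_bigr => k _; by case: ifP.
rewrite E1; congr pair; apply/eqP.
by rewrite -(eqn_add2l p) subnKC// -[X in (X + _)%N == _]E1 E2.
Qed.

Lemma urn_mean_first n (red : bool) (g : nat * nat -> R) :
  urn_mean a b c d n.+1 (unit_ball red) g =
  urn_mean a b c d n (urn_total (fun k : 'I_S.+1 => unit_ball (k < if red then a.+1 else c)%N)) g.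
Proof.
rewrite urn_total_balls; last by case: red; lia.
case: red; rewrite /= /urn_size /urn_step /= mul1r mul0r ?addr0 ?add0r divr1;
  congr (urn_mean _ _ _ _ _ _ _); congr pair; lia.
Qed.

Lemma urn_laws_solve (mu nu : probability R R) M :
  (forall red : bool, (if red then mu else nu).-integrable setT (EFin \o (@id R))) ->
  (forall red : bool, \int[if red then mu else nu]_y `|y| <= M) ->
  (forall red : bool, urn_approx a b c d S sigma (unit_ball red) (if red then mu else nu) (urn_error a b c S)) ->
  solves_system a c S sigma mu nu.
Proof.
move=> im iM ap.
have sg : 0 < sigma <= 1 by rewrite divr_gt0 ?ltr0n//= ler_pdivrMr ?ltr0n// mul1r ltW.
have small := urn_error_small b S0 m0 mS large.
have key (red : bool) : smoothing_image D sigma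
    (fun k : 'I_S.+1 => k < if red then a.+1 else c)%N mu nu (if red then mu else nu).
  move=> L f /smooth_lipschitz_test[K K0 Kf].
  exact: (urn_smoothing hS1 hS2 S0 sg dD dp im iM ap small K0 Kf
    (fun n g => urn_mean_first n red g) (ap red)).
exact: (smoothing_solves_system dD (key true) (key false)).
Qed.

(** The limit laws may be taken along subsequences and on different spaces, because only
    their distributions enter. *)
Lemma urn_limits_solve (d1 d2 : measure_display)
     (T1 : measurableType d1) (T2 : measurableType d2)
     (P1 : probability T1 R) (P2 : probability T2 R)
     (draw1 : nat -> {RV P1 >-> bool}) (draw2 : nat -> {RV P2 >-> bool})
     (X : {RV P1 >-> R}) (Y : {RV P2 >-> R}) (phi psi : nat -> nat) :
  urn_draws a b c d (unit_ball true) draw1 -> urn_draws a b c d (unit_ball false) draw2 ->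
  (forall n, (n <= phi n)%N) -> (forall n, (n <= psi n)%N) ->
  {ae P1, forall w, normalised_urn a b c d S draw1 true (phi n) w @[n --> \oo] --> X w / kappa} ->
  {ae P2, forall w, normalised_urn a b c d S draw2 false (psi n) w @[n --> \oo] --> Y w / kappa} ->
  [/\ in_M2 (kappa * (b%:R / S%:R)) (distribution P1 X),
      in_M2 (- (kappa * (c%:R / S%:R))) (distribution P2 Y) &
      solves_system a c S sigma (distribution P1 X) (distribution P2 Y)].
Proof.
move=> h1 h2 p1 p2 l1 l2.
have M1 := limit_law_in_M2 hS1 hS2 S0 m0 mS large h1 p1 l1.
have M2 := limit_law_in_M2 hS1 hS2 S0 m0 mS large h2 p2 l2.
split.
- by move: M1; rewrite /u2 /= mulr1 mulr0 subr0.
- by move: M2; rewrite /u2 /= mulr1 mulr0 sub0r mulNr mulrN.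
apply: (@urn_laws_solve _ _ (kappa * mean_bound a b c S)) => -[].
- by have [] := in_M2_integrable M1.
- by have [] := in_M2_integrable M2.
- exact: (limit_law_abs hS1 hS2 S0 m0 large h1 p1 l1).
- exact: (limit_law_abs hS1 hS2 S0 m0 large h2 p2 l2).
- exact: (limit_law_approx hS1 hS2 S0 m0 large h1 p1 l1).
- exact: (limit_law_approx hS1 hS2 S0 m0 large h2 p2 l2).
Qed.

Lemma urn_solution_exists : exists mu nu : probability R R,
  [/\ in_M2 (kappa * (b%:R / S%:R)) mu, in_M2 (- (kappa * (c%:R / S%:R))) nu &
      solves_system a c S sigma mu nu].
Proof.
have kap0 : 0 < kappa by exact: growth_limit_gt0.
have ex (red : bool) : exists (P : probability (measurableTypeR R) R)
    (draw : nat -> {RV P >-> bool}) (X : {RV P >-> R}) (phi : nat -> nat),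
    [/\ urn_draws a b c d (unit_ball red) draw, forall n, (n <= phi n)%N &
     {ae P, forall w, normalised_urn a b c d S draw red (phi n) w @[n --> \oo] --> X w / kappa}].
  have u0 : (0 < urn_size (unit_ball red))%N by case: red.
  have hd := @urn_draws_cell R a b c d (unit_ball red).
  have [W [phi [mW p l]]] := normalised_urn_ae_cvg hS1 hS2 S0 m0 mS large hd.
  have mX : measurable_fun setT (fun w => kappa * W w) by exact: measurable_funM.
  exists (uniform_prob (@ltr01 R)), (cell_draw_RV a b c d (unit_ball red)), (mfun_of mX), phi.
  split=> //.
  case: l => N [mN N0 sN]; exists N; split=> // w /= h; apply: sN => /= cw; apply: h.
  by rewrite mulrC mulKf ?gt_eqF.
have [P1 [draw1 [X [phi [h1 p1 l1]]]]] := ex true.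
have [P2 [draw2 [Y [psi [h2 p2 l2]]]]] := ex false.
by exists (distribution P1 X), (distribution P2 Y); exact: (urn_limits_solve h1 h2 p1 p2 l1 l2).
Qed.

(** Dividing by n^sigma or by the growth factor of the mean differs by the factor kappa in
    the limit. *)
Lemma normalised_urn_cvg (disp : measure_display) (T : measurableType disp) (P : probability T R)
    (draw : nat -> {RV P >-> bool}) (red : bool) (w : T) (l : R) :
  u2 R b c S (urn_composition a b c d (unit_ball red) draw n w) / n%:R `^ sigma @[n --> \oo] --> l ->
  normalised_urn a b c d S draw red n w @[n --> \oo] --> l / kappa.
Proof.
have kap0 : 0 < kappa by exact: growth_limit_gt0.
move=> h; have hg := urn_growth_cvg S0 m0 mS.
pose v n := u2 R b c S (urn_composition a b c d (unit_ball red) draw n w) / n%:R `^ sigma.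
have H : v n * (urn_growth a c S n 1 / n%:R `^ sigma)^-1 @[n --> \oo] --> l / kappa.
  by apply: cvgM; [exact: h|apply: cvgV; [exact: lt0r_neq0|exact: hg]].
rewrite -(cvg_shiftn 1) in H; rewrite -(cvg_shiftn 1).
suff -> : (fun n => normalised_urn a b c d S draw red (n + 1) w) =
  (fun n => v (n + 1)%N * (urn_growth a c S (n + 1) 1 / (n + 1)%:R `^ sigma)^-1) by exact: H.
apply/funext => n; rewrite /normalised_urn /v.
have n0 : (n + 1)%:R `^ sigma != 0 :> R by rewrite gt_eqF// powR_gt0// ltr0n addn1.
have g0 : urn_growth a c S (n + 1) 1 != 0 :> R by rewrite gt_eqF// urn_growth_gt0.
by field; rewrite n0 g0.
Qed.

End urn_solution.

Theorem theorem7 (R : realType) (a b c d S : nat) (m sigma : R)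
  (hS1 : (a + b)%N = S) (hS2 : (c + d)%N = S) (hbc : (b * c)%N <> 0%N)
  (hm : m = a%:R - c%:R) (hsigma : sigma = m / S%:R)
  (hlarge : 2%:R^-1 < sigma) :
  (forall B C : R, c%:R * B + b%:R * C = 0 ->
     exists mu nu : probability R R,
       is_unique_solution a c S sigma B C mu nu)
  /\
  (forall (d1 d2 : measure_display)
     (T1 : measurableType d1) (T2 : measurableType d2)
     (P1 : probability T1 R) (P2 : probability T2 R)
     (draw1 : nat -> {RV P1 >-> bool}) (draw2 : nat -> {RV P2 >-> bool})
     (X : {RV P1 >-> R}) (Y : {RV P2 >-> R}),
     is_WDT a b c d S sigma (1%N, 0%N) draw1 X ->
     is_WDT a b c d S sigma (0%N, 1%N) draw2 Y ->
     is_unique_solution a c S sigma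
       (Gamma (S%:R^-1) / Gamma ((m + 1) / S%:R) * (b%:R / S%:R))
       (- (Gamma (S%:R^-1) / Gamma ((m + 1) / S%:R) * (c%:R / S%:R)))
       (distribution P1 X) (distribution P2 Y)).
Proof.
have b0 : (0 < b)%N by lia.
have c0 : (0 < c)%N by lia.
have S0 : (0 < S)%N by lia.
have Sr0 : 0 < S%:R :> R by rewrite ltr0n.
have large : S%:R < 2 * m.
  by move: hlarge; rewrite hsigma ltr_pdivlMr// => h; lra.
have m0 : 0 < m by lra.
have aS : a%:R <= S%:R :> R by rewrite ler_nat -hS1 leq_addr.
have cr0 : 0 < c%:R :> R by rewrite ltr0n.
have br0 : 0 < b%:R :> R by rewrite ltr0n.
have mS : m < S%:R by rewrite hm; lra.
have ca : (c < a)%N by rewrite -(ltr_nat R); rewrite hm in m0; lra.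
have p0 : 0 < S%:R^-1 :> R by rewrite invr_gt0.
have p1 : S%:R^-1 != 1 :> R.
  by rewrite invr_eq1 (eqr_nat R S 1); apply/eqP; lia.
have [D [dD dp]] := dirichlet_exists S p0 p1.
have s1 : 1 < 2 * sigma by lra.
have uniq B C mu nu mu' nu' : in_M2 B mu -> in_M2 C nu -> solves_system a c S sigma mu nu ->
    in_M2 B mu' -> in_M2 C nu' -> solves_system a c S sigma mu' nu' -> same_law mu' mu /\ same_law nu' nu.
  move=> h1 h2 h3 h4 h5 h6.
  exact: (system_unique S0 dD dp s1 h1 h2 h4 h5 h3 h6).
rewrite hm in m0 mS large; rewrite hsigma hm in uniq *.
have kap0 := growth_limit_gt0 S0 m0.
split.
- move=> B C BC.
  have [mu [nu [h1 h2 h3]]] := urn_solution_exists hS1 hS2 S0 m0 mS large dD dp.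
  (* the ratio of the prescribed mean B of X to that of the urn limit *)
  pose t := B / (growth_limit a c S * (b%:R / S%:R)).
  have tB : t * (growth_limit a c S * (b%:R / S%:R)) = B.
    by rewrite /t divfK// gt_eqF// mulr_gt0// divr_gt0.
  have tC : t * - (growth_limit a c S * (c%:R / S%:R)) = C.
    apply: (mulfI (lt0r_neq0 br0)).
    have -> : b%:R * C = - (c%:R * B) by lra.
    rewrite -tB; move: (growth_limit _ _ _) => k; ring.
  exists (scaled_law t mu), (scaled_law t nu).
  have M1 := in_M2_scaled t h1; rewrite tB in M1.
  have M2 := in_M2_scaled t h2; rewrite tC in M2.
  have M3 := solves_system_scaled t h3.
  split; [exact: M1|exact: M2|exact: M3|move=> mu' nu' g1 g2 g3].
  exact: (uniq _ _ _ _ _ _ M1 M2 M3 g1 g2 g3).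
- move=> d1 d2 T1 T2 P1 P2 draw1 draw2 X Y [h1 l1] [h2 l2].
  have kE : Gamma S%:R^-1 / Gamma ((a%:R - c%:R + 1) / S%:R) = growth_limit a c S :> R.
    by rewrite /growth_limit addrC mulrDl mul1r addrC.
  rewrite kE.
  have c1 : {ae P1, forall w, normalised_urn a b c d S draw1 true n w @[n --> \oo] --> X w / growth_limit a c S}.
    case: l1 => N [mN N0 sN]; exists N; split; [exact: mN|exact: N0|move=> w /= h; apply: sN => /= cw; apply: h].
    exact: (@normalised_urn_cvg R a b c d S S0 m0 mS _ _ _ draw1 true w _ cw).
  have c2 : {ae P2, forall w, normalised_urn a b c d S draw2 false n w @[n --> \oo] --> Y w / growth_limit a c S}.
    case: l2 => N [mN N0 sN]; exists N; split; [exact: mN|exact: N0|move=> w /= h; apply: sN => /= cw; apply: h].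
    exact: (@normalised_urn_cvg R a b c d S S0 m0 mS _ _ _ draw2 false w _ cw).
  have [M1 M2 M3] := urn_limits_solve hS1 hS2 S0 m0 mS large dD dp h1 h2
    (fun n => leqnn n) (fun n => leqnn n) c1 c2.
  split; [exact: M1|exact: M2|exact: M3|move=> mu' nu' g1 g2 g3].
  exact: (uniq _ _ _ _ _ _ M1 M2 M3 g1 g2 g3).
Qed.
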